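(* Let $F(t,z)\not\equiv 0$ be an entire function on $\mathbb{C}^2$ satisfying the heat equation $\partial_tF=\partial_z^2F$, whose initial condition $f(z)=F(0,z)$ is even and whose $z$-order $\rho_z$ satisfies $\rho_z<2$. Then $F(t,\cdot)$ is even for every $t$; write $F(t,z)=\Phi(t,z^2)$ with $\Phi(t,\mu)$ entire in $(t,\mu)$, and let $\mu_1(t),\mu_2(t),\ldots$ be the zeros of $\Phi(t,\cdot)$, listed with multiplicity (so that the zeros of $F(t,\cdot)$ are $\pm z_1(t),\pm z_2(t),\ldots$ with $\mu_k(t)=z_k(t)^2$). Let $\mu_k(t)$ be a branch of these zeros, i.e. a holomorphic function on a domain $D\subset\mathbb{C}$ with $\Phi(t,\mu_k(t))=0$ for all $t\in D$. Then $$\mu_k'(t)=-2-8\mu_k(t)\sum_{j\neq k}\frac{1}{\mu_k(t)-\mu_j(t)}$$ for all $t\in D$ except for a discrete subset of $D$, where for each $t$ the sum runs over all the other zeros $\mu_j(t)$ of $\Phi(t,\cdot)$.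
   Context: The $z$-order of $F$ is the order of the entire function $z\mapsto F(t,z)$, which does not depend on $t\in\mathbb{C}$. The order of an entire function $g$ is $\limsup_{r\to\infty}\frac{\ln\ln M(r)}{\ln r}$ with $M(r)=\max_{|z|=r}|g(z)|$. A discrete subset of $D$ means a subset without accumulation points in $D$. *)

(* Defs.v *)
From HB Require Import structures.
From mathcomp Require Import all_boot all_order all_algebra.
From mathcomp Require Import complex.
From mathcomp Require Import all_classical all_reals all_analysis.

Set Implicit Arguments.
Unset Strict Implicit.
Unset Printing Implicit Defensive.

Import Order.TTheory GRing.Theory Num.Theory.
Import numFieldNormedType.Exports.

Local Open Scope classical_set_scope.
Local Open Scope ring_scope.
Local Open Scope complex_scope.

(* The topology and the norm of R[i] as a one-dimensional space over itself. *)
#[export, non_forgetful_inheritance]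
HB.instance Definition _ (R : rcfType) := NormedModule.copy R[i] R[i]^o.

Section Entire.
Variable R : realType.
Local Notation C := R[i].

(* The base field in [differentiable] and [derivable] below is R[i], so these
   are complex differentiability conditions. *)
Definition holomorphic_on (D : set C) (g : C -> C) : Prop :=
  forall t, D t -> derivable g t 1.

Definition entire2 (F : C -> C -> C) : Prop :=
  forall p : C * C, differentiable (fun q : C * C => F q.1 q.2) p.

Definition heat_equation (F : C -> C -> C) : Prop :=
  forall t z : C, derive1 (F ^~ z) t = derive1n 2 (F t) z.

(* For continuous g and r >= 0, the circle is compact, so this supremum is a
   maximum. *)
Definition max_modulus (g : C -> C) (r : R) : R :=
  sup [set ComplexField.Normc.normc (g z)
      | z in [set z | ComplexField.Normc.normc z = r]].

Definition growth_order (g : C -> C) : \bar R :=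
  limf_esup (fun r : R => (ln (ln (max_modulus g r)) / ln r)%:E) +oo%R.

(* The order of F t does not depend on t when F is an entire solution of the
   heat equation; it is read off at t = 0. *)
Definition z_order (F : C -> C -> C) : \bar R := growth_order (F 0).

Definition domain (D : set C) : Prop :=
  [/\ open D, connected D & D !=set0].

Definition discrete_subset (E D : set C) : Prop :=
  E `<=` D /\ forall t, D t -> ~ limit_point E t.

(* w is a zero of g of multiplicity exactly n (n = 0: not a zero). *)
Definition zero_multiplicity (g : C -> C) (w : C) (n : nat) : Prop :=
  (forall i, (i < n)%N -> derive1n i g w = 0) /\ derive1n n g w != 0.

(* The family (nu j)_(j in J) lists the zeros of g with multiplicity.  The index
   set J is an arbitrary set of naturals, finite or infinite, because g may have
   finitely or infinitely many zeros; nu is irrelevant outside J. *)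
Definition lists_zeros (g : C -> C) (J : set nat) (nu : nat -> C) : Prop :=
  forall w : C, exists n : nat,
    zero_multiplicity g w n /\ ([set j | J j /\ nu j = w] #= `I_n)%card.

(* Partial sums of 1 / (nu k - nu j) over the j in J other than k. *)
Definition other_zeros_series (J : set nat) (nu : nat -> C) (k : nat) :
    nat -> C :=
  series (fun j => if j \in J `\ k then (nu k - nu j)^-1 else 0).

End Entire.

(* Main.v *)
Require Import Defs.
From HB Require Import structures.
From mathcomp Require Import all_boot all_order all_algebra.
From mathcomp Require Import complex finmap.
From mathcomp Require Import all_classical all_reals all_analysis.
From mathcomp Require Import ring lra.

Set Implicit Arguments.
Unset Strict Implicit.
Unset Printing Implicit Defensive.

Import Order.TTheory GRing.Theory Num.Theory.
Import numFieldNormedType.Exports.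

Local Open Scope classical_set_scope.
Local Open Scope ring_scope.
Local Open Scope complex_scope.

(** Write [D1], [D2] for the partial derivatives.  Evenness: the heat equation turns the
    time derivatives of F at t = 0 into z-derivatives of even order of the initial condition
    ([heat_derive1n]), so F t (- z) and F t z have the same Taylor series in t ([heat_even]).
    The even entire functions F t are entire in z ^ 2, which gives Phi, and the heat equation
    becomes D1 Phi = 2 D2 Phi + 4 mu D2 (D2 Phi) ([Phi_pde]).

    Along a branch with D2 Phi != 0, differentiating Phi t (mu t) = 0 gives
    mu' = - 2 - 4 mu D2 (D2 Phi) / D2 Phi ([branch_velocity]).  If Phi t z = (z - a) * u z
    with a = mu t, the quotient D2 (D2 Phi) / D2 Phi at a is 2 u'(a) / u(a)
    ([second_derivative_factor]).  So the formula says that u'(a) / u(a) is the sum of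
    1 / (a - nu j) over the zeros nu j of u ([log_derivative_series]).  This is the logarithmic
    derivative of the Hadamard product of a function of order less than one, obtained here by
    a direct estimate.  Divide u by the product of z - nu j over the zeros in the disc of radius 4 ^ k
    about a.  The quotient v has no zero in this disc, and ln |v / v(a)| is there at most a
    constant times q ^ k for some q < 4.  The Borel-Caratheodory inequality bounds v'(a) / v(a) by a
    multiple of (q / 4) ^ k, and v'(a) / v(a) is the error of the partial sum over the zeros
    in the disc.  A count of zeros in the spirit of Jensen's formula bounds the sum over the
    zeros outside by a multiple of (q / 4) ^ k as well, so the series converges for every
    enumeration of the zeros.

    The order is only given at t = 0.  Cauchy estimates for the z-derivatives of F 0,
    inserted in the Taylor series in t, carry the bound to the other times
    ([growth_in_time]); order less than 2 in z is order less than 1 in z ^ 2 ([Phi_growth]).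

    The exceptional set consists of the zeros of t |-> D2 Phi t (mu t).  It is discrete by
    the identity theorem ([identity_domain]) unless this function vanishes identically.  Then
    the equation satisfied by Phi makes all the derivatives of some Phi t vanish at mu t
    ([multiple_branch]), so F t is zero for one t, hence for all t ([heat_zero]).

    The function theory rests on Goursat's theorem for rectangles ([goursat]).  Pulled back
    by the exponential, it says that the mean of a holomorphic function over a circle is its
    value at the centre ([circle_mean]); applied to a difference quotient this is Cauchy's
    integral formula, from which the Taylor expansion with remainder follows
    ([taylor_exists]). *)

(** * Modulus and complex derivative *)

Section Norm.
Variable R : realType.
Local Notation C := R[i].
Local Notation N := (@ComplexField.Normc.normc R).
Local Notation Re := (@complex.Re R).
Local Notation Im := (@complex.Im R).

Lemma normE (z : C) : `|z| = (N z)%:C. Proof. by []. Qed.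

Lemma N_ge0 (z : C) : 0 <= N z.
Proof. by case: z => a b; exact: sqrtr_ge0. Qed.

Lemma NM (x y : C) : N (x * y) = N x * N y.
Proof. exact: ComplexField.Normc.normcM. Qed.

Lemma ND (x y : C) : N (x + y) <= N x + N y.
Proof. exact: le_normcD. Qed.

Lemma NN (x : C) : N (- x) = N x.
Proof. exact: normcN. Qed.

Lemma NB (x y : C) : N (x - y) <= N x + N y.
Proof. by rewrite -(NN y); exact: ND. Qed.

Lemma NBC (x y : C) : N (x - y) = N (y - x).
Proof. by rewrite -NN opprB. Qed.

Lemma N_real (x : R) : N x%:C = `|x|.
Proof. by rewrite /= expr0n addr0 sqrtr_sqr. Qed.

Lemma N0 : N 0 = 0. Proof. by rewrite -[0]/(0%:C) N_real normr0. Qed.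
Lemma N1 : N 1 = 1. Proof. by rewrite -[1]/(1%:C) N_real normr1. Qed.

Lemma N_eq0 (z : C) : (N z == 0) = (z == 0).
Proof.
by apply/eqP/eqP => [/ComplexField.Normc.eq0_normc//|->]; exact: N0.
Qed.

Lemma N_gt0 (z : C) : (0 < N z) = (z != 0).
Proof. by rewrite lt_neqAle N_ge0 andbT eq_sym N_eq0. Qed.

Lemma NV (z : C) : N z^-1 = (N z)^-1.
Proof. exact: ComplexField.Normc.normcV. Qed.

Lemma NX (z : C) n : N (z ^+ n) = N z ^+ n.
Proof. by elim: n => [|n IH]; rewrite ?expr0 ?N1// !exprS NM IH. Qed.

Lemma N_nat n : N n%:R = n%:R.
Proof. by rewrite -(rmorph_nat (@real_complex R)) N_real normr_nat. Qed.

Lemma NB_ge (x y : C) : N x - N y <= N (x - y).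
Proof. by rewrite lerBlDr; apply: le_trans (ND _ _); rewrite subrK. Qed.

Lemma N_sum (I : Type) (s : seq I) (P : pred I) (f : I -> C) :
  N (\sum_(i <- s | P i) f i) <= \sum_(i <- s | P i) N (f i).
Proof.
elim/big_rec2 : _ => [|i x y _ le]; first by rewrite N0.
by apply: le_trans (ND _ _) _; rewrite lerD2l.
Qed.

Lemma N_prod (I : Type) (s : seq I) (P : pred I) (f : I -> C) :
  N (\prod_(i <- s | P i) f i) = \prod_(i <- s | P i) N (f i).
Proof. by elim/big_rec2 : _ => [|i x y _ <-]; rewrite ?N1// NM. Qed.

Lemma N_Re (z : C) : `|Re z| <= N z.
Proof.
case: z => a b /=; rewrite -sqrtr_sqr ler_wsqrtr// lerDl.
exact: sqr_ge0.
Qed.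

Lemma N_Im (z : C) : `|Im z| <= N z.
Proof.
case: z => a b /=; rewrite -sqrtr_sqr ler_wsqrtr// lerDr.
exact: sqr_ge0.
Qed.

Lemma N_imag : N 'i%C = 1.
Proof. by rewrite /= expr0n add0r expr1n sqrtr1. Qed.

Lemma N_ReIm (z : C) : N z <= `|Re z| + `|Im z|.
Proof.
rewrite {1}[z]complexE; apply: le_trans (ND _ _) _.
by rewrite NM N_imag mul1r !N_real.
Qed.

Lemma N_sq (z : C) : N z ^+ 2 = Re z ^+ 2 + Im z ^+ 2.
Proof.
by case: z => a b /=; rewrite sqr_sqrtr// addr_ge0// sqr_ge0.
Qed.

Lemma Re_D (x y : C) : Re (x + y) = Re x + Re y. Proof. by case: x y => ? ? []. Qed.
Lemma Im_D (x y : C) : Im (x + y) = Im x + Im y. Proof. by case: x y => ? ? []. Qed.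
Lemma Re_N (x : C) : Re (- x) = - Re x. Proof. by case: x. Qed.
Lemma Im_N (x : C) : Im (- x) = - Im x. Proof. by case: x. Qed.
Lemma Re_M (x y : C) : Re (x * y) = Re x * Re y - Im x * Im y.
Proof. by case: x y => ? ? []. Qed.
Lemma Im_M (x y : C) : Im (x * y) = Re x * Im y + Im x * Re y.
Proof. by case: x y => ? ? []. Qed.

Lemma ReIm_eq (x y : C) : Re x = Re y -> Im x = Im y -> x = y.
Proof. by case: x y => a b [c d] /= -> ->. Qed.

(** The norm and the balls of [R[i]] take their values and radii in [R[i]] itself; positive
    elements are real, which allows radii and errors in [R] throughout. *)
Lemma lt0c_real (e : C) : 0 < e -> exists2 r : R, 0 < r & e = r%:C.
Proof.
case: e => a b; rewrite ltcE /= => /andP[/eqP -> a0].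
by exists a.
Qed.

Lemma cnbhsP (t : C) (P : set C) :
  nbhs t P <-> exists2 d : R, 0 < d & forall y, N (y - t) < d -> P y.
Proof.
split=> [/nbhs_ballP[e /= e0 eP]|[d d0 dP]].
  have [r r0 er] := lt0c_real e0; exists r => // y yr.
  apply: eP; rewrite er -ball_normE /= distrC normE.
  by rewrite ltcR.
apply/nbhs_ballP; exists d%:C => /=; first by rewrite ltcR.
move=> y; rewrite -ball_normE /= distrC normE ltcR; exact: dP.
Qed.

Lemma cvgCP (T : Type) (F : set_system T) (FF : Filter F) (f : T -> C) (l : C) :
  (f x @[x --> F] --> l) <->
  forall e : R, 0 < e -> \forall x \near F, N (f x - l) < e.
Proof.
split=> [fl e e0|fl].
  by apply: (fl [set y | N (y - l) < e]); apply/cnbhsP; exists e.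
by move=> P /cnbhsP[d d0 dP]; near=> x; apply: dP; near: x; exact: fl.
Unshelve. all: by end_near. Qed.

Lemma ccontP (f : C -> C) (t : C) :
  {for t, continuous f} <->
  forall e : R, 0 < e -> exists2 d : R, 0 < d &
    forall y, N (y - t) < d -> N (f y - f t) < e.
Proof.
split=> [/(@cvgCP _ _ (nbhs_filter t)) fl e /fl /cnbhsP//|fl].
by apply/(@cvgCP _ _ (nbhs_filter t)) => e /fl ?; apply/cnbhsP.
Qed.

Lemma Re_continuous : continuous (fun z : C => Re z).
Proof.
move=> z; apply/(@cvgrPdist_lt _ _ _ _ (nbhs_filter z)) => /= e e0; apply/cnbhsP; exists e => // y ye.
apply: le_lt_trans ye; rewrite distrC -Re_N -Re_D; exact: N_Re.
Qed.

Lemma Im_continuous : continuous (fun z : C => Im z).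
Proof.
move=> z; apply/(@cvgrPdist_lt _ _ _ _ (nbhs_filter z)) => /= e e0; apply/cnbhsP; exists e => // y ye.
apply: le_lt_trans ye; rewrite distrC -Im_N -Im_D; exact: N_Im.
Qed.

Lemma N_continuous : continuous (fun z : C => N z).
Proof.
move=> z; apply/(@cvgrPdist_lt _ _ _ _ (nbhs_filter z)) => /= e e0; apply/cnbhsP; exists e => // y ye.
apply: le_lt_trans ye; rewrite ler_norml.
have := NB_ge y z; have := NB_ge z y; rewrite (NBC z y); lra.
Qed.

Lemma cvg_ReIm (T : Type) (F : set_system T) (FF : Filter F) (f : T -> C) (l : C) :
  Re (f x) @[x --> F] --> Re l -> Im (f x) @[x --> F] --> Im l ->
  f x @[x --> F] --> l.
Proof.
move=> /cvgrPdist_lt rl /cvgrPdist_lt il; apply/cvgCP => e e0; near=> x.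
apply: le_lt_trans (N_ReIm _) _.
rewrite Re_D Re_N Im_D Im_N (splitr e).
by apply: ltrD; rewrite distrC; near: x; [apply: rl|apply: il]; rewrite divr_gt0.
Unshelve. all: by end_near. Qed.

(** The direction 1 and the base field [R[i]] make this the complex derivative. *)
Definition hasd (g : C -> C) (t l : C) := is_derive t (1 : C) g l.

Lemma hasdP (g : C -> C) (t l : C) : hasd g t l <->
  forall e : R, 0 < e -> exists2 d : R, 0 < d &
    forall h, N h < d -> N (g (t + h) - g t - l * h) <= e * N h.
Proof.
have aux e (h : C) : h != 0 ->
  (N (h^-1 *: ((g \o shift t) (h *: (1 : C)) - g t) - l) <= e) =
  (N (g (t + h) - g t - l * h) <= e * N h).
  move=> h0; have Nh : 0 < N h by rewrite N_gt0.
  rewrite -(ler_pM2r Nh) -NM; congr (N _ <= _).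
  rewrite /= /GRing.scale /= mulr1 [h + t]addrC mulrBl mulrAC mulVf// mul1r.
  by [].
split=> [[dg vg] e e0|H].
  have : (h^-1 *: ((g \o shift t) (h *: (1 : C)) - g t)) @[h --> (0 : C)^'] --> l.
    by move/cvg_ex : dg => [l' gl']; rewrite -vg /derive (cvg_lim _ gl')//.
  move=> /cvgCP /(_ _ e0); rewrite /dnbhs => /cnbhsP [d d0 dP].
  exists d => // h hd; have [->|h0] := eqVneq h 0.
    by rewrite addr0 subrr mulr0 subrr N0 mulr0.
  rewrite -aux//; apply/ltW; apply: dP => //; by rewrite subr0.
have cv : (h^-1 *: ((g \o shift t) (h *: (1 : C)) - g t)) @[h --> (0 : C)^'] --> l.
  apply/cvgCP => e e0; have [|d d0 dP] := H (e / 2); first by rewrite divr_gt0.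
  rewrite /dnbhs; apply/cnbhsP; exists d => // h; rewrite subr0 => hd h0.
  have : N (h^-1 *: ((g \o shift t) (h *: (1 : C)) - g t) - l) <= e / 2.
    by rewrite aux//; exact: dP.
  move=> /le_lt_trans; apply; lra.
split; first by apply/cvg_ex; exists l.
exact: cvg_lim.
Qed.

Lemma hasd_derive1 (g : C -> C) (t l : C) : hasd g t l -> derive1 g t = l.
Proof. by move=> gl; rewrite derive1E; exact: derive_val. Qed.

Lemma derivable_hasd (g : C -> C) (t : C) : derivable g t 1 -> hasd g t (derive1 g t).
Proof. by move=> gl; rewrite derive1E; exact: derivableP. Qed.

Lemma hasd_derivable (g : C -> C) (t l : C) : hasd g t l -> derivable g t 1.
Proof. by case. Qed.

Lemma hasd_unique (g : C -> C) (t l l' : C) : hasd g t l -> hasd g t l' -> l = l'.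
Proof. by move=> /hasd_derive1 <- /hasd_derive1. Qed.

Lemma hasd_continuous (g : C -> C) (t l : C) : hasd g t l -> {for t, continuous g}.
Proof.
move=> [gd _]; apply: differentiable_continuous.
exact: (derivable1_diffP g t).1.
Qed.

Lemma hasd_cst (c t : C) : hasd (fun=> c) t 0.
Proof. exact: is_derive_cst. Qed.

Lemma hasd_id (t : C) : hasd id t 1.
Proof. exact: is_derive_id. Qed.

Lemma hasdD (f g : C -> C) (t a b : C) : hasd f t a -> hasd g t b ->
  hasd (fun z => f z + g z) t (a + b).
Proof. by move=> fa gb; exact: is_deriveD. Qed.

Lemma hasdN (f : C -> C) (t a : C) : hasd f t a -> hasd (fun z => - f z) t (- a).
Proof. by move=> fa; exact: is_deriveN. Qed.

Lemma hasdB (f g : C -> C) (t a b : C) : hasd f t a -> hasd g t b ->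
  hasd (fun z => f z - g z) t (a - b).
Proof. by move=> fa gb; exact: is_deriveB. Qed.

Lemma hasdM (f g : C -> C) (t a b : C) : hasd f t a -> hasd g t b ->
  hasd (fun z => f z * g z) t (a * g t + f t * b).
Proof.
move=> fa gb; suff -> : a * g t + f t * b = f t *: b + g t *: a.
  exact: is_deriveM.
by rewrite addrC mulrC [a * _]mulrC [b * _]mulrC.
Qed.

Lemma hasdZ (c : C) (g : C -> C) (t b : C) : hasd g t b ->
  hasd (fun z => c * g z) t (c * b).
Proof. by move=> gb; have := hasdM (hasd_cst c t) gb; rewrite mul0r add0r. Qed.

Lemma hasd_ext (f g : C -> C) (t l : C) :
  (exists2 d : R, 0 < d & forall y, N (y - t) < d -> f y = g y) ->
  hasd f t l -> hasd g t l.
Proof.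
move=> [d d0 fg] /hasdP H; apply/hasdP => e /H[d1 d10 d1P].
exists (Num.min d d1); first by rewrite lt_min d0.
move=> h; rewrite lt_min => /andP[hd hd1].
by rewrite -!fg ?subrr ?N0 ?d1P// addrC addKr.
Qed.

Lemma hasd_comp (g f : C -> C) (t a b : C) : hasd f t a -> hasd g (f t) b ->
  hasd (fun z => g (f z)) t (b * a).
Proof.
move=> fa gb.
pose K := N b + N a + 1 + 1; have Na := N_ge0 a; have Nb := N_ge0 b.
have /ccontP fc := hasd_continuous fa.
move/hasdP in fa; move/hasdP in gb; apply/hasdP => e e0.
(* An error at most e1 in each of the two derivatives costs at most e1 * K. *)
pose e1 := Num.min 1 (e / K).
have K0 : 0 < K by rewrite /K; lra.
have e10 : 0 < e1 by rewrite lt_min ltr01 divr_gt0.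
have e1K : e1 * K <= e by rewrite -ler_pdivlMr// ge_min lexx orbT.
have e1le : e1 <= 1 by rewrite ge_min lexx.
have [d1 d10 d1P] := fa _ e10.
have [d2 d20 d2P] := gb _ e10.
have [d3 d30 d3P] := fc _ d20.
exists (Num.min d1 d3); first by rewrite lt_min d10.
move=> h; rewrite lt_min => /andP[hd1 hd3].
have {}d1P := d1P _ hd1.
have /d2P : N (f (t + h) - f t) < d2 by apply: d3P; rewrite addrC addKr.
rewrite [f t + (_ - _)]addrC subrK; set k := f (t + h) - f t in d1P * => d2P'.
have kl : N k <= (N a + 1) * N h.
  have -> : k = (k - a * h) + a * h by rewrite subrK.
  apply: le_trans (ND _ _) _; rewrite NM mulrDl addrC mul1r lerD2l.
  apply: le_trans d1P _; rewrite ler_piMl ?N_ge0//.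
have -> : g (f (t + h)) - g (f t) - b * a * h =
   (g (f (t + h)) - g (f t) - b * k) + b * (k - a * h) by ring.
apply: le_trans (ND _ _) _.
apply: (@le_trans _ _ (e1 * ((N a + 1) * N h) + N b * (e1 * N h))).
  rewrite NM lerD//; first by apply: le_trans d2P' _; rewrite ler_pM2l.
  exact: ler_wpM2l.
have -> : e1 * ((N a + 1) * N h) + N b * (e1 * N h) = e1 * (N a + N b + 1) * N h by ring.
apply: ler_wpM2r; first exact: N_ge0.
apply: le_trans e1K; rewrite ler_pM2l// /K; lra.
Qed.

Lemma hasdV (f : C -> C) (t a : C) : f t != 0 -> hasd f t a ->
  hasd (fun z => (f z)^-1) t (- a / (f t) ^+ 2).
Proof.
move=> ft [fd <-]; suff -> : - 'D_1 f t / f t ^+ 2 = - f t ^- 2 *: 'D_1 f t.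
  by split; [exact: derivableV|exact: deriveV].
by rewrite mulrC mulrN -mulNr.
Qed.

Lemma hasdX (f : C -> C) n (t a : C) : hasd f t a ->
  hasd (fun z => f z ^+ n) t (n%:R * f t ^+ n.-1 * a).
Proof.
move=> fa; elim: n => [|n IH]; first by rewrite !mul0r; exact: hasd_cst.
have H := hasdM fa IH.
have -> : n.+1%:R * f t ^+ n.+1.-1 * a =
    a * f t ^+ n + f t * (n%:R * f t ^+ n.-1 * a).
  case: n {IH H} => [|n]; first by rewrite /= expr0; ring.
  by rewrite /= !exprS -!natr1; ring.
rewrite (_ : (fun z => f z ^+ n.+1) = (fun z => f z * f z ^+ n))//.
by apply/funext => z; rewrite exprS.
Qed.

Lemma hasd_sum (n : nat) (f : nat -> C -> C) (t : C) (a : nat -> C) :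
  (forall i, (i < n)%N -> hasd (f i) t (a i)) ->
  hasd (fun z => \sum_(i < n) f i z) t (\sum_(i < n) a i).
Proof.
elim: n => [|n IH] H.
  rewrite big_ord0; apply: hasd_ext (hasd_cst 0 t).
  by exists 1 => // y _; rewrite big_ord0.
rewrite big_ord_recr /=.
apply: (@hasd_ext (fun z => \sum_(i < n) f i z + f n z)).
  by exists 1 => // y _; rewrite big_ord_recr.
by apply: hasdD; [apply: IH => i /ltnW; exact: H | exact: H].
Qed.

End Norm.

(** * Integrals of complex-valued functions of a real variable *)

Section Int.
Variable R : realType.
Local Notation C := R[i].
Local Notation N := (@ComplexField.Normc.normc R).
Local Notation Re := (@complex.Re R).
Local Notation Im := (@complex.Im R).

Lemma real_derivP (f : R -> R) (x l : R) : is_derive x 1 f l <->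
  forall e : R, 0 < e -> exists2 d : R, 0 < d &
    forall h, `|h| < d -> `|f (x + h) - f x - l * h| <= e * `|h|.
Proof.
have aux e (h : R) : h != 0 ->
  (`|h^-1 *: ((f \o shift x) (h *: 1) - f x) - l| <= e) =
  (`|f (x + h) - f x - l * h| <= e * `|h|).
  move=> h0; have Nh : 0 < `|h| by rewrite normr_gt0.
  rewrite -(ler_pM2r Nh) -normrM; congr (`|_| <= _).
  rewrite /= /GRing.scale /= mulr1 [h + x]addrC mulrBl mulrAC mulVf// mul1r.
  by [].
split=> [[dg vg] e e0|H].
  have : (h^-1 *: ((f \o shift x) (h *: 1) - f x)) @[h --> (0 : R)^'] --> l.
    by move/cvg_ex : dg => [l' gl']; rewrite -vg /derive (cvg_lim _ gl')//.
  move=> /cvgrPdist_le /(_ _ e0); rewrite /dnbhs => /nbhs_ballP[d /= d0 dP].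
  exists d => // h hd; have [->|h0] := eqVneq h 0.
    by rewrite addr0 subrr mulr0 subrr normr0 mulr0.
  by rewrite -aux// distrC; apply: dP => //; rewrite /ball/= sub0r normrN.
have cv : (h^-1 *: ((f \o shift x) (h *: 1) - f x)) @[h --> (0 : R)^'] --> l.
  apply/cvgrPdist_le => e e0; have [d d0 dP] := H _ e0.
  rewrite /dnbhs; apply/nbhs_ballP; exists d => // h.
  rewrite /ball/= sub0r normrN => hd h0; rewrite distrC aux//; exact: dP.
split; first by apply/cvg_ex; exists l.
exact: cvg_lim.
Qed.

(** The derivative of a complex-valued function of a real variable, stated with the increments
    because [R -> R[i]] mixes two base fields. *)
Definition rderiv (G : R -> C) (x : R) (l : C) :=
  forall e : R, 0 < e -> exists2 d : R, 0 < d &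
    forall h : R, `|h| < d -> N (G (x + h) - G x - l * h%:C) <= e * `|h|.

Lemma rderiv_Re (G : R -> C) (x : R) l : rderiv G x l ->
  is_derive x 1 (fun y => Re (G y)) (Re l).
Proof.
move=> H; apply/real_derivP => e /H[d d0 dP]; exists d => // h /dP.
apply: le_trans; apply: le_trans (N_Re _).
by rewrite !(Re_D, Re_N, Re_M) /= mulr0 subr0.
Qed.

Lemma rderiv_Im (G : R -> C) (x : R) l : rderiv G x l ->
  is_derive x 1 (fun y => Im (G y)) (Im l).
Proof.
move=> H; apply/real_derivP => e /H[d d0 dP]; exists d => // h /dP.
apply: le_trans; apply: le_trans (N_Im _).
by rewrite !(Im_D, Im_N, Im_M) /= mulr0 add0r.
Qed.

Lemma rderiv_ReIm (G : R -> C) (x : R) l : is_derive x 1 (fun y => Re (G y)) (Re l) ->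
  is_derive x 1 (fun y => Im (G y)) (Im l) -> rderiv G x l.
Proof.
move=> /real_derivP Hr /real_derivP Hi e e0.
have e20 : 0 < e / 2 by lra.
have [d d0 dP] := Hr _ e20; have [d' d'0 d'P] := Hi _ e20.
exists (Num.min d d') => [|h]; first by rewrite lt_min d0.
rewrite lt_min => /andP[/dP hd /d'P hd'].
apply: le_trans (N_ReIm _) _.
rewrite !(Re_D, Re_N, Re_M, Im_D, Im_N, Im_M) /= mulr0 subr0 mulr0 add0r.
lra.
Qed.

Lemma rderivD (F G : R -> C) x a b : rderiv F x a -> rderiv G x b ->
  rderiv (fun y => F y + G y) x (a + b).
Proof.
move=> Hr Hi e e0.
have e20 : 0 < e / 2 by lra.
have [d d0 dP] := Hr _ e20; have [d' d'0 d'P] := Hi _ e20.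
exists (Num.min d d') => [|h]; first by rewrite lt_min d0.
rewrite lt_min => /andP[/dP hd /d'P hd'].
have -> : F (x + h) + G (x + h) - (F x + G x) - (a + b) * h%:C =
  (F (x + h) - F x - a * h%:C) + (G (x + h) - G x - b * h%:C) by ring.
apply: le_trans (ND _ _) _; lra.
Qed.

Lemma rderivZ (c : C) (G : R -> C) x b : rderiv G x b ->
  rderiv (fun y => c * G y) x (c * b).
Proof.
move=> H e e0; have Nc := N_ge0 c.
have [|d d0 dP] := H (e / (N c + 1)); first by rewrite divr_gt0//; lra.
exists d => // h /dP.
have -> : c * G (x + h) - c * G x - c * b * h%:C = c * (G (x + h) - G x - b * h%:C).
  by ring.
rewrite NM => /(ler_wpM2l Nc)/le_trans; apply.
rewrite mulrA; apply: ler_wpM2r => //.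
rewrite mulrCA ler_piMr ?(ltW e0)// ler_pdivrMr; lra.
Qed.

Lemma rderivB (F G : R -> C) x a b : rderiv F x a -> rderiv G x b ->
  rderiv (fun y => F y - G y) x (a - b).
Proof.
move=> Fa /(rderivZ (-1)) Gb; have := rderivD Fa Gb; rewrite mulN1r.
by under eq_fun do rewrite mulN1r.
Qed.

Lemma rderiv_cst c x : rderiv (fun=> c) x 0.
Proof.
move=> e e0; exists 1 => // h _; rewrite subrr mul0r subrr N0.
by rewrite mulr_ge0// ltW.
Qed.

Lemma rderiv_real x : rderiv (fun y => y%:C) x 1.
Proof.
move=> e e0; exists 1 => // h _.
have -> : (x + h)%:C - x%:C - 1 * h%:C = 0 :> C by rewrite rmorphD; ring.
by rewrite N0 mulr_ge0// ltW.
Qed.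

Lemma rderiv_continuous (G : R -> C) (x : R) l : rderiv G x l -> {for x, continuous G}.
Proof.
move=> /[dup] /rderiv_Re [rd _] /rderiv_Im [id _].
apply: (@cvg_ReIm _ _ _ (nbhs_filter x)).
  exact: (differentiable_continuous ((derivable1_diffP _ _).1 rd)).
exact: (differentiable_continuous ((derivable1_diffP _ _).1 id)).
Qed.

Lemma rderiv_comp (f : C -> C) (g : R -> C) x a b :
  rderiv g x a -> hasd f (g x) b -> rderiv (fun y => f (g y)) x (b * a).
Proof.
move=> ga /[dup] fb /hasdP fb' e e0.
pose K := N b + N a + 1 + 1; have Na := N_ge0 a; have Nb := N_ge0 b.
pose e1 := Num.min 1 (e / K).
have K0 : 0 < K by rewrite /K; lra.
have e10 : 0 < e1 by rewrite lt_min ltr01 divr_gt0.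
have e1K : e1 * K <= e by rewrite -ler_pdivlMr// ge_min lexx orbT.
have e1le : e1 <= 1 by rewrite ge_min lexx.
have [d1 d10 d1P] := ga _ e10.
have [d2 d20 d2P] := fb' _ e10.
have Na1 : 0 < N a + 1 by lra.
exists (Num.min d1 (d2 / (N a + 1))); first by rewrite lt_min d10 divr_gt0.
move=> h; rewrite lt_min => /andP[hd1]; rewrite ltr_pdivlMr// => hd3.
have {}d1P := d1P _ hd1.
set k := g (x + h) - g x in d1P *.
have kl : N k <= (N a + 1) * `|h|.
  have -> : k = (k - a * h%:C) + a * h%:C by rewrite subrK.
  apply: le_trans (ND _ _) _; rewrite NM N_real mulrDl addrC mul1r lerD2l.
  by apply: le_trans d1P _; rewrite ler_piMl.
have /d2P : N k < d2 by apply: le_lt_trans kl _; rewrite mulrC.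
rewrite [g x + _]addrC subrK => d2P'.
have -> : f (g (x + h)) - f (g x) - b * a * h%:C =
   (f (g (x + h)) - f (g x) - b * k) + b * (k - a * h%:C) by ring.
apply: le_trans (ND _ _) _.
apply: (@le_trans _ _ (e1 * ((N a + 1) * `|h|) + N b * (e1 * `|h|))).
  rewrite NM lerD//; first by apply: le_trans d2P' _; rewrite ler_pM2l.
  exact: ler_wpM2l.
have -> : e1 * ((N a + 1) * `|h|) + N b * (e1 * `|h|) = e1 * (N a + N b + 1) * `|h|.
  by ring.
apply: ler_wpM2r => //.
apply: le_trans e1K; rewrite ler_pM2l// /K; lra.
Qed.

Definition antider (a b : R) (f G : R -> C) :=
  forall x, a <= x <= b -> rderiv G x (f x).

(** Integration is evaluation of an antiderivative: continuous functions have one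
    ([int_exists]), and the integral calculus below reduces to differentiation rules. *)
Definition has_int (a b : R) (f : R -> C) (v : C) :=
  exists2 G, antider a b f G & v = G b - G a.

(** The mean value theorem for the real and the imaginary part separately costs the factor 2,
    which recurs in all the estimates below. *)
Lemma antider_bound a b c d (f G : R -> C) (M : R) : a <= c -> c <= d -> d <= b ->
  antider a b f G -> (forall x, c <= x <= d -> N (f x) <= M) ->
  N (G d - G c) <= 2 * M * (d - c).
Proof.
move=> ac cd db Gf fM.
have sub x : c <= x <= d -> a <= x <= b.
  by move=> /andP[cx xd]; rewrite (le_trans ac)//= (le_trans xd).
have wc (H : C -> R) : continuous H ->
    {within `[c, d], continuous (fun y => H (G y))}.
  move=> Hc; apply/continuous_in_subspaceT => x /set_mem /=.
  rewrite in_itv /= => /sub /Gf /rderiv_continuous Gx.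
  exact: continuous_comp Gx (Hc _).
have {}Gf x : c <= x <= d -> rderiv G x (f x) by move=> /sub; exact: Gf.
have sub' x : x \in `]c, d[ -> c <= x <= d.
  by rewrite in_itv /= => /andP[cx xd]; rewrite !ltW.
have M0 : 0 <= M by apply: le_trans (N_ge0 _) (fM c _); rewrite lexx.
have [||x xcd Ex] := @MVT_segment _ (fun y => Re (G y)) (fun y => Re (f y)) c d cd.
- by move=> x /sub' /Gf /rderiv_Re.
- exact/wc/Re_continuous.
have [||y ycd Ey] := @MVT_segment _ (fun y => Im (G y)) (fun y => Im (f y)) c d cd.
- by move=> y /sub' /Gf /rderiv_Im.
- exact/wc/Im_continuous.
move: xcd ycd; rewrite !in_itv /= => xcd ycd.
apply: le_trans (N_ReIm _) _; rewrite !(Re_D, Re_N, Im_D, Im_N) Ex Ey !normrM.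
have dc : 0 <= d - c by rewrite subr_ge0.
rewrite (ger0_norm dc) -mulrDl; apply: ler_wpM2r => //.
have := le_trans (N_Re (f x)) (fM _ xcd); have := le_trans (N_Im (f y)) (fM _ ycd).
lra.
Qed.

Lemma int_bound a b (f : R -> C) (M : R) v : a <= b ->
  (forall x, a <= x <= b -> N (f x) <= M) -> has_int a b f v ->
  N v <= 2 * M * (b - a).
Proof. by move=> ab fM [G Gf ->]; exact: (antider_bound _ _ _ Gf). Qed.

Lemma intD a b f g v w : has_int a b f v -> has_int a b g w ->
  has_int a b (fun x => f x + g x) (v + w).
Proof.
move=> [F Ff ->] [G Gg ->]; exists (fun x => F x + G x); last by ring.
by move=> x xab; apply: rderivD; [exact: Ff|exact: Gg].
Qed.

Lemma intZ a b c f v : has_int a b f v -> has_int a b (fun x => c * f x) (c * v).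
Proof.
move=> [F Ff ->]; exists (fun x => c * F x); last by ring.
by move=> x xab; apply: rderivZ; exact: Ff.
Qed.

Lemma intB a b f g v w : has_int a b f v -> has_int a b g w ->
  has_int a b (fun x => f x - g x) (v - w).
Proof.
move=> [F Ff ->] [G Gg ->]; exists (fun x => F x - G x); last by ring.
by move=> x xab; apply: rderivB; [exact: Ff|exact: Gg].
Qed.

Lemma int_ext a b f g v : (forall x, a <= x <= b -> f x = g x) ->
  has_int a b f v -> has_int a b g v.
Proof.
move=> fg [F Ff ->]; exists F => // x xab.
by rewrite -fg//; exact: Ff.
Qed.

Lemma int_unique a b f v w : a <= b -> has_int a b f v -> has_int a b f w -> v = w.
Proof.
move=> ab fv fw; apply/eqP; rewrite -subr_eq0 -N_eq0 eq_le N_ge0 andbT.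
have := int_bound (M := 0) ab _ (intB fv fw); rewrite mulr0 mul0r; apply.
by move=> x _; rewrite subrr N0.
Qed.

Lemma int_sum a b n (f : nat -> R -> C) (v : nat -> C) :
  (forall i, (i < n)%N -> has_int a b (f i) (v i)) ->
  has_int a b (fun x => \sum_(i < n) f i x) (\sum_(i < n) v i).
Proof.
elim: n => [|n IH] H.
  exists (fun=> 0); last by rewrite big_ord0 subrr.
  by move=> x _; rewrite big_ord0; exact: rderiv_cst.
rewrite big_ord_recr /=.
apply: (@int_ext _ _ (fun x => \sum_(i < n) f i x + f n x)).
  by move=> x _; rewrite big_ord_recr.
by apply: intD; [apply: IH => i /ltnW; exact: H|exact: H].
Qed.

Lemma int_cst a b c : has_int a b (fun=> c) (c * (b - a)%:C).
Proof.
exists (fun x => c * x%:C); last by rewrite rmorphB /=; ring.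
by move=> x _; rewrite -[X in rderiv _ _ X]mulr1; exact/rderivZ/rderiv_real.
Qed.

Lemma real_antider (f : R -> R) (a b : R) : continuous f ->
  exists G : R -> R, forall x, a <= x <= b -> is_derive x 1 G (f x).
Proof.
move=> fc; pose F (x : R) := \int[lebesgue_measure]_(t in `[a - 1, x]) f t.
exists F => x /andP[ax xb].
have xb1 : x < b + 1 by lra.
have ax1 : (a - 1 < x)%R by lra.
have fi : lebesgue_measure.-integrable `[a - 1, b + 1] (EFin \o f).
  by apply: continuous_compact_integrable; [exact: segment_compact|exact: continuous_subspaceT].
have [dF vF] := continuous_FTC1_closed xb1 fi ax1 (fc x).
by split; [exact: dF|rewrite -derive1E].
Qed.

(** The real theory is applied to the function frozen outside [[a, b]], which is continuous on
    the whole line. *)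
Lemma int_exists (a b : R) (f : R -> C) : a <= b ->
  (forall x : R, a <= x <= b -> {for x, continuous f}) -> exists v, has_int a b f v.
Proof.
move=> ab fc.
pose cl (x : R) : R := Num.max a (Num.min b x).
have clab x : a <= cl x <= b.
  by rewrite /cl le_max lexx /= ge_max ab ge_min lexx.
have clid x : a <= x <= b -> cl x = x.
  by move=> /andP[ax xb]; rewrite /cl (min_idPr xb) (max_idPr ax).
have clc : continuous cl.
  move=> x; apply: continuous_max; first exact: cst_continuous.
  by apply: continuous_min; [exact: cst_continuous|exact: cvg_id].
have fclc : continuous (f \o cl).
  by move=> x; apply: continuous_comp; [exact: clc|exact/fc/clab].
have [|Gr Hr] := @real_antider (fun x => Re (f (cl x))) a b.
  by move=> x; exact: (@continuous_comp _ _ _ (f \o cl) (fun z : C => Re z) x (fclc x) (@Re_continuous R _)).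
have [|Gi Hi] := @real_antider (fun x => Im (f (cl x))) a b.
  by move=> x; exact: (@continuous_comp _ _ _ (f \o cl) (fun z : C => Im z) x (fclc x) (@Im_continuous R _)).
exists ((Gr b +i* Gi b) - (Gr a +i* Gi a)), (fun x => Gr x +i* Gi x) => //.
move=> x xab; rewrite -{2}(clid x xab).
by apply: rderiv_ReIm => /=; [exact: Hr|exact: Hi].
Qed.

End Int.

(** * Goursat's theorem for rectangles *)

Section Goursat.
Variable R : realType.
Local Notation C := R[i].
Local Notation N := (@ComplexField.Normc.normc R).
Local Notation I := ('i%C : C).

Lemma cartE (x y : R) : x +i* y = x%:C + I * y%:C.
Proof. by rewrite [LHS]complexE. Qed.

Lemma rderiv_horiz (y x : R) : rderiv (fun x => x +i* y) x 1.
Proof.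
have := rderivD (rderiv_real x) (rderiv_cst (I * y%:C) x); rewrite addr0.
by under eq_fun do rewrite -cartE.
Qed.

Lemma rderiv_vert (x y : R) : rderiv (fun y => x +i* y) y I.
Proof.
have := rderivD (rderiv_cst x%:C y) (rderivZ I (rderiv_real y)); rewrite add0r mulr1.
by under eq_fun do rewrite -cartE.
Qed.

Variable g : C -> C.

(** The integral of [g] along the boundary of [[a, b]] x [[c, d]]. *)
Definition rect_int (a b c d : R) (J : C) := exists hc hd va vb,
  [/\ has_int a b (fun x => g (x +i* c)) hc, has_int a b (fun x => g (x +i* d)) hd,
      has_int c d (fun y => g (a +i* y)) va, has_int c d (fun y => g (b +i* y)) vb &
      J = hc - hd + I * (vb - va)].

Lemma rect_int_exists (a b c d : R) : a <= b -> c <= d ->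
  (forall x y, a <= x <= b -> c <= y <= d -> {for (x +i* y), continuous g}) ->
  exists J, rect_int a b c d J.
Proof.
move=> ab cd gc.
have H (y : R) : c <= y <= d -> exists v, has_int a b (fun x => g (x +i* y)) v.
  move=> yc; apply: int_exists => // x xa.
  exact: (@continuous_comp _ _ _ (fun x => x +i* y) g x
    (rderiv_continuous (rderiv_horiz y x)) (gc _ _ xa yc)).
have V (x : R) : a <= x <= b -> exists v, has_int c d (fun y => g (x +i* y)) v.
  move=> xa; apply: int_exists => // y yc.
  exact: (@continuous_comp _ _ _ (fun y => x +i* y) g y
    (rderiv_continuous (rderiv_vert x y)) (gc _ _ xa yc)).
have [|h1 H1] := H c; first by rewrite lexx.
have [|h2 H2] := H d; first by rewrite lexx andbT.
have [|v1 V1] := V a; first by rewrite lexx.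
have [|v2 V2] := V b; first by rewrite lexx andbT.
by exists (h1 - h2 + I * (v2 - v1)), h1, h2, v1, v2.
Qed.

Lemma int_split (a b c : R) f v : a <= c -> c <= b -> has_int a b f v ->
  exists v1 v2, [/\ has_int a c f v1, has_int c b f v2 & v = v1 + v2].
Proof.
move=> ac cb [F Ff ->]; exists (F c - F a), (F b - F c); split; last by ring.
  by exists F => // x /andP[ax xc]; apply: Ff; rewrite ax (le_trans xc).
by exists F => // x /andP[cx xb]; apply: Ff; rewrite xb (le_trans ac).
Qed.

Lemma rect_int_vsplit a b c d e J J1 J2 : a <= c -> c <= b -> d <= e ->
  rect_int a b d e J -> rect_int a c d e J1 -> rect_int c b d e J2 -> J = J1 + J2.
Proof.
move=> ac cb de [h1 [h2 [v1 [v2 [H1 H2 H3 H4 ->]]]]]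
  [h1' [h2' [v1' [v2' [H1' H2' H3' H4' ->]]]]]
  [k1 [k2 [w1 [w2 [K1 K2 K3 K4 ->]]]]].
have [p1 [p2 [P1 P2 ->]]] := int_split ac cb H1.
have [q1 [q2 [Q1 Q2 ->]]] := int_split ac cb H2.
rewrite (int_unique ac P1 H1') (int_unique ac Q1 H2') (int_unique cb P2 K1)
  (int_unique cb Q2 K2) (int_unique de H3 H3') (int_unique de H4 K4)
  (int_unique de K3 H4'); ring.
Qed.

Lemma rect_int_hsplit a b c d e J J1 J2 : a <= b -> d <= c -> c <= e ->
  rect_int a b d e J -> rect_int a b d c J1 -> rect_int a b c e J2 -> J = J1 + J2.
Proof.
move=> ab dc ce [h1 [h2 [v1 [v2 [H1 H2 H3 H4 ->]]]]]
  [h1' [h2' [v1' [v2' [H1' H2' H3' H4' ->]]]]]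
  [k1 [k2 [w1 [w2 [K1 K2 K3 K4 ->]]]]].
have [p1 [p2 [P1 P2 ->]]] := int_split dc ce H3.
have [q1 [q2 [Q1 Q2 ->]]] := int_split dc ce H4.
rewrite (int_unique dc P1 H3') (int_unique dc Q1 H4') (int_unique ce P2 K3)
  (int_unique ce Q2 K4) (int_unique ab H1 H1') (int_unique ab H2 K2)
  (int_unique ab K1 H2'); ring.
Qed.

(** The first-order Taylor polynomial of [g] has the primitive [P] below, so only the error term
    contributes. *)
Lemma rect_int_local a b c d (J w0 l : C) (e D : R) : a <= b -> c <= d -> 0 <= e ->
  (forall x y, a <= x <= b -> c <= y <= d -> N ((x +i* y) - w0) <= D /\
    N (g (x +i* y) - g w0 - l * ((x +i* y) - w0)) <= e * N ((x +i* y) - w0)) ->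
  rect_int a b c d J -> N J <= 4 * (e * D) * ((b - a) + (d - c)).
Proof.
move=> ab cd e0 H [h1 [h2 [v1 [v2 [H1 H2 H3 H4 ->]]]]].
pose P w := g w0 * w + l / 2 * (w - w0) ^+ 2.
pose P' w := g w0 + l * (w - w0).
have HP w : hasd P w (P' w).
  have := hasdD (hasdZ (g w0) (hasd_id w))
    (hasdZ (l / 2) (hasdX 2 (hasdB (hasd_id w) (hasd_cst w0 w)))).
  suff -> : g w0 * 1 + l / 2 * (2%:R * (id w - w0) ^+ 2.-1 * (1 - 0)) = P' w by [].
  by rewrite /P' /=; field.
have hor y v : c <= y <= d -> has_int a b (fun x => g (x +i* y)) v ->
    N (v - (P (b +i* y) - P (a +i* y))) <= 2 * (e * D) * (b - a).
  move=> yc vi.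
  have Pi : has_int a b (fun x => P' (x +i* y)) (P (b +i* y) - P (a +i* y)).
    exists (fun x => P (x +i* y)) => // x _.
    by have := rderiv_comp (rderiv_horiz y x) (HP (x +i* y)); rewrite mulr1.
  apply: int_bound (intB vi Pi) => // x xa.
  have [H0 H0'] := H _ _ xa yc; rewrite /P' opprD addrA.
  by apply: le_trans H0' _; exact: ler_wpM2l.
have ver x v : a <= x <= b -> has_int c d (fun y => g (x +i* y)) v ->
    N (I * v - (P (x +i* d) - P (x +i* c))) <= 2 * (e * D) * (d - c).
  move=> xa vi.
  have Pi : has_int c d (fun y => I * P' (x +i* y)) (P (x +i* d) - P (x +i* c)).
    exists (fun y => P (x +i* y)) => // y _.
    by have := rderiv_comp (rderiv_vert x y) (HP (x +i* y)); rewrite mulrC.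
  apply: int_bound (intB (intZ I vi) Pi) => // y yc.
  have [H0 H0'] := H _ _ xa yc; rewrite -mulrBr NM N_imag mul1r /P' opprD addrA.
  by apply: le_trans H0' _; exact: ler_wpM2l.
have aa : a <= a <= b by rewrite lexx.
have bb : a <= b <= b by rewrite lexx andbT.
have cc : c <= c <= d by rewrite lexx.
have dd : c <= d <= d by rewrite lexx andbT.
have := hor _ _ cc H1; have := hor _ _ dd H2; have := ver _ _ aa H3; have := ver _ _ bb H4.
set A1 := I * v2 - _; set A2 := I * v1 - _; set A3 := h2 - _; set A4 := h1 - (_ - _).
have -> : h1 - h2 + I * (v2 - v1) = (A4 - A3) + (A1 - A2).
  by rewrite /A1 /A2 /A3 /A4; ring.
move=> B1 B2 B3 B4; apply: le_trans (ND _ _) _.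
apply: (le_trans (lerD (NB _ _) (NB _ _))); lra.
Qed.

Lemma dist_le (a r x y : R) : a <= x <= a + r -> a <= y <= a + r -> `|x - y| <= r.
Proof. by move=> *; rewrite ler_norml; lra. Qed.

Section Bisection.
Variables (x0 y0 p q : R).
Hypotheses (p0 : 0 <= p) (q0 : 0 <= q).
Hypothesis gd : forall x y, x0 <= x <= x0 + p -> y0 <= y <= y0 + q ->
  exists l, hasd g (x +i* y) l.

(** [z] is the lower left corner of a rectangle of the [n]-th generation. *)
Let inside n (z : R * R) := [/\ x0 <= z.1, z.1 + p / 2 ^+ n <= x0 + p, y0 <= z.2 &
  z.2 + q / 2 ^+ n <= y0 + q].
Let rint n (z : R * R) := rect_int z.1 (z.1 + p / 2 ^+ n) z.2 (z.2 + q / 2 ^+ n).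

Let half (r : R) n : r / 2 ^+ n = r / 2 ^+ n.+1 + r / 2 ^+ n.+1.
Proof.
have h0 : (2 : R) ^+ n != 0 by rewrite expf_neq0.
by rewrite exprSr; field; rewrite h0.
Qed.

Let dge0 (r : R) n : 0 <= r -> 0 <= r / 2 ^+ n.
Proof. by move=> r0; rewrite divr_ge0// exprn_ge0. Qed.

Let rex n z : inside n z -> exists J, rint n z J.
Proof.
move=> [h1 h2 h3 h4]; apply: rect_int_exists.
- by rewrite lerDl dge0.
- by rewrite lerDl dge0.
- move=> x y /andP[a1 a2] /andP[b1 b2]; have [||l gl] := gd (x := x) (y := y).
  + by rewrite (le_trans h1)//= (le_trans a2).
  + by rewrite (le_trans h3)//= (le_trans b2).
  exact: hasd_continuous gl.
Qed.

(** The integral is the sum of those over the four quarters, so one of them carries at least a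
    quarter of it. *)
Let step n z J : inside n z -> rint n z J ->
  exists z', [/\ z.1 <= z'.1, z'.1 + p / 2 ^+ n.+1 <= z.1 + p / 2 ^+ n,
    z.2 <= z'.2, z'.2 + q / 2 ^+ n.+1 <= z.2 + q / 2 ^+ n &
    exists2 J', rint n.+1 z' J' & N J / 4 <= N J'].
Proof.
move=> [h1 h2 h3 h4] HJ; set p' := p / 2 ^+ n.+1; set q' := q / 2 ^+ n.+1.
have p'0 : 0 <= p' by exact: dge0.
have q'0 : 0 <= q' by exact: dge0.
move: h2 h4 HJ; rewrite /rint (half p n) (half q n) -/p' -/q' => h2 h4 HJ.
case: z h1 h2 h3 h4 HJ => x y /= h1 h2 h3 h4 HJ.
have R1 : inside n.+1 (x, y) by split => //=; rewrite -/p' -/q'; lra.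
have R2 : inside n.+1 (x + p', y) by split => //=; rewrite -/p' -/q'; lra.
have R3 : inside n.+1 (x, y + q') by split => //=; rewrite -/p' -/q'; lra.
have R4 : inside n.+1 (x + p', y + q') by split => //=; rewrite -/p' -/q'; lra.
have [J1 K1] := rex R1; have [J2 K2] := rex R2.
have [J3 K3] := rex R3; have [J4 K4] := rex R4.
rewrite /rint /= -/p' -/q' in K1 K2 K3 K4.
have gcont u v : x <= u <= x + (p' + p') -> y <= v <= y + (q' + q') ->
    {for (u +i* v), continuous g}.
  move=> xu yv; have [||l gl] := gd (x := u) (y := v); try lra.
  exact: hasd_continuous gl.
have [JL KL] : exists J, rect_int x (x + p') y (y + (q' + q')) J.
  by apply: rect_int_exists; try lra; move=> u v *; apply: gcont; lra.
have [JR KR] : exists J, rect_int (x + p') (x + (p' + p')) y (y + (q' + q')) J.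
  by apply: rect_int_exists; try lra; move=> u v *; apply: gcont; lra.
have E : J = JL + JR by apply: (rect_int_vsplit _ _ _ HJ KL KR); lra.
rewrite -!addrA in K1 K2 K3 K4.
have EL : JL = J1 + J3 by apply: (rect_int_hsplit _ _ _ KL K1 K3); lra.
have ER : JR = J2 + J4 by apply: (rect_int_hsplit _ _ _ KR K2 K4); lra.
have NJ : N J <= N J1 + N J3 + (N J2 + N J4).
  rewrite E EL ER; apply: le_trans (ND _ _) _; exact: lerD (ND _ _) (ND _ _).
have [g1|l1] := leP (N J / 4) (N J1).
  by exists (x, y); split => //=; try lra; exists J1.
have [g2|l2] := leP (N J / 4) (N J2).
  exists (x + p', y); split => //=; try lra.
  by exists J2 => //; rewrite /= -?addrA.
have [g3|l3] := leP (N J / 4) (N J3).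
  exists (x, y + q'); split => //=; try lra.
  by exists J3 => //; rewrite /= -?addrA.
have [g4|l4] := leP (N J / 4) (N J4); last by lra.
exists (x + p', y + q'); split => //=; try lra.
by exists J4 => //; rewrite /= -?addrA.
Qed.

(** By bisection: nested rectangles shrink to a point, where differentiability makes the integral
    over a small rectangle less than the share of the original integral that it carries. *)
Lemma goursat J : rect_int x0 (x0 + p) y0 (y0 + q) J -> J = 0.
Proof.
move=> HJ; apply/eqP; rewrite -N_eq0 eq_le N_ge0 andbT leNgt; apply/negP => J0.
have succ (n : nat) (z : R * R) : exists z', inside n z ->
    (exists2 J', rint n z J' & N J / 4 ^+ n <= N J') ->
    [/\ z.1 <= z'.1, z'.1 + p / 2 ^+ n.+1 <= z.1 + p / 2 ^+ n,
     z.2 <= z'.2, z'.2 + q / 2 ^+ n.+1 <= z.2 + q / 2 ^+ n &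
     exists2 J', rint n.+1 z' J' & N J / 4 ^+ n.+1 <= N J'].
  have [inz|] := pselect (inside n z); last by exists z.
  have [[J' H1 H2]|] := pselect (exists2 J', rint n z J' & N J / 4 ^+ n <= N J');
    last by exists z.
  have [z' [h1 h2 h3 h4 [J'' H3 H4]]] := step inz H1.
  exists z' => _ _; split => //; exists J'' => //.
  apply: le_trans H4; rewrite exprSr invfM mulrA; lra.
pose s n z := projT1 (cid (succ n z)).
pose fix z n := if n is m.+1 then s m (z m) else (x0, y0).
have inv n : inside n (z n) /\ (exists2 J', rint n (z n) J' & N J / 4 ^+ n <= N J').
  elim: n => [|n [IH1 IH2]].
    by rewrite /inside /rint expr0 !divr1; split => //=; exists J; rewrite // expr0 divr1.
  rewrite /= /s; case: cid => z' /= /(_ IH1 IH2) [a1 a2 a3 a4 a5]; split => //.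
  by case: IH1 => b1 b2 b3 b4; split; lra.
have mono n : [/\ (z n).1 <= (z n.+1).1,
    (z n.+1).1 + p / 2 ^+ n.+1 <= (z n).1 + p / 2 ^+ n,
    (z n).2 <= (z n.+1).2 & (z n.+1).2 + q / 2 ^+ n.+1 <= (z n).2 + q / 2 ^+ n].
  by rewrite /= /s; case: cid => z' /= /(_ (inv n).1 (inv n).2) [].
have nest (u : nat -> R) (r : R) : 0 <= r -> (forall n, u n <= u n.+1) ->
    (forall n, u n.+1 + r / 2 ^+ n.+1 <= u n + r / 2 ^+ n) ->
    exists X, forall n, u n <= X <= u n + r / 2 ^+ n.
  move=> r0 u1 u2.
  have ud : {homo u : m n / (m <= n)%N >-> m <= n}.
    by apply: homo_leq => //; exact: le_trans.
  have uu m n : u m <= u n + r / 2 ^+ n.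
    have v n1 n2 : (n1 <= n2)%N -> u n2 + r / 2 ^+ n2 <= u n1 + r / 2 ^+ n1.
      elim: n2 => [|n2 IH]; first by rewrite leqn0 => /eqP ->.
      by rewrite leq_eqVlt => /orP[/eqP ->//|/IH]; exact/le_trans.
    have [mn|nm] := leqP m n.
      by apply: (le_trans (ud _ _ mn)); rewrite lerDl dge0.
    apply: le_trans (v _ _ (ltnW nm)); by rewrite lerDl dge0.
  exists (sup (range u)) => n; apply/andP; split.
    apply: ub_le_sup; last by exists n.
    by exists (u 0%N + r / 2 ^+ 0) => _ [m _ <-].
  by apply: ge_sup; [exists (u 0%N); exists 0%N|move=> _ [m _ <-]].
have [X HX] := nest (fun n => (z n).1) p p0 (fun n => let: And4 a _ _ _ := mono n in a)
  (fun n => let: And4 _ a _ _ := mono n in a).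
have [Y HY] := nest (fun n => (z n).2) q q0 (fun n => let: And4 _ _ a _ := mono n in a)
  (fun n => let: And4 _ _ _ a := mono n in a).
have [||l gl] := gd (x := X) (y := Y).
- by have := HX 0%N; rewrite /= expr0 divr1.
- by have := HY 0%N; rewrite /= expr0 divr1.
pose S := p + q + 1; have S0 : 0 < S by rewrite ltr_wpDl// addr_ge0.
(* With this e the bound of [rect_int_local] is half of the integral carried by step n. *)
pose e := N J / (8 * S ^+ 2).
have S20 : 0 < S ^+ 2 by rewrite exprn_gt0.
have e0 : 0 < e by rewrite divr_gt0// mulr_gt0.
move/hasdP : gl => /(_ _ e0) [d d0 dP].
have [n Hn] : exists n, S / 2 ^+ n < d.
  have /cvgrPdist_lt /(_ (d / S)) : (@GRing.exp R (2^-1)) @ \oo --> (0 : R).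
    by apply: cvg_expr; rewrite ger0_norm ?invf_lt1 ?ltr1n// invr_ge0.
  move=> /(_ _)[]; first by rewrite divr_gt0.
  move=> n _ /(_ n (leqnn n)) /=; rewrite sub0r normrN ger0_norm; last first.
    by rewrite exprn_ge0 // invr_ge0.
  by rewrite ltr_pdivlMr// mulrC exprVn => ?; exists n.
have [_ [J' HJ' JJ']] := inv n.
have P2 : 0 < (2 : R) ^+ n by rewrite exprn_gt0.
have pS : p / 2 ^+ n + q / 2 ^+ n <= S / 2 ^+ n.
  by rewrite -mulrDl ler_pM2r ?invr_gt0// lerDl.
have := HX n; have := HY n => hy hx.
have pn0 := dge0 n p0; have qn0 := dge0 n q0.
have : N J' <= 4 * (e * (S / 2 ^+ n)) * ((z n).1 + p / 2 ^+ n - (z n).1 +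
    ((z n).2 + q / 2 ^+ n - (z n).2)).
  apply: (rect_int_local (w0 := X +i* Y) (l := l)) HJ'; rewrite ?lerDl ?(ltW e0)//.
  move=> x y hx' hy'.
  have near : N ((x +i* y) - (X +i* Y)) <= S / 2 ^+ n.
    apply: le_trans (N_ReIm _) _; apply: le_trans pS.
    by apply: lerD; [exact: (dist_le hx' hx)|exact: (dist_le hy' hy)].
  split=> //; have /dP : N ((x +i* y) - (X +i* Y)) < d by exact: le_lt_trans near _.
  by rewrite [(X +i* Y) + _]addrC subrK.
have -> : (z n).1 + p / 2 ^+ n - (z n).1 + ((z n).2 + q / 2 ^+ n - (z n).2) =
   p / 2 ^+ n + q / 2 ^+ n by ring.
apply/negP; rewrite -ltNge; apply: lt_le_trans JJ'.
apply: (@le_lt_trans _ _ (4 * (e * (S / 2 ^+ n)) * (S / 2 ^+ n))).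
  apply: ler_wpM2l => //; apply: mulr_ge0 => //.
  by apply: mulr_ge0; [exact: ltW|rewrite divr_ge0 ?ltW].
have -> : 4 * (e * (S / 2 ^+ n)) * (S / 2 ^+ n) = N J / 4 ^+ n / 2.
  rewrite /e (_ : (4 : R) ^+ n = 2 ^+ n * 2 ^+ n); last by rewrite -exprMn -natrM.
  by field; rewrite !gt_eqF.
have : 0 < N J / 4 ^+ n by rewrite divr_gt0// exprn_gt0.
lra.
Qed.

End Bisection.
End Goursat.

(** * The complex exponential and means over circles *)

Section Cexp.
Variable R : realType.
Local Notation C := R[i].
Local Notation N := (@ComplexField.Normc.normc R).
Local Notation Re := (@complex.Re R).
Local Notation Im := (@complex.Im R).

Definition cexp (z : C) : C :=
  (expR (Re z) * cos (Im z)) +i* (expR (Re z) * sin (Im z)).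

Lemma cexpD z w : cexp (z + w) = cexp z * cexp w.
Proof.
by apply: ReIm_eq; rewrite ?Re_M ?Im_M /= Re_D Im_D expRD ?cosD ?sinD; ring.
Qed.

Lemma cexp0 : cexp 0 = 1.
Proof. by apply: ReIm_eq; rewrite /= expR0 ?cos0 ?sin0 mul1r. Qed.

Lemma N_cexp z : N (cexp z) = expR (Re z).
Proof.
apply/eqP; rewrite -(@eqrXn2 _ 2) ?N_ge0 ?expR_ge0// N_sq /= !exprMn -mulrDr.
by rewrite cos2Dsin2 mulr1.
Qed.

Lemma cexp_neq0 z : cexp z != 0.
Proof. by rewrite -N_gt0 N_cexp expR_gt0. Qed.

Lemma cexp_period x : cexp (x +i* (2 * pi)) = cexp (x +i* 0).
Proof. by rewrite /cexp /= mulr_natl cos2pi sin2pi cos0 sin0. Qed.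

(** The real and imaginary parts of cexp h - 1 - h are split into the first-order errors of
    [expR], [cos] and [sin]. *)
Lemma hasd_cexp0 : hasd cexp 0 1.
Proof.
have /real_derivP E : is_derive (0 : R) 1 expR 1.
  by have := is_derive_expR (0 : R); rewrite expR0.
have /real_derivP Co : is_derive (0 : R) 1 cos 0.
  by have := is_derive_cos (0 : R); rewrite sin0 oppr0.
have /real_derivP Si : is_derive (0 : R) 1 sin 1.
  by have := is_derive_sin (0 : R); rewrite cos0.
apply/hasdP => e e0.
pose e1 := Num.min 1 (e / 6).
have e10 : 0 < e1 by rewrite lt_min ltr01 divr_gt0.
have e1e : e1 <= e / 6 by rewrite ge_min lexx orbT.
have e11 : e1 <= 1 by rewrite ge_min lexx.
have [d1 d10 d1P] := E _ e10; have [d2 d20 d2P] := Co _ e10; have [d3 d30 d3P] := Si _ e10.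
exists (Num.min (Num.min d1 (e1 / 2)) (Num.min d2 d3)).
  by rewrite !lt_min d10 d20 d30 divr_gt0.
case=> x y; rewrite !lt_min => /andP[/andP[hd1 he]] /andP[hd2 hd3].
set h := x +i* y in hd1 hd2 hd3 he *.
have Nx : `|x| <= N h by exact: (N_Re h).
have Ny : `|y| <= N h by exact: (N_Im h).
have := d1P x (le_lt_trans Nx hd1); have := d2P y (le_lt_trans Ny hd2).
have := d3P y (le_lt_trans Ny hd3).
rewrite !add0r expR0 cos0 sin0 subr0 mul0r subr0 !mul1r => S1 C1 E1.
have Nh := N_ge0 h.
have Ex : `|expR x - 1| <= 2 * N h.
  have -> : expR x - 1 = (expR x - 1 - x) + x by ring.
  apply: le_trans (ler_normD _ _) _.
  have : e1 * `|x| <= `|x| by rewrite ler_piMl.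
  lra.
have Ex2 : `|expR x| <= 2.
  have -> : expR x = (expR x - 1) + 1 by ring.
  apply: le_trans (ler_normD _ _) _; rewrite normr1; lra.
rewrite cexp0; apply: le_trans (N_ReIm _) _; rewrite [complex.Re _]/= [complex.Im _]/=.
have -> : expR x * cos y - 1 - x = expR x * (cos y - 1) + (expR x - 1 - x) by ring.
have -> : expR x * sin y - 0 - y = expR x * (sin y - y) + (expR x - 1) * y by ring.
have m1 : `|expR x * (cos y - 1)| <= 2 * (e1 * N h).
  rewrite normrM; apply: ler_pM => //; apply: le_trans C1 _.
  by rewrite ler_wpM2l// ltW.
have m2 : `|expR x * (sin y - y)| <= 2 * (e1 * N h).
  rewrite normrM; apply: ler_pM => //; apply: le_trans S1 _.
  by rewrite ler_wpM2l// ltW.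
have m3 : `|(expR x - 1) * y| <= e1 * N h.
  rewrite normrM; apply: ler_pM => //; apply: le_trans Ex _; lra.
have m4 : e1 * `|x| <= e1 * N h by rewrite ler_wpM2l// ltW.
have m5 : e1 * N h <= e / 6 * N h by rewrite ler_wpM2r.
have := ler_normD (expR x * (cos y - 1)) (expR x - 1 - x).
have := ler_normD (expR x * (sin y - y)) ((expR x - 1) * y).
lra.
Qed.

Lemma hasd_cexp z : hasd cexp z (cexp z).
Proof.
have /hasdP H := hasd_cexp0; apply/hasdP => e e0.
have [|d d0 dP] := H (e / N (cexp z)).
  by rewrite divr_gt0// N_gt0 cexp_neq0.
exists d => // h /dP; rewrite add0r cexp0 mul1r => hd.
have -> : cexp (z + h) - cexp z - cexp z * h = cexp z * (cexp h - 1 - h).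
  by rewrite cexpD; ring.
rewrite NM mulrC -ler_pdivlMr ?N_gt0 ?cexp_neq0//.
by rewrite mulrAC.
Qed.

Definition cis (t : R) : C := cexp (0 +i* t).

Lemma N_cis t : N (cis t) = 1. Proof. by rewrite N_cexp expR0. Qed.

Lemma cexp_cis x t : cexp (x +i* t) = (expR x)%:C * cis t.
Proof. by apply: ReIm_eq; rewrite /= ?expR0 /=; ring. Qed.

Lemma N_eps0 (z : C) (K : R) : (forall e : R, 0 < e -> N z <= K * e) -> z = 0.
Proof.
move=> H; apply/eqP; rewrite -N_eq0 eq_le N_ge0 andbT leNgt; apply/negP => z0.
have K0 : 0 < K.
  by have := H 1 ltr01; rewrite mulr1; exact: lt_le_trans.
have := H (N z / K / 2) ltac:(by rewrite !divr_gt0).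
rewrite (_ : K * _ = N z / 2); last by field; rewrite gt_eqF.
lra.
Qed.

Lemma cont_vert (g : C -> C) (x y : R) : {for (x +i* y), continuous g} ->
  {for y, continuous (fun y => g (x +i* y))}.
Proof.
move=> gc; exact: (@continuous_comp _ _ _ (fun y => x +i* y) g y
    (rderiv_continuous (rderiv_vert x y)) gc).
Qed.

(* H is holomorphic in the punctured disc of radius r0 except perhaps on the circle of radius
   rho: in the Cauchy formula H is a quotient by w - z, and rho is the modulus of z. *)
Section CircleMean.
Variables (H : C -> C) (r0 rho : R).
Hypothesis Hc : forall w, N w < r0 -> {for w, continuous H}.
Hypothesis Hd : forall w, 0 < N w -> N w < r0 -> N w != rho -> exists l, hasd H w l.

(** The exponential maps vertical segments of length 2 pi to circles about 0, and rectangles of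
    this height to annuli. *)
Let G z := H (cexp z).
Let tp : R := 2 * pi.
Let tp0 : 0 <= tp. Proof. by rewrite mulr_ge0// ltW// pi_gt0. Qed.

Let Gc x y : expR x < r0 -> {for (x +i* y), continuous G}.
Proof.
move=> xr; apply: (@continuous_comp _ _ _ cexp H); first exact: hasd_continuous (hasd_cexp _).
by apply: Hc; rewrite N_cexp.
Qed.

Let Vex x : expR x < r0 -> exists v, has_int 0 tp (fun y => G (x +i* y)) v.
Proof.
move=> xr; apply: int_exists => // y _.
exact: cont_vert (@Gc x y xr).
Qed.

Let V x v := has_int 0 tp (fun y => G (x +i* y)) v.

(** Goursat for the rectangle between the two segments; its horizontal sides cancel by
    periodicity. *)
Let Vconst x1 x2 v1 v2 : x1 <= x2 -> expR x2 < r0 ->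
  (forall x, x1 <= x <= x2 -> expR x != rho) -> V x1 v1 -> V x2 v2 -> v1 = v2.
Proof.
move=> x12 xr xrho V1 V2.
have xr' x : x1 <= x <= x1 + (x2 - x1) -> expR x < r0.
  by move=> /andP[_ xx]; apply: le_lt_trans xr; rewrite ler_expR; lra.
have gd x y : x1 <= x <= x1 + (x2 - x1) -> 0 <= y <= 0 + tp -> exists l, hasd G (x +i* y) l.
  move=> xx _; have [|||l Hl] := Hd (w := cexp (x +i* y)); rewrite ?N_cexp ?expR_gt0//.
  - exact: xr'.
  - by apply: xrho; move: xx; rewrite addrC subrK.
  by exists (l * cexp (x +i* y)); exact: hasd_comp (hasd_cexp _) Hl.
have x120 : 0 <= x2 - x1 by rewrite subr_ge0.
have [|||J HJ] := @rect_int_exists R G x1 (x1 + (x2 - x1)) 0 (0 + tp).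
- by rewrite lerDl.
- by rewrite lerDl.
- by move=> x y xx _; apply: Gc; exact: xr'.
have := goursat x120 tp0 gd HJ.
case: HJ => h1 [h2 [w1 [w2 [K1 K2 K3 K4 ->]]]].
rewrite add0r in K2 K3 K4; rewrite (addrC x1) subrK in K1 K2 K4.
have -> : h1 = h2.
  apply: (int_unique x12 K1); apply: int_ext K2 => x _.
  by rewrite /G /tp cexp_period.
rewrite (int_unique tp0 K3 V1) (int_unique tp0 K4 V2) subrr add0r => /eqP.
rewrite mulf_eq0 -N_eq0 N_imag oner_eq0 /= subr_eq0 => /eqP ->.
by [].
Qed.

(** Uniform continuity along the segment, by compactness; it carries the mean across the
    exceptional circle. *)
Let Vcont x0 v0 : expR x0 < r0 -> V x0 v0 -> forall e : R, 0 < e ->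
  exists2 d : R, 0 < d & forall x v, `|x - x0| < d -> V x v -> N (v - v0) <= 2 * tp * e.
Proof.
move=> xr V0 e e0.
have /compact_near_coveringP cov := @segment_compact R 0 tp.
pose P x y := N (G (x +i* y) - G (x0 +i* y)) < e.
have [|d /= d0 dP] := cov R (nbhs x0) P _.
  move=> y _; have /ccontP /(_ (e / 2)) [|d d0 dP] := @Gc x0 y xr; first by rewrite divr_gt0.
  exists (ball y (d / 2), ball x0 (d / 2)).
    by split; apply: nbhsx_ballx; rewrite divr_gt0.
  case=> y' x' [/= yy xx]; rewrite /ball/= in yy xx.
  have A : N (G (x' +i* y') - G (x0 +i* y)) < e / 2.
    apply: dP; apply: le_lt_trans (N_ReIm _) _.
    by rewrite /= distrC [ `|y' - _|]distrC; lra.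
  have B : N (G (x0 +i* y') - G (x0 +i* y)) < e / 2.
    apply: dP; apply: le_lt_trans (N_ReIm _) _.
    by rewrite /= subrr normr0 [ `|y' - _|]distrC; lra.
  rewrite /P; have -> : G (x' +i* y') - G (x0 +i* y') =
    (G (x' +i* y') - G (x0 +i* y)) - (G (x0 +i* y') - G (x0 +i* y)) by ring.
  apply: le_lt_trans (NB _ _) _; lra.
exists d => // x v xd Vx.
have := int_bound (M := e) tp0 _ (intB Vx V0); rewrite subr0.
move=> h; apply: (le_trans (h _)); last by rewrite mulrAC.
move=> y yt; apply/ltW; apply: (dP x) => /=; first by rewrite distrC.
by rewrite in_itv.
Qed.

Let V0lim : 0 < r0 -> forall e : R, 0 < e -> exists K, forall x v, x < K -> V x v ->
  N (v - H 0 * tp%:C) <= 2 * tp * e.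
Proof.
move=> r00 e e0; have H0c : {for (0 : C), continuous H} by apply: Hc; rewrite N0.
have [d d0 dP] := (ccontP H 0).1 H0c e e0.
exists (ln d) => x v xd Vx.
have V0 := int_cst 0 tp (H 0); rewrite subr0 in V0.
have := int_bound (M := e) tp0 _ (intB Vx V0); rewrite subr0.
move=> h; apply: (le_trans (h _)); last by rewrite mulrAC.
move=> y yt; apply/ltW; apply: dP; rewrite subr0 N_cexp /=.
by rewrite -[d]lnK// ltr_expR.
Qed.

(** The mean does not change with the radius, by [Vconst] and [Vcont], and tends to the value
    at 0 as the radius tends to 0. *)
Lemma circle_mean r : 0 < r -> r < r0 ->
  has_int 0 (2 * pi) (fun t => H (r%:C * cis t)) (H 0 * (2 * pi)%:C).
Proof.
move=> r_gt0 rr0; have r00 := lt_trans r_gt0 rr0.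
(* Radii inside the exceptional circle. *)
have A x v : expR x < r0 -> expR x < rho \/ rho <= 0 -> V x v -> v = H 0 * tp%:C.
  move=> xr xrho Vx; apply/eqP; rewrite -subr_eq0; apply/eqP.
  apply: (@N_eps0 _ (2 * tp)) => e /(V0lim r00)[K KP].
  pose x' := Num.min (K - 1) x.
  have x'x : x' <= x by rewrite ge_min lexx orbT.
  have x'K : x' < K by rewrite gt_min ltrBlDr ltrDl ltr01.
  have [v' Vx'] := Vex (le_lt_trans (etrans (ler_expR _ _) x'x) xr).
  rewrite -(Vconst x'x xr _ Vx' Vx); first exact: KP Vx'.
  move=> u /andP[_ ux]; case: xrho => [xrho|rho0].
    by rewrite lt_eqF//; apply: le_lt_trans xrho; rewrite ler_expR.
  by rewrite gt_eqF// (le_lt_trans rho0)// expR_gt0.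
(* The exceptional circle itself, from inside. *)
have B x v : expR x < r0 -> expR x = rho -> V x v -> v = H 0 * tp%:C.
  move=> xr xrho Vx; apply/eqP; rewrite -subr_eq0; apply/eqP.
  apply: (@N_eps0 _ (2 * tp)) => e /(Vcont xr Vx)[d d0 dP].
  have x'x : x - d / 2 < x by lra.
  have [v' Vx'] := Vex (lt_trans (etrans (ltr_expR _ _) x'x) xr).
  rewrite -(A _ _ _ _ Vx'); first 1 last.
  - by apply: lt_trans xr; rewrite ltr_expR.
  - by left; rewrite -xrho ltr_expR.
  rewrite NBC; apply: dP Vx'; rewrite ler0_norm; lra.
(* Radii beyond it, starting from the exceptional circle. *)
have V0 x v : expR x < r0 -> V x v -> v = H 0 * tp%:C.
  move=> xr Vx; have [xrho|xrho|xrho] := ltgtP (expR x) rho.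
  - by apply: A Vx => //; left.
  - have [rho0|rho0] := leP rho 0; first by apply: A Vx => //; right.
    have Er : expR (ln rho) = rho by rewrite lnK.
    have rr : expR (ln rho) < r0 by rewrite Er (lt_trans xrho).
    have [w Vw] := Vex rr; have Ew := B _ _ rr Er Vw; rewrite -Ew.
    have lx : ln rho < x by rewrite -ltr_expR Er.
    apply/eqP; rewrite -subr_eq0; apply/eqP.
    apply: (@N_eps0 _ (2 * tp)) => e /(Vcont rr Vw)[d d0 dP].
    pose x' := Num.min x (ln rho + d / 2).
    have x'x : x' <= x by rewrite ge_min lexx.
    have lx' : ln rho < x' by rewrite lt_min lx/=; lra.
    have x'd : x' <= ln rho + d / 2 by rewrite ge_min lexx orbT.
    have [v' Vx'] := Vex (le_lt_trans (etrans (ler_expR _ _) x'x) xr).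
    rewrite -(Vconst x'x xr _ Vx' Vx).
      by apply: dP Vx'; rewrite ger0_norm; lra.
    move=> u /andP[x'u _]; rewrite gt_eqF// -Er ltr_expR.
    exact: lt_le_trans x'u.
  - exact: B Vx.
have [|v Vx] := Vex (x := ln r); first by rewrite lnK.
have E : expR (ln r) = r by rewrite lnK.
rewrite -(V0 _ _ _ Vx) ?E//; apply: int_ext Vx => t _.
by rewrite /G cexp_cis E.
Qed.

End CircleMean.
End Cexp.

(** * Power series expansion *)

Section Taylor.
Variable R : realType.
Local Notation C := R[i].
Local Notation N := (@ComplexField.Normc.normc R).
Local Notation I := ('i%C : C).

Lemma disc_compact (c : C) (r : R) : compact [set z : C | N (z - c) <= r].
Proof.
have sq : compact ((fun p : R * R => c + (p.1 +i* p.2)) @` (`[- r, r] `*` `[- r, r])).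
  apply: continuous_compact; last by apply: compact_setX; exact: segment_compact.
  apply: continuous_subspaceT => p.
  apply: (@cvg_ReIm _ _ _ (nbhs_filter p)) => /=.
    under eq_fun do rewrite Re_D; rewrite Re_D.
    by apply: cvgD; [exact: cvg_cst|exact: cvg_fst].
  under eq_fun do rewrite Im_D; rewrite Im_D.
  by apply: cvgD; [exact: cvg_cst|exact: cvg_snd].
apply: subclosed_compact sq _.
  have -> : [set z : C | N (z - c) <= r] = (fun z => N (z - c)) @^-1` [set x | x <= r].
    by [].
  apply: preimage_closed; last exact: closed_le.
  by move=> z _; exact: (@continuous_comp _ _ _ (fun z : C => z - c) N z
    (hasd_continuous (hasdB (hasd_id z) (hasd_cst c z))) (@N_continuous R _)).
move=> z /= zr; exists (complex.Re (z - c), complex.Im (z - c)) => /=; last first.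
  by rewrite addrC -[X in X + c](_ : z - c = _) ?subrK//; case: (z - c).
by split; rewrite /= in_itv /= -ler_norml; apply: le_trans zr; [exact: N_Re|exact: N_Im].
Qed.

(** Holomorphic on the open disc of centre [c] and radius [r]. *)
Definition hol (f : C -> C) (c : C) (r : R) :=
  forall w, N (w - c) < r -> exists l, hasd f w l.

Lemma bounded_disc (f : C -> C) (c : C) (r : R) :
  (forall w, N (w - c) <= r -> {for w, continuous f}) ->
  exists2 M : R, 0 < M & forall w, N (w - c) <= r -> N (f w) <= M.
Proof.
move=> fc.
have cf : {within [set z : C | N (z - c) <= r], continuous (fun w => N (f w))}.
  apply/continuous_in_subspaceT => w /set_mem /= wr.
  exact: (@continuous_comp _ _ _ f N w (fc _ wr) (@N_continuous R _)).
have /compact_bounded[M [_ HM]] := continuous_compact cf (@disc_compact c r).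
exists (`|M| + 1) => [|w wr]; first by rewrite ltr_wpDl.
have M1 : M < `|M| + 1 by apply: le_lt_trans (ler_norm _) _; rewrite ltrDl.
have := HM _ M1 (N (f w)) (ex_intro2 _ _ w wr erefl).
by rewrite /= ger0_norm// N_ge0.
Qed.

Lemma rderiv_circle (r t : R) : rderiv (fun t => r%:C * cis t) t (r%:C * cis t * I).
Proof.
rewrite -mulrA; apply: rderivZ.
exact: (rderiv_comp (rderiv_vert 0 t) (hasd_cexp _)).
Qed.

Lemma N_circle (r t : R) : 0 < r -> N (r%:C * cis t) = r.
Proof. by move=> r0; rewrite NM N_cis N_real mulr1 gtr0_norm. Qed.

Lemma hasd_inv (z : C) : z != 0 -> hasd (fun w => w^-1) z (- 1 / z ^+ 2).
Proof. by move=> z0; exact: (@hasdV _ id _ _ z0 (hasd_id z)). Qed.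

(** The negative powers w ^- n with n > 0 are derivatives along the circle, since dw = i w dt. *)
Lemma int_pow (r : R) n : 0 < r ->
  has_int 0 (2 * pi) (fun t => (r%:C * cis t)^-1 ^+ n) (if n == 0%N then (2 * pi)%:C else 0).
Proof.
move=> r0; case: n => [|n] /=.
  have := int_cst 0 (2 * pi) (1 : C); rewrite mul1r subr0; apply: int_ext => t _.
  by rewrite expr0.
pose k : C := - n.+1%:R * I.
have k0 : k != 0.
  by rewrite mulf_neq0 ?oppr_eq0 ?pnatr_eq0// -N_gt0 N_imag.
exists (fun t => k^-1 * (r%:C * cis t)^-1 ^+ n.+1); last first.
  by rewrite /cis -(cexp_period 0) subrr.
move=> t _.
have w0 : r%:C * cis t != 0 by rewrite -N_gt0 N_circle.
have D := hasdX n.+1 (hasd_inv w0).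
have := rderivZ k^-1 (rderiv_comp (rderiv_circle r t) D).
set w := r%:C * cis t in w0 *.
suff -> : k^-1 * (n.+1%:R * w^-1 ^+ n.+1.-1 * (- 1 / w ^+ 2) * (w * I)) = w^-1 ^+ n.+1.
  by [].
rewrite /= [w^-1 ^+ n.+1]exprSr; move: (w^-1 ^+ n) => W.
have -> : n.+1%:R * W * (-1 / w ^+ 2) * (w * I) = k * (W * w^-1).
  by rewrite /k; field.
by rewrite mulrA mulVf// mul1r.
Qed.

Lemma contM (f g : C -> C) (z : C) : {for z, continuous f} -> {for z, continuous g} ->
  {for z, continuous (fun w => f w * g w)}.
Proof.
move=> fc gc; exact: (@cvgM _ _ _ (nbhs_filter z) f g _ _ fc gc).
Qed.

(** Extended at [z] by the value [l], which is to be the derivative of [f] at [z]. *)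
Definition diff_quotient (f : C -> C) (z l w : C) : C :=
  if w == z then l else (f w - f z) / (w - z).

Lemma diff_quotient_continuous f z l : hasd f z l -> {for z, continuous (diff_quotient f z l)}.
Proof.
move=> /hasdP H; apply/ccontP => e e0.
have [|d d0 dP] := H (e / 2); first by rewrite divr_gt0.
exists d => // y yd; rewrite /diff_quotient eqxx; case: eqVneq => [_|yz].
  by rewrite subrr N0.
have h0 : y - z != 0 by rewrite subr_eq0.
have -> : (f y - f z) / (y - z) - l = (f y - f z - l * (y - z)) / (y - z).
  by field.
rewrite NM NV ltr_pdivrMr ?N_gt0//.
have := dP _ yd; rewrite [z + _]addrC subrK => /le_lt_trans; apply.
by rewrite ltr_pM2r ?N_gt0//; lra.
Qed.

Lemma diff_quotient_hasd f z l w a : w != z -> hasd f w a -> exists b, hasd (diff_quotient f z l) w b.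
Proof.
move=> wz fa.
have D := hasdM (hasdB fa (hasd_cst (f z) w))
  (hasdV (f := fun w => w - z) (t := w) _ (hasdB (hasd_id w) (hasd_cst z w))).
have {}D := D ltac:(by rewrite subr_eq0).
eexists; apply: hasd_ext D; exists (N (w - z)); first by rewrite N_gt0 subr_eq0.
move=> y ywz; rewrite /diff_quotient; case: eqVneq => // yz.
by move: ywz; rewrite yz NBC ltxx.
Qed.

Lemma geom_split (w z : C) n : w != 0 -> w != z ->
  w / (w - z) = \sum_(i < n) z ^+ i * w^-1 ^+ i + (z / w) ^+ n * (w / (w - z)).
Proof.
move=> w0 wz; have wz0 : w - z != 0 by rewrite subr_eq0.
elim: n => [|n IH]; first by rewrite big_ord0 expr0 add0r mul1r.
rewrite big_ord_recr /= {1}IH -addrA; congr (_ + _).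
rewrite exprS -exprMn; move: ((z / w) ^+ n) => W.
by field; rewrite w0 wz0.
Qed.

(** The mean of w (f w - f z) / (w - z) over the circle is zero ([circle_mean]): this is the
    Cauchy formula.  Expanding w / (w - z) in a geometric series ([geom_split]) and integrating
    term by term gives the expansion with its remainder. *)
Lemma taylor_exists (f : C -> C) (c : C) (r0 r : R) : 0 < r -> r < r0 -> hol f c r0 ->
  exists a : nat -> C,
  (forall M : R, (forall w, N (w - c) = r -> N (f w) <= M) -> forall n, N (a n) * r ^+ n <= 2 * M) /\
  (forall M : R, (forall w, N (w - c) <= r -> N (f w) <= M) -> forall z n, N z < r ->
     N (f (c + z) - \sum_(i < n) a i * z ^+ i) <= 4 * M * (N z / r) ^+ n * (r / (r - N z))).
Proof.
move=> r_gt0 rr0 fh.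
pose tp : R := 2 * pi.
have tp0 : 0 < tp by rewrite mulr_gt0// pi_gt0.
pose g w := f (c + w).
have gh w : N w < r0 -> exists l, hasd g w l.
  move=> wr; have [|l fl] := fh (c + w); first by rewrite addrC addKr.
  by exists (l * (0 + 1)); exact: (hasd_comp (hasdD (hasd_cst c w) (hasd_id w)) fl).
pose W t := r%:C * cis t.
have NW t : N (W t) = r by exact: N_circle.
have W0 t : W t != 0 by rewrite -N_gt0 NW.
have vex n : exists v, has_int 0 tp (fun t => g (W t) * (W t)^-1 ^+ n) v.
  apply: int_exists => [|t _]; first exact: ltW.
  have [|l gl] := gh (W t); first by rewrite NW.
  have D := hasdM gl (hasdX n (hasd_inv (W0 t))).
  exact: rderiv_continuous (rderiv_comp (rderiv_circle r t) D).
pose v n := projT1 (cid (vex n)).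
have Hv n : has_int 0 tp (fun t => g (W t) * (W t)^-1 ^+ n) (v n).
  by rewrite /v; case: cid.
have tpC : tp%:C != 0 :> C by rewrite -N_gt0 N_real normr_gt0 gt_eqF.
have Ntp : N (tp%:C : C) = tp by rewrite N_real gtr0_norm.
exists (fun n => v n / tp%:C); split.
  move=> M fM n.
  have := int_bound (M := M / r ^+ n) (ltW tp0) _ (Hv n); rewrite subr0 => B.
  rewrite NM NV Ntp -ler_pdivlMr ?exprn_gt0// ler_pdivrMr//.
  rewrite -(mulrA 2 M); apply: B => t _; rewrite NM NX NV NW exprVn.
  rewrite ler_pM2r ?invr_gt0 ?exprn_gt0//; apply: fM.
  by rewrite addrC addKr.
move=> M fM z n zr.
have M0 : 0 <= M by apply: le_trans (N_ge0 _) (fM c _); rewrite subrr N0 ltW.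
have gM w : N w <= r -> N (g w) <= M by move=> wr; apply: fM; rewrite addrC addKr.
have rz0 : 0 < r - N z by rewrite subr_gt0.
case: n => [|n].
  rewrite big_ord0 subr0 expr0 mulr1; apply: le_trans (gM _ (ltW zr)) _.
  rewrite -mulrA mulrCA ler_peMr//.
  have : 1 <= r / (r - N z) by rewrite ler_pdivlMr// mul1r gerBl N_ge0.
  lra.
have [l gl] := gh z (lt_trans zr rr0).
(* H is continuous on the disc and holomorphic off the circle through z. *)
pose H w := w * diff_quotient g z l w.
have Hc w : N w < r0 -> {for w, continuous H}.
  move=> wr; have [->|wz] := eqVneq w z.
    exact: contM (hasd_continuous (hasd_id z)) (diff_quotient_continuous gl).
  have [a ga] := gh w wr; have [b gb] := diff_quotient_hasd l wz ga.
  exact: hasd_continuous (hasdM (hasd_id w) gb).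
have Hd w : 0 < N w -> N w < r0 -> N w != N z -> exists l, hasd H w l.
  move=> _ wr wz; have [a ga] := gh w wr.
  have wz' : w != z by apply: contra_neq wz => ->.
  have [b gb] := diff_quotient_hasd l wz' ga.
  by eexists; exact: (hasdM (hasd_id w) gb).
have := circle_mean Hc Hd r_gt0 rr0; rewrite {2}/H mul0r mul0r -/tp => IH.
have P1 := int_sum (n := n.+1) (v := fun i => z ^+ i * v i) (fun i _ => intZ (z ^+ i) (Hv i)).
have P2 := intZ (g z) (int_sum (n := n.+1) (fun i _ => intZ (z ^+ i) (int_pow i r_gt0))).
have E : \sum_(i < n.+1) z ^+ i * (if i == 0 :> nat then (2 * pi)%:C else 0) = tp%:C.
  rewrite big_ord_recl /= expr0 mul1r big1 ?addr0// => i _.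
  by rewrite mulr0.
rewrite E in P2.
have := intB IH (intB P1 P2); rewrite -/tp sub0r => P3.
have := int_bound (M := 2 * M * (N z / r) ^+ n.+1 * (r / (r - N z))) (ltW tp0) _ P3.
rewrite subr0 => B.
have -> : g z - \sum_(i < n.+1) v i / tp%:C * z ^+ i =
  tp%:C^-1 * - (\sum_(i < n.+1) z ^+ i * v i - g z * tp%:C).
  rewrite opprB mulrBr mulrCA mulVf// mulr1; congr (_ - _).
  by rewrite mulr_sumr; apply: eq_bigr => i _; ring.
rewrite NM NV Ntp mulrC ler_pdivrMr//.
have -> : 4 * M * (N z / r) ^+ n.+1 * (r / (r - N z)) * tp =
  2 * (2 * M * (N z / r) ^+ n.+1 * (r / (r - N z))) * tp by ring.
apply: B => t _; have wz : W t != z by apply: contraTneq zr => <-; rewrite NW ltxx.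
have -> : H (W t) - (\sum_(i < n.+1) z ^+ i * (g (W t) * (W t)^-1 ^+ i) -
    g z * \sum_(i < n.+1) z ^+ i * (W t)^-1 ^+ i) =
    (g (W t) - g z) * ((z / W t) ^+ n.+1 * (W t / (W t - z))).
  have := geom_split n.+1 (W0 t) wz; set S := \sum_(i < _) _ => G.
  have -> : \sum_(i < n.+1) z ^+ i * (g (W t) * (W t)^-1 ^+ i) = g (W t) * S.
    by rewrite /S mulr_sumr; apply: eq_bigr => i _; ring.
  rewrite /H /diff_quotient (negbTE wz).
  have -> : W t * ((g (W t) - g z) / (W t - z)) = (g (W t) - g z) * (W t / (W t - z)) by ring.
  rewrite {1}G; ring.
move: (W t) wz (NW t) => w wz Nw.
have gwz : N (g w - g z) <= 2 * M.
  apply: le_trans (NB _ _) _; have := gM _ (ltW zr); have := gM w; rewrite Nw lexx.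
  by move=> /(_ isT); lra.
rewrite NM -[leRHS]mulrA; apply: ler_pM; rewrite ?N_ge0//.
rewrite !NM NX NM !NV Nw ler_wpM2l//; first by rewrite exprn_ge0// divr_ge0 ?N_ge0 ?ltW.
rewrite ler_wpM2l ?(ltW r_gt0)// lef_pV2 ?posrE// ?N_gt0 ?subr_eq0//.
by have := NB_ge w z; rewrite Nw.
Qed.

End Taylor.

(** * Cauchy estimates and Weierstrass's theorem *)

Section OneVar.
Variable R : realType.
Local Notation C := R[i].
Local Notation N := (@ComplexField.Normc.normc R).
Local Notation Re := (@complex.Re R).
Local Notation Im := (@complex.Im R).

Lemma hol_sub (f : C -> C) (c : C) (r : R) (c' : C) (r' : R) : hol f c r -> N (c' - c) + r' <= r -> hol f c' r'.
Proof.
move=> fh cr w wr; apply: fh; apply: lt_le_trans cr.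
have -> : w - c = (w - c') + (c' - c) by ring.
by apply: le_lt_trans (ND _ _) _; rewrite addrC ltrD2l.
Qed.

Lemma hol_derive1 (f : C -> C) (c : C) (r : R) (w : C) : hol f c r -> N (w - c) < r -> hasd f w (derive1 f w).
Proof. by move=> fh /fh[l /[dup] H /hasd_derive1 ->]. Qed.

(** The first two coefficients are read off the remainder bounds for n = 1 and n = 2. *)
Lemma taylor0 (f : C -> C) (c : C) (r0 r : R) : 0 < r -> r < r0 -> hol f c r0 ->
  exists a : nat -> C, [/\ a 0%N = f c, a 1%N = derive1 f c,
   (forall M : R, (forall w, N (w - c) = r -> N (f w) <= M) -> forall n, N (a n) * r ^+ n <= 2 * M) &
   (forall M : R, (forall w, N (w - c) <= r -> N (f w) <= M) -> forall z n, N z < r ->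
     N (f (c + z) - \sum_(i < n) a i * z ^+ i) <= 4 * M * (N z / r) ^+ n * (r / (r - N z)))].
Proof.
move=> r_gt0 rr0 fh; have [a [a1 a2]] := taylor_exists r_gt0 rr0 fh.
have fc w : N (w - c) <= r -> {for w, continuous f}.
  move=> wr; have [l fl] := fh w (le_lt_trans wr rr0); exact: hasd_continuous fl.
have [M M0 HM] := bounded_disc fc.
have E0 : a 0%N = f c.
  have := a2 M HM 0 1%N; rewrite N0 mul0r expr1 mulr0 mul0r => /(_ r_gt0).
  rewrite big_ord_recl big_ord0 expr0 mulr1 !addr0 => H.
  by apply/esym/eqP; rewrite -subr_eq0 -N_eq0 eq_le N_ge0 H.
exists a; split => //; apply/esym/hasd_derive1/hasdP => e e0.
pose K := 8 * M / r ^+ 2; have K0 : 0 < K by rewrite !(mulr_gt0, invr_gt0, exprn_gt0).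
exists (Num.min (r / 2) (e / K)).
  by rewrite lt_min (divr_gt0 r_gt0)// (divr_gt0 e0 K0).
move=> h; rewrite lt_min => /andP[hr]; rewrite ltr_pdivlMr// => hK.
have hr' : N h < r by lra.
have := a2 M HM h 2%N hr'; rewrite !big_ord_recl big_ord0 /= expr0 mulr1 addr0 E0 expr1.
rewrite opprD addrA => /le_trans; apply.
apply: (@le_trans _ _ (4 * M * (N h / r) ^+ 2 * 2)).
  apply: ler_wpM2l; last by rewrite ler_pdivrMr; lra.
  exact: (mulr_ge0 (mulr_ge0 (ler0n _ 4) (ltW M0))
    (exprn_ge0 _ (divr_ge0 (N_ge0 _) (ltW r_gt0)))).
have -> : 4 * M * (N h / r) ^+ 2 * 2 = (N h * K) * N h by rewrite /K; field; rewrite gt_eqF.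
by rewrite ler_wpM2r ?N_ge0 ?ltW.
Qed.

Lemma center_bound_of_circle (f : C -> C) (c : C) (r0 r M : R) : 0 < r -> r < r0 -> hol f c r0 ->
  (forall w, N (w - c) = r -> N (f w) <= M) -> N (f c) <= 2 * M.
Proof.
move=> r_gt0 rr0 fh fM; have [a [<- _ /(_ _ fM 0%N) H _]] := taylor0 r_gt0 rr0 fh.
by rewrite expr0 mulr1 in H.
Qed.

Lemma cvg0_geom (K x e : R) : 0 <= x -> x < 1 -> 0 < e ->
  exists n0, forall n, (n0 <= n)%N -> K * x ^+ n < e.
Proof.
move=> x0 x1 e0.
have : (fun n => K * x ^+ n) @ \oo --> K * 0.
  by apply: cvgMr; apply: cvg_expr; rewrite ger0_norm.
rewrite mulr0 => /cvgrPdist_lt /(_ _ e0)[n0 _ Hn0]; exists n0 => n /Hn0 /=.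
by rewrite sub0r normrN; exact/le_lt_trans/ler_norm.
Qed.

(** A substitute for the maximum principle: sum the geometric series that bounds the Taylor
    terms. *)
Lemma disc_bound_of_circle (f : C -> C) (c : C) (r0 r M : R) (z : C) : 0 < r -> r < r0 -> hol f c r0 ->
  (forall w, N (w - c) = r -> N (f w) <= M) -> N z < r ->
  N (f (c + z)) <= 2 * M * (r / (r - N z)).
Proof.
move=> r_gt0 rr0 fh fM zr; have [a [_ _ H1 H2]] := taylor0 r_gt0 rr0 fh.
have fc w : N (w - c) <= r -> {for w, continuous f}.
  move=> wr; have [l fl] := fh w (le_lt_trans wr rr0); exact: hasd_continuous fl.
have [M' M'0 /H2 HM] := bounded_disc fc.
have Nz := N_ge0 z; pose x := N z / r.
have x0 : 0 <= x by rewrite divr_ge0// ltW.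
have x1 : x < 1 by rewrite ltr_pdivrMr// mul1r.
have M0 : 0 <= 2 * M by have := H1 _ fM 0%N; rewrite expr0 mulr1; exact/le_trans/N_ge0.
have S n : N (\sum_(i < n) a i * z ^+ i) <= 2 * M * (r / (r - N z)).
  have -> : r / (r - N z) = (1 - x)^-1 by rewrite /x; field; rewrite !gt_eqF// subr_gt0.
  apply: le_trans (N_sum _ _ _) _.
  apply: (@le_trans _ _ (\sum_(i < n) 2 * M * x ^+ i)).
    apply: ler_sum => i _; rewrite NM NX /x expr_div_n mulrA mulrAC.
    rewrite ler_wpM2r ?exprn_ge0//.
    by rewrite ler_pdivlMr ?exprn_gt0//; exact: H1.
  rewrite -mulr_sumr ler_wpM2l//.
  rewrite -[leRHS]mul1r ler_pdivlMr ?subr_gt0//.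
  have := subrX1 x n; set S := \sum_(i < n) _ => E.
  have -> : S * (1 - x) = - ((x - 1) * S) by ring.
  by rewrite -E; have := exprn_ge0 n x0; lra.
apply/ler_addgt0Pr => e e0.
have [n0 /(_ n0 (leqnn _)) Hn] := cvg0_geom (4 * M' * (r / (r - N z))) x0 x1 e0.
have -> : f (c + z) = (f (c + z) - \sum_(i < n0) a i * z ^+ i) + \sum_(i < n0) a i * z ^+ i.
  by rewrite subrK.
apply: le_trans (ND _ _) _; rewrite addrC; apply: lerD; first exact: S.
by apply: le_trans (HM z n0 zr) _; rewrite mulrAC ltW.
Qed.

Lemma cauchy_derivative (f : C -> C) (c : C) (r M : R) (l : C) : 0 < r -> hol f c r ->
  (forall w, N (w - c) < r -> N (f w) <= M) -> hasd f c l -> N l <= 4 * M / r.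
Proof.
move=> r0 fh fM fl; have r20 : 0 < r / 2 by rewrite divr_gt0.
have r2r : r / 2 < r by lra.
have [a [_ a1 H _]] := taylor0 r20 r2r fh.
have := H M _ 1%N; rewrite a1 (hasd_derive1 fl) expr1 ler_pdivlMr// => H'.
suff : N l * (r / 2) <= 2 * M by lra.
by apply: H' => w wr; apply: fM; rewrite wr.
Qed.

Lemma quad_remainder (f : C -> C) (c : C) (r M : R) (l : C) : 0 < r -> hol f c r ->
  (forall w, N (w - c) < r -> N (f w) <= M) -> hasd f c l ->
  forall h, N h <= r / 4 -> N (f (c + h) - f c - l * h) <= 32 * M / r ^+ 2 * N h ^+ 2.
Proof.
move=> r0 fh fM fl h hr; have r20 : 0 < r / 2 by rewrite divr_gt0.
have r2r : r / 2 < r by lra.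
have [a [a0 a1 _ H]] := taylor0 r20 r2r fh.
have M0 : 0 <= M by apply: le_trans (N_ge0 _) (fM c _); rewrite subrr N0.
have := H M _ h 2%N; rewrite !big_ord_recl big_ord0 /= expr0 mulr1 addr0 expr1 a0 a1.
rewrite (hasd_derive1 fl) opprD addrA => H'.
apply: le_trans (H' _ _) _.
- by move=> w wr; apply: fM; lra.
- lra.
have Nh := N_ge0 h.
apply: (@le_trans _ _ (4 * M * (N h / (r / 2)) ^+ 2 * 2)).
  apply: ler_wpM2l; last by rewrite ler_pdivrMr; lra.
  exact: (mulr_ge0 (mulr_ge0 (ler0n _ 4) M0) (exprn_ge0 _ (divr_ge0 (N_ge0 _) (ltW r20)))).
by rewrite le_eqVlt; apply/orP; left; apply/eqP; field; rewrite gt_eqF.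
Qed.

Lemma cauchy_seqC (u : nat -> C) :
  (forall e : R, 0 < e -> exists n0, forall m n, (n0 <= m)%N -> (n0 <= n)%N -> N (u m - u n) < e) ->
  exists l, forall e : R, 0 < e -> exists n0, forall n, (n0 <= n)%N -> N (u n - l) < e.
Proof.
move=> H.
have aux (p : C -> R) : (forall z w, `|p z - p w| <= N (z - w)) -> cvgn (fun n => p (u n)).
  move=> pN; apply/cauchy_cvgP/cauchy_exP => e e0; have [n0 Hn] := H _ e0.
  exists (p (u n0)); exists n0 => // n /= n0n.
  by apply: le_lt_trans (pN _ _) _; exact: Hn.
have pRe z w : `|Re z - Re w| <= N (z - w) by rewrite -Re_N -Re_D; exact: N_Re.
have pIm z w : `|Im z - Im w| <= N (z - w) by rewrite -Im_N -Im_D; exact: N_Im.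
have /cvg_ex [/= a Ha] := aux _ pRe.
have /cvg_ex [/= b Hb] := aux _ pIm.
exists (a +i* b) => e e0.
have /cvgCP /(_ _ e0)[n0 _ Hn] : u n @[n --> \oo] --> (a +i* b) by exact: cvg_ReIm.
by exists n0.
Qed.

Lemma small_inv (e : R) : 0 < e -> exists n0, forall n, (n0 <= n)%N -> (n.+1%:R)^-1 < e.
Proof.
move=> e0; exists (Num.truncn e^-1) => n n0.
rewrite invf_plt ?posrE//; apply: (@lt_le_trans _ _ (Num.truncn e^-1).+1%:R).
  by apply: truncnS_gt.
by rewrite ler_nat.
Qed.

(** By [cauchy_derivative] the derivatives at [c] of the approximants form a Cauchy sequence,
    and [quad_remainder] bounds their second-order remainders uniformly; both pass to the
    limit. *)
Lemma weierstrass (f : C -> C) (c : C) (r : R) : 0 < r ->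
  (forall e : R, 0 < e -> exists2 g, hol g c r & forall w, N (w - c) < r -> N (g w - f w) <= e) ->
  exists l, hasd f c l.
Proof.
move=> r0 H.
have pos n : 0 < (n.+1%:R)^-1 :> R by rewrite invr_gt0.
have Hn n : exists g, hol g c r /\ forall w, N (w - c) < r -> N (g w - f w) <= (n.+1%:R)^-1.
  by have [g g1 g2] := H _ (pos n); exists g.
pose g n := projT1 (cid (Hn n)).
have gh n : hol (g n) c r by rewrite /g; case: cid => ? [].
have gf n w : N (w - c) < r -> N (g n w - f w) <= (n.+1%:R)^-1.
  exact: ((projT2 (cid (Hn n))).2 w).
have cc : N (c - c) < r by rewrite subrr N0.
pose a n := derive1 (g n) c.
have ga n : hasd (g n) c (a n) by exact: hol_derive1 (gh n) cc.
have aa m n : N (a m - a n) <= 4 * ((m.+1%:R)^-1 + (n.+1%:R)^-1) / r.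
  apply: (@cauchy_derivative (fun w => g m w - g n w) c r) => //; last exact: hasdB.
    by move=> w wr; exists (derive1 (g m) w - derive1 (g n) w); apply: hasdB; exact: hol_derive1 wr.
  move=> w wr; have -> : g m w - g n w = (g m w - f w) - (g n w - f w) by ring.
  by apply: le_trans (NB _ _) _; apply: lerD; exact: gf.
have [e e0|l Hl] := @cauchy_seqC a.
  have [|n0 Hn0] := @small_inv (e * r / 8); first by rewrite !(mulr_gt0, divr_gt0).
  exists n0 => m n /Hn0 m0 /Hn0 n0'; apply: le_lt_trans (aa m n) _.
  rewrite ltr_pdivrMr//; move: (m.+1%:R^-1 : R) (n.+1%:R^-1 : R) m0 n0' => x y m0 n0'.
  lra.
have gbd : exists2 M : R, 0 < M & forall n w, N (w - c) < r / 2 -> N (g n w) <= M.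
  have [|M M0 HM] := @bounded_disc _ (g 0%N) c (r / 2).
    move=> w wr; have [|b gb] := gh 0%N w; first by lra.
    exact: hasd_continuous gb.
  exists (M + 1 + 1) => [|n w wr]; first by rewrite !addr_gt0.
  have -> : g n w = g 0%N w + (g n w - f w) - (g 0%N w - f w) by ring.
  have wr' : N (w - c) < r by lra.
  apply: le_trans (NB _ _) _; apply: lerD; last first.
    by apply: le_trans (gf _ _ wr') _; rewrite invf_le1// ler1n.
  apply: le_trans (ND _ _) _; apply: lerD; first by apply: HM; exact: ltW.
  by apply: le_trans (gf _ _ wr') _; rewrite invf_le1// ler1n.
have [M M0 gM] := gbd.
have r20 : 0 < r / 2 by rewrite divr_gt0.
pose K := 32 * M / (r / 2) ^+ 2.
have K0 : 0 < K by rewrite divr_gt0 ?exprn_gt0// mulr_gt0.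
(* The uniform quadratic remainder, in the limit. *)
have Q h : N h <= r / 8 -> N (f (c + h) - f c - l * h) <= K * N h ^+ 2.
  move=> hr; apply/ler_addgt0Pr => e e0.
  have Nh := N_ge0 h.
  have e30 : 0 < e / (3 * (1 + N h)) by rewrite divr_gt0// mulr_gt0//; lra.
  have [n1 Hn1] := small_inv e30; have [n2 Hn2] := Hl _ e30.
  pose n := maxn n1 n2.
  have := Hn1 n (leq_maxl _ _); have := Hn2 n (leq_maxr _ _) => A B.
  have hr' : N (c + h - c) < r by rewrite addrC addKr; lra.
  have B1 := gf n _ hr'; have B2 := gf n _ cc.
  have := @quad_remainder (g n) c (r / 2) M (a n) r20 (hol_sub (gh n) _) (gM n) (ga n) h.
  rewrite subrr N0 add0r => /(_ ltac:(lra) ltac:(lra)); rewrite -/K => Q.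
  have -> : f (c + h) - f c - l * h = (g n (c + h) - g n c - a n * h) -
      (g n (c + h) - f (c + h)) + (g n c - f c) + (a n - l) * h by ring.
  apply: le_trans (ND _ _) _; rewrite NM.
  have A' : N (a n - l) * N h <= e / (3 * (1 + N h)) * N h by rewrite ler_wpM2r// ltW.
  have E : e / (3 * (1 + N h)) * (1 + N h) = e / 3 by field; rewrite gt_eqF//; lra.
  have T1 := ND (g n (c + h) - g n c - a n * h - (g n (c + h) - f (c + h))) (g n c - f c).
  have T2 := NB (g n (c + h) - g n c - a n * h) (g n (c + h) - f (c + h)).
  have T3 : 0 <= e / (3 * (1 + N h)) * N h by rewrite mulr_ge0// ltW.
  rewrite mulrDr mulr1 in E; move: e30 A B A' E T3.
  move: (e / (3 * (1 + N h))) => eta e30 A B A' E T3.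
  move: (n.+1%:R^-1 : R) B B1 B2 => x B B1 B2; lra.
exists l; apply/hasdP => e e0; exists (Num.min (r / 8) (e / K)).
  by rewrite lt_min (divr_gt0 r0)// (divr_gt0 e0 K0).
move=> h; rewrite lt_min => /andP[/ltW /Q hr]; rewrite ltr_pdivlMr// => hK.
by apply: le_trans hr _; rewrite expr2 mulrA ler_wpM2r ?N_ge0// mulrC ltW.
Qed.

Lemma weierstrass_ball (f : C -> C) (c : C) (r : R) :
  (forall e : R, 0 < e -> exists2 g, hol g c r & forall w, N (w - c) < r -> N (g w - f w) <= e) ->
  hol f c r.
Proof.
move=> H w wr; apply: (@weierstrass f w (r - N (w - c))); first by rewrite subr_gt0.
move=> e /H[g gh gf]; exists g.
  by apply: hol_sub gh _; rewrite addrC subrK.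
move=> z; rewrite ltrBrDr => zr; apply: gf; apply: le_lt_trans zr.
by apply: le_trans (ND _ _); rewrite addrA subrK.
Qed.

(** Difference quotients with a fixed small increment are holomorphic and converge uniformly to
    the derivative by [quad_remainder]. *)
Lemma hol_derive (f : C -> C) (c : C) (r : R) : hol f c r -> hol (derive1 f) c r.
Proof.
move=> fh w wr; have [s s0 sE] : exists2 s : R, 0 < s & 2 * s = r - N (w - c).
  by exists ((r - N (w - c)) / 2); [rewrite divr_gt0// subr_gt0|field].
have fw : hol f w (2 * s) by apply: hol_sub fh _; rewrite sE; lra.
have [|M M0 fM] := @bounded_disc _ f w (s + s / 2).
  by move=> z zs; have [|l fl] := fw z; [lra|exact: hasd_continuous fl].
apply: (@weierstrass _ w s) => // e e0.
pose K := 32 * M / (s / 2) ^+ 2; have K0 : 0 < K by rewrite divr_gt0 ?mulr_gt0 ?exprn_gt0 ?divr_gt0.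
pose h := Num.min (s / 8) (e / K).
have h0 : 0 < h by rewrite lt_min (divr_gt0 s0)// (divr_gt0 e0 K0).
have hs : h <= s / 8 by rewrite ge_min lexx.
have he : h * K <= e by rewrite -ler_pdivlMr// ge_min lexx orbT.
have hC : h%:C != 0 :> C by rewrite -N_gt0 N_real normr_gt0 gt_eqF.
have Nh : N h%:C = h by rewrite N_real gtr0_norm.
exists (fun z => h%:C^-1 * (f (z + h%:C) - f z)).
  move=> z zs; have [|l1 fl1] := fw z; first by lra.
  have [|l2 fl2] := fw (z + h%:C).
    by rewrite -addrA [h%:C - _]addrC addrA; apply: le_lt_trans (ND _ _) _; rewrite Nh; lra.
  eexists; apply: hasdZ; apply: hasdB fl1.
  exact: (hasd_comp (hasdD (hasd_id z) (hasd_cst h%:C z)) fl2).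
move=> z zs; have zd := hol_derive1 fw (w := z) ltac:(lra).
have := @quad_remainder f z (s / 2) M (derive1 f z) ltac:(lra) _ _ zd h%:C.
rewrite Nh -/K => Q.
have -> : h%:C^-1 * (f (z + h%:C) - f z) - derive1 f z =
    h%:C^-1 * (f (z + h%:C) - f z - derive1 f z * h%:C) by field.
rewrite NM NV Nh mulrC ler_pdivrMr//; apply: le_trans (Q _ _ _) _.
- by apply: hol_sub fw _; lra.
- move=> u us; apply: fM; have -> : u - w = (u - z) + (z - w) by ring.
  by apply: le_trans (ND _ _) _; lra.
- lra.
by rewrite expr2 mulrA ler_wpM2r ?(ltW h0)// mulrC.
Qed.

End OneVar.

(** * Taylor coefficients and isolated zeros *)

Section Expansion.
Variable R : realType.
Local Notation C := R[i].
Local Notation N := (@ComplexField.Normc.normc R).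

(** An asymptotic expansion to all orders at [c].  It is unique ([expansion_unique]) and can be
    differentiated ([expansion_derive]), which identifies its coefficients. *)
Definition expansion (f : C -> C) (c : C) (a : nat -> C) := forall n,
  exists K d : R, [/\ 0 < K, 0 < d & forall z : C, z != 0 -> N z <= d ->
    N (f (c + z) - \sum_(i < n) a i * z ^+ i) <= K * N z ^+ n].

Lemma small_real (d : R) : 0 < d -> exists2 z : C, z != 0 & N z = d.
Proof.
move=> d0; exists d%:C; first by rewrite -N_gt0 N_real normr_gt0 gt_eqF.
by rewrite N_real gtr0_norm.
Qed.

Lemma expansion_unique f c a b : expansion f c a -> expansion f c b -> forall n, a n = b n.
Proof.
move=> fa fb; elim/ltn_ind => n IH.
have [K [d [K0 d0 H]]] := fa n.+1; have [K' [d' [K'0 d'0 H']]] := fb n.+1.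
apply/eqP; rewrite -subr_eq0; apply/eqP; apply: (@N_eps0 _ _ (K + K')) => e e0.
pose s := Num.min e (Num.min d d').
have s0 : 0 < s by rewrite !lt_min e0 d0.
have se : s <= e by rewrite ge_min lexx.
have sd : s <= d by rewrite ge_min [X in _ || X]ge_min lexx orbT.
have sd' : s <= d' by rewrite ge_min [X in _ || X]ge_min lexx !orbT.
have [z z0 Nz] := small_real s0.
have := H z z0; rewrite Nz => /(_ sd) A; have := H' z z0; rewrite Nz => /(_ sd') B.
apply: (@le_trans _ _ ((K + K') * s)); last by rewrite ler_wpM2l// addr_ge0 ?ltW.
rewrite -(@ler_pM2r _ (s ^+ n)) ?exprn_gt0// -mulrA -exprS mulrDl.
apply: le_trans (lerD A B); rewrite !big_ord_recr /=.
have -> : \sum_(i < n) b i * z ^+ i = \sum_(i < n) a i * z ^+ i.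
  by apply: eq_bigr => i _; rewrite IH.
set S := \sum_(i < n) _; rewrite -{1}Nz -NX -NM [leRHS]addrC.
have -> : (a n - b n) * z ^+ n = (f (c + z) - (S + b n * z ^+ n)) -
  (f (c + z) - (S + a n * z ^+ n)) by ring.
exact: NB.
Qed.

Lemma hol_bounded (f : C -> C) (c : C) (r0 r : R) : r < r0 -> hol f c r0 ->
  exists2 M : R, 0 < M & forall w, N (w - c) <= r -> N (f w) <= M.
Proof.
move=> rr0 fh; apply: bounded_disc => w wr.
have [l fl] := fh w (le_lt_trans wr rr0); exact: hasd_continuous fl.
Qed.

Lemma hol_expansion (f : C -> C) (c : C) (r0 r : R) : 0 < r -> r < r0 -> hol f c r0 ->
  exists a : nat -> C, [/\ expansion f c a, a 0%N = f c,
   (forall M : R, (forall w, N (w - c) = r -> N (f w) <= M) -> forall n, N (a n) * r ^+ n <= 2 * M) &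
   (forall M : R, (forall w, N (w - c) <= r -> N (f w) <= M) -> forall z n, N z < r ->
     N (f (c + z) - \sum_(i < n) a i * z ^+ i) <= 4 * M * (N z / r) ^+ n * (r / (r - N z)))].
Proof.
move=> r_gt0 rr0 fh; have [a [a0 a1 H1 H2]] := taylor0 r_gt0 rr0 fh.
exists a; split => // n.
have [M M0 /H2 fM] := hol_bounded rr0 fh.
exists (4 * M / r ^+ n * 2), (r / 2); split.
- by rewrite !(mulr_gt0, divr_gt0, exprn_gt0)// invr_gt0 exprn_gt0.
- by rewrite divr_gt0.
move=> z _ zr; apply: le_trans (fM z n _) _; first by lra.
rewrite expr_div_n; have Nz := N_ge0 z.
have -> : 4 * M / r ^+ n * 2 * N z ^+ n = 4 * M * (N z ^+ n / r ^+ n) * 2 by ring.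
apply: ler_wpM2l; last by rewrite ler_pdivrMr; lra.
exact: (mulr_ge0 (mulr_ge0 (ler0n _ 4) (ltW M0)) (divr_ge0 (exprn_ge0 _ Nz) (exprn_ge0 _ (ltW r_gt0)))).
Qed.

Lemma hasd_poly (a : nat -> C) n (c w : C) :
  hasd (fun w => \sum_(i < n) a i * (w - c) ^+ i) w
    (\sum_(i < n.-1) i.+1%:R * a i.+1 * (w - c) ^+ i).
Proof.
have H := @hasd_sum _ n (fun i w => a i * (w - c) ^+ i) w
  (fun i => a i * (i%:R * (w - c) ^+ i.-1 * (1 - 0)))
  (fun i _ => hasdZ (a i) (hasdX i (hasdB (hasd_id w) (hasd_cst c w)))).
suff <- : \sum_(i < n) a i * (i%:R * (w - c) ^+ i.-1 * (1 - 0)) =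
    \sum_(i < n.-1) i.+1%:R * a i.+1 * (w - c) ^+ i by [].
case: n {H} => [|n]; first by rewrite !big_ord0.
rewrite big_ord_recl /= !mul0r mulr0 add0r; apply: eq_bigr => i _.
by rewrite /bump /= add1n /=; ring.
Qed.

(** Cauchy estimate for the remainder on the disc of radius |z| about c + z, which stays at
    distance comparable to |z| from [c]. *)
Lemma expansion_derive (f : C -> C) (c : C) (r : R) (a : nat -> C) : 0 < r -> hol f c r ->
  expansion f c a -> expansion (derive1 f) c (fun n => n.+1%:R * a n.+1).
Proof.
move=> r0 fh fa n; have [K [d [K0 d0 H]]] := fa n.+1.
pose D := Num.min (d / 4) (r / 4).
have D0 : 0 < D by rewrite lt_min !divr_gt0.
have Dd : D <= d / 4 by rewrite ge_min lexx.
have Dr : D <= r / 4 by rewrite ge_min lexx orbT.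
exists (4 * K * 2 ^+ n.+1), D; split => //.
  by rewrite !mulr_gt0// exprn_gt0.
move=> z z0 zD; pose P w := \sum_(i < n.+1) a i * (w - c) ^+ i.
have Pd w : hasd P w (\sum_(i < n) i.+1%:R * a i.+1 * (w - c) ^+ i).
  exact: hasd_poly.
have Nz : 0 < N z by rewrite N_gt0.
have czc : c + z - c = z by rewrite addrC addKr.
have czr : N (c + z - c) + N z <= r by rewrite czc; lra.
have fz : hol f (c + z) (N z) by exact: hol_sub fh czr.
have czz : N (c + z - (c + z)) < N z by rewrite subrr N0.
have := @cauchy_derivative _ (fun w => f w - P w) (c + z) (N z) (K * (2 * N z) ^+ n.+1) _ Nz _ _
  (hasdB (hol_derive1 fz czz) (Pd (c + z))).
rewrite czc => /(_ _ _)/le_trans; apply.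
- by move=> w /fz[l fl]; eexists; exact: hasdB fl (Pd w).
- move=> w wz; have wc : w - c != 0.
    by apply: contraTneq wz => wc; rewrite opprD addrA wc sub0r NN ltxx.
  have N2 : N (w - c) <= 2 * N z.
    have -> : w - c = (w - (c + z)) + z by ring.
    by apply: le_trans (ND _ _) _; lra.
  have := H _ wc; rewrite [c + _]addrC subrK => /(_ ltac:(lra))/le_trans; apply.
  by rewrite ler_pM2l//; apply: lerXn2r; rewrite ?nnegrE ?N_ge0 ?mulr_ge0 ?N_ge0.
by rewrite exprMn [N z ^+ n.+1]exprSr le_eqVlt; apply/orP; left; apply/eqP; field; rewrite gt_eqF.
Qed.

Definition tcoef (f : C -> C) (c : C) n : C := derive1n n f c / n`!%:R.

Lemma derive1nSr n (f : C -> C) : derive1n n.+1 f = derive1n n (derive1 f).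
Proof. exact: iterSr. Qed.

Lemma factC_neq0 n : n`!%:R != 0 :> C.
Proof. by rewrite pnatr_eq0 -lt0n fact_gt0. Qed.

Lemma expansion_tcoef (f : C -> C) (c : C) (r : R) a n : 0 < r -> hol f c r ->
  expansion f c a -> a n = tcoef f c n.
Proof.
move=> r0; elim: n f a => [|n IH] f a fh fa.
  have [|b [fb b0 _ _]] := @hol_expansion f c r (r / 2) ltac:(lra) _ fh; first by lra.
  by rewrite (expansion_unique fa fb) b0 /tcoef /= divr1.
have := IH _ _ (hol_derive fh) (expansion_derive r0 fh fa).
rewrite /tcoef -derive1nSr factS natrM => E.
have n1 : n.+1%:R != 0 :> C by rewrite pnatr_eq0.
rewrite invfM mulrCA -E mulrA mulVf// mul1r.
by [].
Qed.

(** The coefficients of [taylor_exists] are those of an asymptotic expansion, hence the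
    derivatives divided by factorials. *)
Lemma taylor (f : C -> C) (c : C) (r0 r : R) : 0 < r -> r < r0 -> hol f c r0 ->
  (forall M : R, (forall w, N (w - c) = r -> N (f w) <= M) ->
     forall n, N (tcoef f c n) * r ^+ n <= 2 * M) /\
  (forall M : R, (forall w, N (w - c) <= r -> N (f w) <= M) -> forall z n, N z < r ->
     N (f (c + z) - \sum_(i < n) tcoef f c i * z ^+ i) <= 4 * M * (N z / r) ^+ n * (r / (r - N z))).
Proof.
move=> r_gt0 rr0 fh; have [a [fa _ H1 H2]] := hol_expansion r_gt0 rr0 fh.
have E n := expansion_tcoef n (lt_trans r_gt0 rr0) fh fa.
split=> [M fM n|M fM z n zr]; first by rewrite -E; exact: H1.
have -> : \sum_(i < n) tcoef f c i * z ^+ i = \sum_(i < n) a i * z ^+ i.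
  by apply: eq_bigr => i _; rewrite E.
exact: H2.
Qed.

Lemma taylor_cvg (f : C -> C) (c : C) (r : R) : hol f c r -> forall z, N z < r ->
  forall e : R, 0 < e -> exists n0, forall n, (n0 <= n)%N ->
    N (f (c + z) - \sum_(i < n) tcoef f c i * z ^+ i) < e.
Proof.
move=> fh z zr e e0; have Nz := N_ge0 z.
have [s zs sr] : exists2 s, N z < s & s < r by exists ((N z + r) / 2); lra.
have s0 : 0 < s by exact: le_lt_trans zs.
have [_ H] := taylor s0 sr fh; have [M M0 /H fM] := hol_bounded sr fh.
have [||n0 Hn] := cvg0_geom (4 * M * (s / (s - N z))) _ _ e0 (x := N z / s).
- by rewrite divr_ge0// ltW.
- by rewrite ltr_pdivrMr// mul1r.
by exists n0 => n /Hn; apply: le_lt_trans; rewrite mulrAC; exact: fM.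
Qed.

Lemma taylor_zero (f : C -> C) (c : C) (r : R) : hol f c r ->
  (forall n, derive1n n f c = 0) -> forall w, N (w - c) < r -> f w = 0.
Proof.
move=> fh f0 w wr; apply/eqP; rewrite -N_eq0 eq_le N_ge0 andbT.
apply/ler_addgt0Pr => e e0; rewrite add0r.
have [n0 /(_ n0 (leqnn _))] := taylor_cvg fh wr e0.
rewrite big1 => [|i _]; last by rewrite /tcoef f0 !mul0r.
by rewrite subr0 addrC subrK => /ltW.
Qed.

(** The first nonvanishing Taylor term dominates the others near [c]. *)
Lemma isolated_zero (f : C -> C) (c : C) (r : R) n : 0 < r -> hol f c r ->
  derive1n n f c != 0 ->
  exists2 d : R, 0 < d & forall w, w != c -> N (w - c) < d -> f w != 0.
Proof.
move=> r0 fh fn; have r20 : 0 < r / 2 by rewrite divr_gt0.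
have [m fm mmin] := ex_minnP (ex_intro (fun n => derive1n n f c != 0) n fn).
have [|a [fa _ _ _]] := hol_expansion r20 _ fh; first by lra.
have [K [d [K0 d0 H]]] := fa m.+1.
have tm : tcoef f c m != 0 by rewrite mulf_neq0// invr_neq0// factC_neq0.
exists (Num.min d (N (tcoef f c m) / K)).
  by rewrite lt_min d0 divr_gt0// N_gt0.
move=> w wc; rewrite lt_min => /andP[wd]; rewrite ltr_pdivlMr// => wK.
have w0 : w - c != 0 by rewrite subr_eq0.
have := H _ w0 (ltW wd); rewrite [c + _]addrC subrK big_ord_recr /= big1.
  rewrite add0r (expansion_tcoef _ r0 fh fa) => B; apply: contraTneq wK => fw.
  rewrite -leNgt; rewrite fw sub0r NN NM NX in B.
  have W : 0 < N (w - c) ^+ m by rewrite exprn_gt0// N_gt0.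
  by rewrite -(ler_pM2r W) (le_trans B)// exprS mulrA [K * _]mulrC.
move=> i _; rewrite (expansion_tcoef _ r0 fh fa) /tcoef.
have [->|fi] := eqVneq (derive1n i f c) 0; first by rewrite !mul0r.
by have := mmin _ fi; rewrite leqNgt ltn_ord.
Qed.

(** Along the segment from [c] to [w] the function has derivative zero. *)
Lemma hasd0_cst (f : C -> C) (c : C) (r : R) :
  (forall w, N (w - c) < r -> hasd f w 0) -> forall w, N (w - c) < r -> f w = f c.
Proof.
move=> f0 w wr; pose z := w - c.
have Gd t : 0 <= t <= 1 -> rderiv (fun t => f (c + z * t%:C)) t 0.
  move=> /andP[t0 t1].
  have g := rderivD (rderiv_cst c t) (rderivZ z (rderiv_real t)).
  have := rderiv_comp g (f0 (c + z * t%:C) _); rewrite mul0r; apply.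
  rewrite addrC addKr NM N_real ger0_norm//.
  by apply: le_lt_trans wr; rewrite ler_piMr// N_ge0.
have := @antider_bound _ 0 1 0 1 (fun=> 0) _ 0 (lexx _) ler01 (lexx _) Gd.
rewrite !mulr0 mul0r addr0 mulr1 [c + z]addrC subrK => H.
apply/eqP; rewrite -subr_eq0 -N_eq0 eq_le N_ge0 andbT; apply: H => t _.
by rewrite N0.
Qed.

End Expansion.

(** * Entire functions of two variables *)

Section TwoVar.
Variable R : realType.
Local Notation C := R[i].
Local Notation N := (@ComplexField.Normc.normc R).

Definition cont2 (F : C -> C -> C) := forall (t z : C) (e : R), 0 < e ->
  exists2 d : R, 0 < d & forall t' z', N (t' - t) < d -> N (z' - z) < d ->
    N (F t' z' - F t z) < e.

(** Jointly continuous and separately entire: a form of analyticity in two variables that is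
    stable under locally uniform limits ([ent2_weierstrass]). *)
Definition ent2 (F : C -> C -> C) := [/\ cont2 F,
  (forall z c r, hol (F ^~ z) c r) & (forall t c r, hol (F t) c r)].

(** The partial derivatives are sealed, so that comparing two of them never unfolds the
    underlying limits. *)
Lemma partial_derivatives : {D : (C -> C -> C) -> C -> C -> C |
  forall F t z, D F t z = derive1 (F t) z}.
Proof. by exists (fun F t => derive1 (F t)). Qed.

Definition D2 := sval partial_derivatives.
Definition D1 (F : C -> C -> C) (t z : C) : C := D2 (fun z t => F t z) z t.

Lemma D2E F t z : D2 F t z = derive1 (F t) z.
Proof. exact: (svalP partial_derivatives). Qed.

Lemma D1E F t z : D1 F t z = derive1 (F ^~ z) t.
Proof. exact: D2E. Qed.

Definition entire (u : C -> C) := forall w, exists l, hasd u w l.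

Lemma entire_hol u : entire u -> forall c r, hol u c r.
Proof. by move=> ue c r w _; exact: ue. Qed.

Lemma hasd_D1 F t z : ent2 F -> hasd (F ^~ z) t (D1 F t z).
Proof.
by move=> [_ H _]; rewrite D1E; apply: (hol_derive1 (H z t 1)); rewrite subrr N0.
Qed.

Lemma hasd_D2 F t z : ent2 F -> hasd (F t) z (D2 F t z).
Proof.
by move=> [_ _ H]; rewrite D2E; apply: (hol_derive1 (H t z 1)); rewrite subrr N0.
Qed.

Lemma cont2_continuous F (p : C * C) : cont2 F ->
  {for p, continuous (fun q : C * C => F q.1 q.2)}.
Proof.
move=> Fc; apply/(@cvgCP _ _ _ (nbhs_filter p)) => e /(Fc p.1 p.2)[d d0 H].
exists ([set t | N (t - p.1) < d], [set z | N (z - p.2) < d]) => /=.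
  by split; apply/cnbhsP; exists d.
by move=> [t z] [/=]; exact: H.
Qed.

Lemma continuous_cont2 F : (forall p : C * C,
  {for p, continuous (fun q : C * C => F q.1 q.2)}) -> cont2 F.
Proof.
move=> H t z e e0.
have /(@cvgCP _ _ _ (nbhs_filter (t, z))) /(_ _ e0) := H (t, z).
move=> [[A B] [/= /cnbhsP[d d0 dA] /cnbhsP[d' d'0 dB]] AB].
exists (Num.min d d'); first by rewrite lt_min d0.
move=> t' z'; rewrite !lt_min => /andP[td _] /andP[_ zd].
by apply: (AB (t', z')); split; [exact: dA|exact: dB].
Qed.

Lemma bounded_bidisc F (t0 z0 : C) (r : R) : cont2 F ->
  exists2 M : R, 0 < M & forall t z, N (t - t0) <= r -> N (z - z0) <= r -> N (F t z) <= M.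
Proof.
move=> Fc.
have cF : {within ([set t | N (t - t0) <= r] `*` [set z | N (z - z0) <= r]),
    continuous (fun q : C * C => N (F q.1 q.2))}.
  apply: continuous_subspaceT => p.
  exact: (@continuous_comp _ _ _ (fun q : C * C => F q.1 q.2) N p
    (cont2_continuous Fc) (@N_continuous R _)).
have /compact_bounded[M [_ HM]] := continuous_compact cF
  (compact_setX (@disc_compact R t0 r) (@disc_compact R z0 r)).
exists (`|M| + 1) => [|t z tr zr]; first by rewrite ltr_wpDl.
have M1 : M < `|M| + 1 by apply: le_lt_trans (ler_norm _) _; rewrite ltrDl.
have := HM _ M1 (N (F t z)) (ex_intro2 _ _ (t, z) (conj tr zr) erefl).
by rewrite /= ger0_norm// N_ge0.
Qed.

Lemma ent2_weierstrass F : (forall t0 z0, exists2 r : R, 0 < r & forall e : R, 0 < e ->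
    exists2 G, ent2 G & forall t z, N (t - t0) < r -> N (z - z0) < r -> N (G t z - F t z) <= e) ->
  ent2 F.
Proof.
move=> H; split.
- move=> t z e e0; have [r r0 Hr] := H t z.
  have [|G [Gc _ _] GF] := Hr (e / 4); first by rewrite divr_gt0.
  have [|d d0 Gd] := Gc t z (e / 4); first by rewrite divr_gt0.
  exists (Num.min r d); first by rewrite lt_min r0.
  move=> t' z'; rewrite !lt_min => /andP[tr td] /andP[zr zd].
  have A := GF _ _ tr zr; have B := Gd _ _ td zd.
  have := GF t z; rewrite !subrr N0 => /(_ r0 r0) E.
  have -> : F t' z' - F t z = (G t' z' - G t z) - (G t' z' - F t' z') + (G t z - F t z) by ring.
  apply: le_lt_trans (ND _ _) _; have := NB (G t' z' - G t z) (G t' z' - F t' z').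
  lra.
- move=> z; apply: entire_hol => t; have [r r0 Hr] := H t z.
  apply: (weierstrass r0) => e /Hr[G [_ Gh _] GF]; exists (G ^~ z); first exact: Gh.
  by move=> w wr; apply: GF => //; rewrite subrr N0.
- move=> t; apply: entire_hol => z; have [r r0 Hr] := H t z.
  apply: (weierstrass r0) => e /Hr[G [_ _ Gh] GF]; exists (G t); first exact: Gh.
  by move=> w wr; apply: GF => //; rewrite subrr N0.
Qed.

Lemma ent2_swap F : ent2 F -> ent2 (fun z t => F t z).
Proof.
move=> [Fc F1 F2]; split => // z t e /(Fc t z)[d d0 H].
by exists d => // z' t' zd td; exact: H.
Qed.

Lemma ent2_shift F (a b : C) : ent2 F -> ent2 (fun t z => F (t + a) (z + b)).
Proof.
move=> FE; have [Fc F1 F2] := FE; split.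
- move=> t z e /(Fc (t + a) (z + b))[d d0 H]; exists d => // t' z' td zd.
  by apply: H; rewrite opprD addrACA subrr addr0.
- move=> z; apply: entire_hol => t; eexists.
  exact: (hasd_comp (hasdD (hasd_id t) (hasd_cst a t)) (hasd_D1 (t + a) (z + b) FE)).
- move=> t; apply: entire_hol => z; eexists.
  exact: (hasd_comp (hasdD (hasd_id z) (hasd_cst b z)) (hasd_D2 (t + a) (z + b) FE)).
Qed.

Lemma ent2_lin F G (a b : C) : ent2 F -> ent2 G -> ent2 (fun t z => a * F t z + b * G t z).
Proof.
move=> FE GE; have [Fc F1 F2] := FE; have [Gc G1 G2] := GE; split.
- apply: continuous_cont2 => p.
  have cc (c : C) : {for p, continuous (fun q : C * C => c)} by exact: cst_continuous.
  apply: (@cvgD _ _ _ _ (nbhs_filter p)); apply: (@cvgM _ _ _ (nbhs_filter p)); try exact: cc.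
    exact: cont2_continuous.
  exact: cont2_continuous.
- move=> z; apply: entire_hol => t; eexists.
  exact: (hasdD (hasdZ a (hasd_D1 t z FE)) (hasdZ b (hasd_D1 t z GE))).
- move=> t; apply: entire_hol => z; eexists.
  exact: (hasdD (hasdZ a (hasd_D2 t z FE)) (hasdZ b (hasd_D2 t z GE))).
Qed.

(** The quadratic remainder of [quad_remainder], uniformly on a bidisc. *)
Lemma diff_quotient_D2 F (t0 z0 : C) : ent2 F -> exists2 K : R, 0 < K & forall t z (h : C),
  N (t - t0) < 1 -> N (z - z0) < 1 -> h != 0 -> N h <= 1 / 4 ->
  N (h^-1 * (F t (z + h) - F t z) - D2 F t z) <= K * N h.
Proof.
move=> FE; have [Fc F1 F2] := FE; have [M M0 FM] := bounded_bidisc t0 z0 2 Fc.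
exists (32 * M) => [|t z h t1 z1 h0 hr]; first by rewrite mulr_gt0.
have := @quad_remainder _ (F t) z 1 M (D2 F t z) ltr01 (F2 t z 1) _ (hasd_D2 t z FE) h hr.
rewrite expr1n divr1 => Q.
have -> : h^-1 * (F t (z + h) - F t z) - D2 F t z =
    h^-1 * (F t (z + h) - F t z - D2 F t z * h) by field.
have Nh : 0 < N h by rewrite N_gt0.
rewrite NM NV mulrC ler_pdivrMr// -[_ * N h * N h]mulrA -expr2; apply: Q => w w1; apply: FM; first by lra.
have -> : w - z0 = (w - z) + (z - z0) by ring.
by apply: le_trans (ND _ _) _; lra.
Qed.

(** By [diff_quotient_D2] it is a locally uniform limit of difference quotients. *)
Lemma ent2_D2 F : ent2 F -> ent2 (D2 F).
Proof.
move=> FE; apply: ent2_weierstrass => t0 z0; exists 1 => // e e0.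
have [K K0 H] := diff_quotient_D2 t0 z0 FE.
pose s := Num.min (1 / 4) (e / K).
have s0 : 0 < s by rewrite lt_min (divr_gt0 e0 K0) andbT divr_gt0.
have s1 : s <= 1 / 4 by rewrite ge_min lexx.
have se : s * K <= e by rewrite -ler_pdivlMr// ge_min lexx orbT.
have [h h0 Nh] := small_real s0.
exists (fun t z => h^-1 * F (t + 0) (z + h) + (- h^-1) * F t z).
  by apply: ent2_lin => //; exact: ent2_shift.
move=> t z tr zr; rewrite addr0 mulNr -mulrBr.
by apply: le_trans (H _ _ _ tr zr h0 _) _; rewrite Nh// mulrC.
Qed.

Lemma ent2_D1 F : ent2 F -> ent2 (D1 F).
Proof. by move=> /ent2_swap/ent2_D2/ent2_swap. Qed.

(** Cauchy estimate in [t] for the error of the difference quotients in [z]. *)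
Lemma D1D2 F t z : ent2 F -> D1 (D2 F) t z = D2 (D1 F) t z.
Proof.
move=> FE; have [K K0 H] := diff_quotient_D2 t z FE; have [K' K'0 H'] := diff_quotient_D2 t z (ent2_D1 FE).
apply/eqP; rewrite -subr_eq0; apply/eqP; apply: (@N_eps0 _ _ (4 * K + K')) => e e0.
have [s [s0 s1 se]] : exists s : R, [/\ 0 < s, s <= 1 / 4 & s <= e].
  exists (Num.min (1 / 4) e); split; rewrite ?ge_min ?lexx ?orbT//.
  by rewrite lt_min e0 andbT divr_gt0.
have [h h0 Nh] := small_real s0.
have tt : N (t - t) < 1 by rewrite subrr N0.
have zz : N (z - z) < 1 by rewrite subrr N0.
have := H' t z h tt zz h0; rewrite Nh => /(_ s1) B.
have D := hasdB (hasdZ h^-1 (hasdB (hasd_D1 t (z + h) FE) (hasd_D1 t z FE)))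
  (hasd_D1 t z (ent2_D2 FE)).
have A := @cauchy_derivative _ _ t 1 (K * s) _ ltr01 _ _ D.
have {}A : N (h^-1 * (D1 F t (z + h) - D1 F t z) - D1 (D2 F) t z) <= 4 * (K * s).
  rewrite divr1 in A; apply: A.
    apply: entire_hol => w; eexists.
    exact: (hasdB (hasdZ h^-1 (hasdB (hasd_D1 w (z + h) FE) (hasd_D1 w z FE)))
      (hasd_D1 w z (ent2_D2 FE))).
  by move=> w wt; rewrite -Nh; apply: H => //; rewrite Nh.
set q := h^-1 * _ in A B.
have -> : D1 (D2 F) t z - D2 (D1 F) t z = (q - D2 (D1 F) t z) - (q - D1 (D2 F) t z) by ring.
have X := NB (q - D2 (D1 F) t z) (q - D1 (D2 F) t z).
apply: (le_trans X).
apply: (@le_trans _ _ ((4 * K + K') * s)).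
  rewrite mulrDl -mulrA [leRHS]addrC.
  exact: lerD.
apply: ler_wpM2l => //.
by apply: addr_ge0; [apply: mulr_ge0 => //|]; exact: ltW.
Qed.

(** First vary [z], with a quadratic error, then [t]; the continuity of [D2 F] compares its values
    at the two times. *)
Lemma frechet_estimate F t z : ent2 F -> forall e : R, 0 < e -> exists2 d : R, 0 < d &
  forall h k, N h < d -> N k < d ->
  N (F (t + h) (z + k) - F t z - (D1 F t z * h + D2 F t z * k)) <= e * (N h + N k).
Proof.
move=> FE e e0; have [K K0 H] := diff_quotient_D2 t z FE.
have [c2 _ _] := ent2_D2 FE; have e20 : 0 < e / 2 by rewrite divr_gt0.
have [d1 d10 Hd1] := c2 t z _ e20.
have /hasdP/(_ _ e20)[d2 d20 Hd2] := hasd_D1 t z FE.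
exists (Num.min (Num.min d1 d2) (Num.min (1 / 4) (e / 2 / K))).
  by rewrite !lt_min d10 d20 (divr_gt0 e20 K0) andbT divr_gt0.
move=> h k; rewrite !lt_min => /andP[/andP[hd1 hd2] /andP[h4 _]] /andP[_ /andP[k4]].
rewrite ltr_pdivlMr// => kK.
have Nh := N_ge0 h; have Nk := N_ge0 k.
have thh : N (t + h - t) < 1 by rewrite [t + h]addrC addrK; lra.
have th1 : N (t + h - t) < d1 by rewrite [t + h]addrC addrK.
have zz : N (z - z) < 1 by rewrite subrr N0.
have zz1 : N (z - z) < d1 by rewrite subrr N0.
have A : N (F (t + h) (z + k) - F (t + h) z - D2 F (t + h) z * k) <= K * N k * N k.
  have [->|k0] := eqVneq k 0; first by rewrite addr0 subrr mulr0 subrr N0 !mulr0.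
  have := H _ _ k thh zz k0 (ltW k4).
  rewrite -(@ler_pM2r _ (N k)) ?N_gt0// -NM; congr (N _ <= _).
  by field.
have B := Hd1 _ _ th1 zz1; have D := Hd2 _ hd2.
move: (F (t + h) (z + k)) (F (t + h) z) (F t z) (D2 F (t + h) z) (D2 F t z) (D1 F t z) A B D.
move=> f2 f1 f0 p' p q A B D.
have -> : f2 - f0 - (q * h + p * k) = (f2 - f1 - p' * k) + (p' - p) * k + (f1 - f0 - q * h).
  by ring.
apply: le_trans (ND _ _) _.
have X := ND (f2 - f1 - p' * k) ((p' - p) * k).
rewrite NM in X.
have B' : N (p' - p) * N k <= e / 2 * N k by rewrite ler_wpM2r// ltW.
have A' : K * N k * N k <= e / 2 * N k by rewrite ler_wpM2r// mulrC ltW.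
have N1 : 0 <= e * N h by rewrite mulr_ge0// ltW.
lra.
Qed.

Lemma hasd_curve F (f g : C -> C) t a b : ent2 F -> hasd f t a -> hasd g t b ->
  hasd (fun t => F (f t) (g t)) t (D1 F (f t) (g t) * a + D2 F (f t) (g t) * b).
Proof.
move=> FE fa gb; apply/hasdP => e e0.
pose u := D1 F (f t) (g t); pose v := D2 F (f t) (g t).
pose S := N u + N v + N a + N b + 3.
have n1 := N_ge0 u; have n2 := N_ge0 v.
have n3 := N_ge0 a; have n4 := N_ge0 b.
have S0 : 0 < S by rewrite /S; lra.
have [e1 [e10 e11 e1S]] : exists e1 : R, [/\ 0 < e1, e1 <= 1 & e1 * S <= e].
  exists (Num.min 1 (e / S)); split; first by rewrite lt_min ltr01 (divr_gt0 e0 S0).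
    by rewrite ge_min lexx.
  by rewrite -ler_pdivlMr// ge_min lexx orbT.
have [d1 d10 H1] := (hasdP _ _ _).1 fa _ e10.
have [d2 d20 H2] := (hasdP _ _ _).1 gb _ e10.
have [d d0 H] := frechet_estimate (f t) (g t) FE e10.
have [d3 d30 H3] := (ccontP _ _).1 (hasd_continuous fa) _ d0.
have [d4 d40 H4] := (ccontP _ _).1 (hasd_continuous gb) _ d0.
exists (Num.min (Num.min d1 d2) (Num.min d3 d4)); first by rewrite !lt_min d10 d20 d30 d40.
move=> h; rewrite !lt_min => /andP[/andP[/H1 B1 /H2 B2] /andP[h3 h4]].
have th : t + h - t = h by rewrite addrC addKr.
have K3 : N (f (t + h) - f t) < d by apply: H3; rewrite th.
have K4 : N (g (t + h) - g t) < d by apply: H4; rewrite th.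
have := H _ _ K3 K4; rewrite [f t + _]addrC subrK [g t + _]addrC subrK => B.
set p := f (t + h) - f t in B B1 *; set q := g (t + h) - g t in B B2 *.
have Nh := N_ge0 h.
have Np : N p <= (N a + 1) * N h.
  have -> : p = (p - a * h) + a * h by rewrite subrK.
  apply: le_trans (ND _ _) _; rewrite NM.
  have : e1 * N h <= N h by rewrite ler_piMl.
  lra.
have Nq : N q <= (N b + 1) * N h.
  have -> : q = (q - b * h) + b * h by rewrite subrK.
  apply: le_trans (ND _ _) _; rewrite NM.
  have : e1 * N h <= N h by rewrite ler_piMl.
  lra.
set f1 := F (f (t + h)) _ in B *; set f0 := F (f t) _ in B *.
rewrite -/u -/v in B *.
have -> : f1 - f0 - (u * a + v * b) * h = (f1 - f0 - (u * p + v * q)) +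
  (u * (p - a * h) + v * (q - b * h)) by ring.
apply: le_trans (ND _ _) _.
have X := ND (u * (p - a * h)) (v * (q - b * h)); rewrite !NM in X.
have Y1 : N u * N (p - a * h) <= N u * (e1 * N h) by rewrite ler_wpM2l.
have Y2 : N v * N (q - b * h) <= N v * (e1 * N h) by rewrite ler_wpM2l.
have Y3 : e1 * (N p + N q) <= e1 * ((N a + 1) * N h + (N b + 1) * N h).
  by rewrite ler_wpM2l ?(ltW e10)// lerD.
apply: (@le_trans _ _ (e1 * S * N h)); last by rewrite ler_wpM2r.
have -> : e1 * S * N h = e1 * ((N a + 1) * N h + (N b + 1) * N h) + N u * (e1 * N h) +
  N v * (e1 * N h) + e1 * N h by rewrite /S; ring.
have : 0 <= e1 * N h by rewrite mulr_ge0// ltW.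
lra.
Qed.

End TwoVar.

(** * Joint differentiability *)

Section Bridge.
Variable R : realType.
Local Notation C := R[i].
Local Notation N := (@ComplexField.Normc.normc R).

Lemma diff_idC (t : C) : differentiable (id : C -> C) t.
Proof. exact: (derivable1_diffP _ _).1 (hasd_derivable (hasd_id t)). Qed.

Lemma entire2_ent2 (F : C -> C -> C) : entire2 F -> ent2 F.
Proof.
move=> FE; split.
- apply: continuous_cont2 => p.
  exact: differentiable_continuous (FE p).
- move=> z; apply: entire_hol => t; exists (derive1 (F ^~ z) t); apply: derivable_hasd.
  apply/derivable1_diffP.
  apply: (@differentiable_comp _ _ _ _ (fun t => (t, z)) (fun q : C * C => F q.1 q.2) t).
    by apply: differentiable_pair; [exact: diff_idC|exact: differentiable_cst].
  exact: FE.
- move=> t; apply: entire_hol => z; exists (derive1 (F t) z); apply: derivable_hasd.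
  apply/derivable1_diffP.
  apply: (@differentiable_comp _ _ _ _ (fun z => (t, z)) (fun q : C * C => F q.1 q.2) z).
    by apply: differentiable_pair; [exact: differentiable_cst|exact: diff_idC].
  exact: FE.
Qed.

Section Differential.
Variables a b : C.

(** The differential at a point with partial derivatives [a] and [b]. *)
Definition lin2 (q : C * C) : C := a * q.1 + b * q.2.

Lemma lin2_linear : linear lin2.
Proof.
by move=> c p q; rewrite /lin2 /= /GRing.scale /=; ring.
Qed.

HB.instance Definition _ := @GRing.isLinear.Build C (C * C)%type C *:%R lin2 lin2_linear.

Lemma lin2_continuous : continuous lin2.
Proof.
move=> p; have cc (c : C) : {for p, continuous (fun q : C * C => c)} by exact: cst_continuous.
apply: (@cvgD _ _ _ _ (nbhs_filter p)); apply: (@cvgM _ _ _ (nbhs_filter p)); try exact: cc.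
  exact: cvg_fst.
exact: cvg_snd.
Qed.
End Differential.

Lemma norm_pair_ge (h k : C) : (Num.max (N h) (N k))%:C <= `|(h, k)|.
Proof.
rewrite prod_normE !normE.
have -> : Num.max (N (h, k).1)%:C (N (h, k).2)%:C = (Num.max (N h) (N k))%:C :> C.
  rewrite /Num.max ltcR [(h, k).1]/= [(h, k).2]/=.
  by case: (ltP (N h) (N k)).
exact: lexx.
Qed.

(** [frechet_estimate] is differentiability for the maximum norm on pairs. *)
Lemma ent2_entire2 (F : C -> C -> C) : ent2 F -> entire2 F.
Proof.
move=> FE p.
pose dF := lin2 (D1 F p.1 p.2) (D2 F p.1 p.2).
have est := frechet_estimate p.1 p.2 FE.
pose f := fun q : C * C => F q.1 q.2.
suff o : f \o shift p = cst (f p) + dF +o_ (0 : C * C) id.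
  have E := @diff_unique _ _ _ f dF p (@lin2_continuous _ _) o.
  by apply/diff_locallyP; rewrite E; split => //; exact: lin2_continuous.
have H : forall eps : C, 0 < eps -> \forall y \near (0 : C * C),
   `|((f \o shift p) - (cst (f p) + dF)) y| <= eps * `|y|.
  move=> e e0; have [r r0 ->] := lt0c_real e0.
  have [|d d0 H] := est (r / 2); first by rewrite divr_gt0.
  exists ([set t | N (t - 0) < d], [set z | N (z - 0) < d]) => /=.
    by split; apply/cnbhsP; exists d.
  move=> [h k] /= [hd kd]; rewrite subr0 in hd; rewrite subr0 in kd.
  have B := H _ _ hd kd.
  apply: (@le_trans _ _ (r%:C * (Num.max (N h) (N k))%:C)); last first.
    rewrite ler_pM2l ?ltcR//; exact: norm_pair_ge.
  rewrite -rmorphM normE lecR.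
  have -> : ((f \o shift p) - (cst (f p) + dF)) (h, k) =
     F (p.1 + h) (p.2 + k) - F p.1 p.2 - (D1 F p.1 p.2 * h + D2 F p.1 p.2 * k).
    by rewrite -addrA -opprD [p.1 + h]addrC [p.2 + k]addrC.
  apply: le_trans B _; set u := N h; set v := N k.
  have : u <= Num.max u v by rewrite le_max lexx.
  have : v <= Num.max u v by rewrite le_max lexx orbT.
  move: (Num.max u v) => m vm um; rewrite mulrAC -mulrA ler_pM2l//; lra.
exact/eqaddoP.
Qed.

End Bridge.

(** * The heat equation and evenness *)

Section Heat.
Variable R : realType.
Local Notation C := R[i].
Local Notation N := (@ComplexField.Normc.normc R).

Definition heat (F : C -> C -> C) := forall t z, D1 F t z = D2 (D2 F) t z.

Lemma heat_equationP (F : C -> C -> C) : heat_equation F -> heat F.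
Proof.
move=> H t z; rewrite D1E D2E H /=; congr (derive1 _ z).
by apply/funext => w; rewrite D2E.
Qed.

Lemma heat_D1 F : ent2 F -> heat F -> heat (D1 F).
Proof.
move=> FE FH t z.
have E1 : D1 F = D2 (D2 F) by apply/funext => u; apply/funext => v; exact: FH.
have E2 : D1 (D2 F) = D2 (D1 F).
  by apply/funext => u; apply/funext => v; exact: D1D2.
by rewrite {1}E1 D1D2 ?E2//; exact: ent2_D2.
Qed.

(** The time derivative of a solution is again a solution, so the heat equation can be iterated. *)
Lemma heat_derive1n m F t z : ent2 F -> heat F ->
  derive1n m (F ^~ z) t = derive1n m.*2 (F t) z.
Proof.
elim: m F => [//|m IH] F FE FH.
have -> : derive1n m.+1 (F ^~ z) = derive1n m (D1 F ^~ z).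
  rewrite derive1nSr; congr (derive1n m _).
  by apply/funext => w; rewrite D1E.
rewrite (IH _ (ent2_D1 FE) (heat_D1 FE FH)) doubleS !derive1nSr.
congr (derive1n _ _ z); apply/funext => w; rewrite FH D2E; congr (derive1 _ w).
by apply/funext => u; rewrite D2E.
Qed.

Lemma taylor_cvg_uniform (f : C -> C) (c : C) (r s : R) : hol f c r -> 0 <= s -> s < r ->
  forall e : R, 0 < e -> exists n0, forall n, (n0 <= n)%N -> forall z, N z <= s ->
    N (f (c + z) - \sum_(i < n) tcoef f c i * z ^+ i) < e.
Proof.
move=> fh s0 sr e e0.
have [u us ur] : exists2 u, s < u & u < r by exists ((s + r) / 2); lra.
have u0 : 0 < u by exact: le_lt_trans us.
have [_ H] := taylor u0 ur fh; have [M M0 /H fM] := hol_bounded ur fh.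
have [||n0 Hn] := cvg0_geom (4 * M * (u / (u - s))) _ _ e0 (x := s / u).
- by rewrite divr_ge0// ltW.
- by rewrite ltr_pdivrMr// mul1r.
exists n0 => n /Hn; set T := 4 * M * _ * _ => HT z zs.
have zu : N z < u by lra.
apply: le_lt_trans (fM z n zu) _; apply: le_lt_trans HT.
rewrite /T mulrAC; apply: ler_pM.
- by apply: mulr_ge0; [lra|apply: divr_ge0; lra].
- by apply/exprn_ge0/divr_ge0; [exact: N_ge0|lra].
- apply: ler_wpM2l; first lra.
  by rewrite ler_pM2l// lef_pV2 ?posrE; lra.
apply: lerXn2r; rewrite ?nnegrE ?divr_ge0 ?N_ge0 ?(ltW u0)//.
by rewrite ler_pM2r ?invr_gt0.
Qed.

Lemma taylor_eq (f g : C -> C) (c c' : C) (r : R) : hol f c r -> hol g c' r ->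
  (forall n, derive1n n f c = derive1n n g c') -> forall z, N z < r -> f (c + z) = g (c' + z).
Proof.
move=> fh gh fg z zr; apply/eqP; rewrite -subr_eq0; apply/eqP.
apply: (@N_eps0 _ _ 2) => e e0.
have [n1 H1] := taylor_cvg fh zr e0; have [n2 H2] := taylor_cvg gh zr e0.
have := H1 (maxn n1 n2) (leq_maxl _ _); have := H2 (maxn n1 n2) (leq_maxr _ _).
have -> : \sum_(i < maxn n1 n2) tcoef f c i * z ^+ i =
    \sum_(i < maxn n1 n2) tcoef g c' i * z ^+ i.
  by apply: eq_bigr => i _; rewrite /tcoef fg.
move: (\sum_(i < _) _) => S A B.
have -> : f (c + z) - g (c' + z) = (f (c + z) - S) - (g (c' + z) - S) by ring.
by apply: le_trans (NB _ _) _; lra.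
Qed.

Lemma derive1n_cst0 n (w : C) : derive1n n (fun=> 0 : C) w = 0.
Proof.
elim: n w => [//|n IH] w; rewrite derive1nSr.
have -> : derive1 (fun=> 0 : C) = (fun=> 0) :> (C -> C); last exact: IH.
by apply/funext => u; exact: hasd_derive1 (hasd_cst 0 u).
Qed.

(** The Taylor coefficients of [F ^~ z] at [t0] are multiples of z-derivatives of [F t0]. *)
Lemma heat_zero F t0 : ent2 F -> heat F -> (forall z, F t0 z = 0) -> forall t z, F t z = 0.
Proof.
move=> FE FH F0 t z; have [_ Fh _] := FE.
apply: (@taylor_zero _ (F ^~ z) t0 (N (t - t0) + 1)); [exact: Fh| |lra].
move=> n; rewrite heat_derive1n//.
have -> : F t0 = (fun=> 0) by apply/funext.
exact: derive1n_cst0.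
Qed.

Lemma derive1n_opp (f : C -> C) n (w : C) : (forall c r, hol f c r) ->
  derive1n n (fun z => f (- z)) w = (-1) ^+ n * derive1n n f (- w).
Proof.
elim: n f w => [|n IH] f w fh; first by rewrite expr0 mul1r.
rewrite !derive1nSr.
have -> : derive1 (fun z => f (- z)) = (fun z => (fun u => - derive1 f u) (- z)).
  apply/funext => z; apply: hasd_derive1.
  have fz : hasd f (- z) (derive1 f (- z)) by apply: (hol_derive1 (fh (- z) 1)); rewrite subrr N0.
  by have := hasd_comp (hasdN (hasd_id z)) fz; rewrite mulrN1.
have fh' c r : hol (fun u => - derive1 f u) c r.
  move=> u ur; have [l gl] := hol_derive (fh c r) ur.
  by exists (- l); exact: hasdN.
apply: (etrans (IH (fun u => - derive1 f u) w fh')).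
rewrite exprS mulN1r mulNr -mulrN; congr (_ * _).
have aux m (g : C -> C) (u : C) : (forall c r, hol g c r) ->
    derive1n m (fun u => - g u) u = - derive1n m g u.
  elim: m g u => [//|m IHm] g u gh; rewrite !derive1nSr.
  have -> : derive1 (fun u => - g u) = (fun u => - derive1 g u).
    apply/funext => v; apply: hasd_derive1; apply: hasdN.
    by apply: (hol_derive1 (gh v 1)); rewrite subrr N0.
  by apply: IHm => c r; exact: hol_derive.
by apply: aux => c r; exact: hol_derive.
Qed.

(** The z-derivatives of even order of an even function are even, so both sides have the same
    Taylor series in [t] at 0. *)
Lemma heat_even F : ent2 F -> heat F -> (forall z, F 0 (- z) = F 0 z) ->
  forall t z, F t (- z) = F t z.
Proof.
move=> FE FH F0 t z; have [_ F1 F2] := FE.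
have := @taylor_eq (F ^~ (- z)) (F ^~ z) 0 0 (N t + 1) (F1 _ _ _) (F1 _ _ _) _ t.
rewrite add0r; apply; last by lra.
move=> n; rewrite !heat_derive1n//.
have {2}-> : F 0 = (fun z => F 0 (- z)) by apply/funext => w; rewrite F0.
by rewrite derive1n_opp// -signr_odd odd_double expr0 mul1r.
Qed.

(** For even [g] the choice of the square root does not matter ([even_rootE]): this is the
    function of z ^ 2 which gives [g z]. *)
Definition even_root (g : C -> C) (m : C) : C := g (sqrtc m).

Lemma sqrtc_cases (z : C) : sqrtc (z ^+ 2) = z \/ sqrtc (z ^+ 2) = - z.
Proof.
have := sqr_sqrtc (z ^+ 2) => /eqP; rewrite eqf_sqr => /orP[]/eqP; by [left|right].
Qed.

Lemma even_rootE g (z : C) : (forall z, g (- z) = g z) -> even_root g (z ^+ 2) = g z.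
Proof. by move=> ge; rewrite /even_root; case: (sqrtc_cases z) => ->. Qed.

Lemma sum_double (a : nat -> C) n : (forall i, odd i -> a i = 0) ->
  \sum_(i < n.*2) a i = \sum_(i < n) a i.*2.
Proof.
move=> a0; elim: n => [|n IH]; first by rewrite !big_ord0.
by rewrite doubleS !big_ord_recr /= IH (a0 n.*2.+1) ?addr0//= odd_double.
Qed.

(** Near every point, the Taylor polynomials of [g] at 0, which contain only even powers,
    converge uniformly; in [m] they are polynomials of half the degree. *)
Lemma even_root_hol g : (forall c r, hol g c r) -> (forall z, g (- z) = g z) ->
  forall c r, hol (even_root g) c r.
Proof.
move=> gh ge.
have odd0 i : odd i -> tcoef g 0 i = 0.
  move=> io; rewrite /tcoef; suff -> : derive1n i g 0 = 0 by rewrite mul0r.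
  have := @derive1n_opp g i 0 gh; rewrite -signr_odd io expr1 mulN1r oppr0.
  have -> : (fun z => g (- z)) = g by apply/funext.
  move=> /eqP; rewrite -addr_eq0 -mulr2n -mulr_natl mulf_eq0 pnatr_eq0 /=.
  by move/eqP.
move=> c r; apply: (@hol_sub _ _ 0 (N c + `|r|)); last by rewrite subr0 lerD2l ler_norm.
set rho := N c + `|r|; have rho0 : 0 <= rho by rewrite addr_ge0 ?N_ge0.
apply: weierstrass_ball => e e0.
have s1 : rho <= rho + 1 by lra.
have [||n0 Hn] := @taylor_cvg_uniform g 0 (rho + 2) (rho + 1) (gh _ _) _ _ e e0; [lra|lra|].
exists (fun m => \sum_(i < n0) tcoef g 0 i.*2 * (m - 0) ^+ i).
  by apply: entire_hol => w; eexists; exact: (hasd_poly (fun i => tcoef g 0 i.*2)).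
move=> w; rewrite subr0 => wr; set s := sqrtc w.
have sw : s ^+ 2 = w by exact: sqr_sqrtc.
have Ns : N s <= rho + 1.
  have Ns0 := N_ge0 s; rewrite leNgt; apply/negP => H.
  have : N w = N s ^+ 2 by rewrite -sw NX.
  have : (rho + 1) * (rho + 1) <= N s * N s by apply: ler_pM; lra.
  have : 0 <= rho * rho by rewrite mulr_ge0.
  rewrite expr2; lra.
have := Hn n0.*2 _ s Ns; rewrite add0r => /(_ _)/ltW H.
rewrite NBC; apply: le_trans (H _); last by rewrite -addnn leq_addr.
rewrite (@sum_double (fun i => tcoef g 0 i * s ^+ i)) => [|i io]; last by rewrite odd0 ?mul0r.
rewrite /even_root -/s le_eqVlt; apply/orP; left; apply/eqP; congr (N (_ - _)).
by apply: eq_bigr => i _; rewrite -sw -exprM mul2n.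
Qed.

Definition Phi_of (F : C -> C -> C) (t : C) : C -> C := even_root (F t).

Section Phi.
Variable F : C -> C -> C.
Hypothesis FE : ent2 F.
Hypothesis Feven : forall t z, F t (- z) = F t z.
Local Notation Phi := (Phi_of F).

Lemma PhiE t z : Phi t (z ^+ 2) = F t z.
Proof. exact: even_rootE. Qed.

(** Joint continuity: if z ^ 2 is close to z0 ^ 2, then [z] is close to [z0] or to [- z0]. *)
Lemma ent2_Phi : ent2 Phi.
Proof.
have [Fc F1 F2] := FE; split.
- move=> t m e e0; set s0 := sqrtc m.
  have s02 : s0 ^+ 2 = m by exact: sqr_sqrtc.
  have [d1 d10 H1] := Fc t s0 e e0; have [d2 d20 H2] := Fc t (- s0) e e0.
  have [d [d0 dd1 dd2]] : exists d : R, [/\ 0 < d, d <= d1 & d <= d2].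
    by exists (Num.min d1 d2); rewrite lt_min d10 !ge_min !lexx orbT.
  exists (Num.min d (d ^+ 2)); first by rewrite lt_min d0 exprn_gt0.
  move=> t' m'; rewrite !lt_min => /andP[td _] /andP[_ md].
  set s := sqrtc m'; have s2 : s ^+ 2 = m' by exact: sqr_sqrtc.
  rewrite /Phi_of /even_root -/s -/s0.
  have [ss|ss] := ltP (N (s - s0)) d.
    by apply: H1; [exact: lt_le_trans td dd1|exact: lt_le_trans ss dd1].
  rewrite -[F t s0]Feven; apply: H2; first exact: lt_le_trans td dd2.
  apply: lt_le_trans dd2; rewrite opprK ltNge; apply/negP => ss'.
  move: md; rewrite -s2 -s02 subr_sqr NM ltNge expr2 => /negP; apply.
  by apply: ler_pM => //; exact: ltW.
- by move=> m c r; exact: F1.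
- by move=> t c r; apply: even_root_hol.
Qed.

Hypothesis FH : heat F.

(** Chain rule for F t z = Phi t (z ^ 2), twice in [z]. *)
Lemma Phi_pde t m : D1 Phi t m = 2 * D2 Phi t m + 4 * m * D2 (D2 Phi) t m.
Proof.
have PE := ent2_Phi; set z := sqrtc m; have zm : z ^+ 2 = m by exact: sqr_sqrtc.
have sq (w : C) : hasd (fun w => w ^+ 2) w (2 * w).
  by have := hasdX 2 (hasd_id w); rewrite /= expr1 mulr1.
have E2 w : D2 F t w = D2 Phi t (w ^+ 2) * (2 * w).
  rewrite D2E; apply: hasd_derive1.
  have := hasd_comp (sq w) (hasd_D2 t (w ^+ 2) PE).
  by under [X in hasd X]eq_fun do rewrite PhiE.
have E22 : D2 (D2 F) t z = D2 (D2 Phi) t (z ^+ 2) * (2 * z) * (2 * z) + D2 Phi t (z ^+ 2) * 2.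
  rewrite D2E; apply: hasd_derive1.
  have := hasdM (hasd_comp (sq z) (hasd_D2 t (z ^+ 2) (ent2_D2 PE))) (hasdZ 2 (hasd_id z)).
  rewrite mulr1; under [X in hasd X]eq_fun do rewrite -E2.
  by [].
have E1 : D1 F t z = D1 Phi t (z ^+ 2).
  rewrite !D1E; congr (derive1 _ t); apply/funext => u.
  by rewrite PhiE.
have := FH t z; rewrite E1 E22 zm => ->.
by rewrite -zm; ring.
Qed.

End Phi.
End Heat.

(** * Isolated zeros on a domain and multiple zeros along a branch *)

Section Branch.
Variable R : realType.
Local Notation C := R[i].
Local Notation N := (@ComplexField.Normc.normc R).

Lemma open_ball (D : set C) (t : C) : open D -> D t ->
  exists2 r : R, 0 < r & forall w, N (w - t) < r -> D w.
Proof. by move=> oD Dt; apply/cnbhsP; move: oD; rewrite openE => /(_ _ Dt). Qed.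

Lemma open_of_balls (D : set C) : (forall t, D t -> exists2 r : R, 0 < r & forall w, N (w - t) < r -> D w) ->
  open D.
Proof. by move=> H; rewrite openE => t /H Ht; apply/cnbhsP. Qed.

(** The points near which [g] vanishes and those with a zero-free punctured neighbourhood form
    two disjoint open sets, which cover [D] by [taylor_zero] and [isolated_zero]. *)
Lemma identity_domain (D : set C) (g : C -> C) : open D -> connected D ->
  (forall t, D t -> exists l, hasd g t l) ->
  (forall t, D t -> g t = 0) \/
  (forall t, D t -> exists2 d : R, 0 < d & forall w, w != t -> N (w - t) < d -> g w != 0).
Proof.
move=> oD cD gh.
pose Z := [set t | D t /\ exists2 d : R, 0 < d & forall w, N (w - t) < d -> g w = 0].
pose W := [set t | D t /\ exists2 d : R, 0 < d & forall w, w != t -> N (w - t) < d -> g w != 0].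
have dich t : D t -> Z t \/ W t.
  move=> Dt; have [r r0 rD] := open_ball oD Dt.
  have gr : hol g t r by move=> w /rD/gh.
  have [g0|] := pselect (forall n, derive1n n g t = 0).
    by left; split => //; exists r => // w wr; exact: taylor_zero gr g0 _ wr.
  move=> /existsNP[n /eqP gn]; right; split => //.
  exact: isolated_zero r0 gr gn.
have disj t : Z t -> W t -> False.
  move=> [_ [d d0 gd]] [_ [d' d'0 gd']].
  have m0 : 0 < Num.min d d' by rewrite lt_min d0.
  have m20 : 0 < Num.min d d' / 2 by rewrite divr_gt0.
  have [h h0 Nh] := small_real m20.
  have hm : N h < Num.min d d' by rewrite Nh; lra.
  move: hm; rewrite lt_min => /andP[hd hd'].
  have th : t + h - t = h by rewrite addrC addKr.
  have := gd' (t + h); rewrite th => /(_ _ hd'); rewrite gd ?th// eqxx.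
  by move=> /(_ _)/negP; apply => //; rewrite -subr_eq0 th.
have oZ : open Z.
  apply: open_of_balls => t [Dt [d d0 gd]]; have [r r0 rD] := open_ball oD Dt.
  exists (Num.min r (d / 2)); first by rewrite lt_min r0 divr_gt0.
  move=> w; rewrite lt_min => /andP[/rD Dw wd]; split => //.
  exists (d / 2); first by rewrite divr_gt0.
  move=> u uw; apply: gd; have -> : u - t = (u - w) + (w - t) by ring.
  by apply: le_lt_trans (ND _ _) _; lra.
have oW : open W.
  apply: open_of_balls => t /[dup] Wt [Dt [d d0 gd]]; have [r r0 rD] := open_ball oD Dt.
  exists (Num.min r d); first by rewrite lt_min r0.
  move=> w; rewrite lt_min => /andP[/rD Dw wd].
  have [->//|wt] := eqVneq w t; split => //.
  have gw := gd _ wt wd; have [l gl] := gh _ Dw.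
  have [|e e0 He] := (ccontP _ _).1 (hasd_continuous gl) (N (g w)).
    by rewrite N_gt0.
  exists e => // u _ /He; apply: contraTneq => ->.
  by rewrite sub0r NN ltxx.
have [[t Zt]|Z0] := pselect (exists t, Z t); last first.
  right => t Dt; have [Zt|[]//] := dich _ Dt.
  by case: Z0; exists t.
left; suff ZD : Z = D by move=> u; rewrite -ZD => -[_ [d d0]]; apply; rewrite subrr N0.
apply: cD; first by exists t.
  by exists Z => //; rewrite setIidr// => u [].
exists (~` W); first exact: open_closedC.
apply/seteqP; split => [u Zu|u [Du nWu]].
  by split; [by case: Zu|move=> Wu; exact: disj Zu Wu].
by have [] := dich _ Du.
Qed.

Section Multiple.
Variable P : C -> C -> C.
Hypothesis PE : ent2 P.
Hypothesis Ppde : forall t m, D1 P t m = 2 * D2 P t m + 4 * m * D2 (D2 P) t m.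

Let Q n := iter n (@D2 R) P.

Let QE n : ent2 (Q n).
Proof. by elim: n => [//|n IH]; exact: ent2_D2. Qed.

Let Q_derive1n n t m : Q n t m = derive1n n (P t) m.
Proof.
elim: n t m => [//|n IH] t m; rewrite /= D2E; congr (derive1 _ m).
by apply/funext => w; exact: IH.
Qed.

(** Differentiating the equation of [P] raises the coefficient of the first-order term by 4. *)
Let Qpde n t m : D1 (Q n) t m = (4 *+ n + 2) * Q n.+1 t m + 4 * m * Q n.+2 t m.
Proof.
elim: n t m => [|n IH] t m; first by rewrite mulr0n add0r Ppde.
rewrite [Q n.+1]/= D1D2; last exact: QE.
rewrite D2E; apply: hasd_derive1.
have -> : D1 (Q n) t = (fun m => (4 *+ n + 2) * Q n.+1 t m + 4 * m * Q n.+2 t m).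
  by apply/funext => w.
have := hasdD (hasdZ (4 *+ n + 2) (hasd_D2 t m (QE n.+1)))
  (hasdM (hasdZ 4 (hasd_id m)) (hasd_D2 t m (QE n.+2))).
rewrite -[D2 (Q n.+1)]/(Q n.+2) -[D2 (Q n.+2)]/(Q n.+3).
suff -> : (4 *+ n + 2) * Q n.+2 t m + (4 * 1 * Q n.+2 t m + 4 * id m * Q n.+3 t m) =
  (4 *+ n.+1 + 2) * Q n.+2 t m + 4 * m * Q n.+3 t m by [].
by rewrite mulrS /=; ring.
Qed.

Variables (mu : C -> C) (t1 : C) (r : R).
Hypothesis r0 : 0 < r.
Hypothesis muh : hol mu t1 r.
Hypothesis Q0 : forall t, N (t - t1) < r -> P t (mu t) = 0.

(** The derivative of t |-> Q n t (mu t), if this function is zero near [t]. *)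
Let Qcurve n t (s : R) (t2 : C) : N (t - t2) < s -> N (t - t1) < r ->
  (forall u, N (u - t2) < s -> Q n u (mu u) = 0) ->
  D1 (Q n) t (mu t) + Q n.+1 t (mu t) * derive1 mu t = 0.
Proof.
move=> ts tr Qn; have H := hasd_curve (QE n) (hasd_id t) (hol_derive1 muh tr).
rewrite mulr1 in H; apply: hasd_unique H _; apply: hasd_ext (hasd_cst 0 t).
exists (s - N (t - t2)); first by rewrite subr_gt0.
move=> u; rewrite ltrBrDr => us; rewrite Qn//.
by apply: le_lt_trans us; apply: le_trans (ND _ _); rewrite addrA subrK.
Qed.

(** Inductively, all z-derivatives of [P] vanish along the branch, so the Taylor series of some
    [P t] at [mu t] is zero.  Where [mu] is not zero, two consecutive ones being zero gives the
    next one by [Qpde], whose term in [Q n.+2] has the coefficient 4 mu.  If [mu] vanishes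
    identically, that term disappears and [Qpde] gives [Q n.+1] from [Q n]. *)
Lemma multiple_branch : (forall t, N (t - t1) < r -> D2 P t (mu t) = 0) ->
  exists t2, forall m, P t2 m = 0.
Proof.
move=> Q1; have [_ _ Ph] := PE.
have fin t : (forall n, Q n t (mu t) = 0) -> exists t2, forall m, P t2 m = 0.
  move=> H; exists t => m; apply: (@taylor_zero _ (P t) (mu t) (N (m - mu t) + 1)).
  - exact: Ph.
  - by move=> n; rewrite -Q_derive1n.
  - by rewrite ltrDl.
have [[t2 t2r m2]|mu0] := pselect (exists2 t2, N (t2 - t1) < r & mu t2 != 0).
  have [l ml] := muh t2r.
  have [|s s0 Hs] := (ccontP _ _).1 (hasd_continuous ml) (N (mu t2)).
    by rewrite N_gt0.
  pose s' := Num.min s (r - N (t2 - t1)).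
  have s'0 : 0 < s' by rewrite lt_min s0 subr_gt0.
  have in1 t : N (t - t2) < s' -> N (t - t1) < r.
    rewrite lt_min => /andP[_]; rewrite ltrBrDr; apply: le_lt_trans.
    by apply: le_trans (ND _ _); rewrite addrA subrK.
  have mun t : N (t - t2) < s' -> mu t != 0.
    rewrite lt_min => /andP[/Hs + _]; apply: contraTneq => ->.
    by rewrite sub0r NN ltxx.
  have claim n : (forall t, N (t - t2) < s' -> Q n t (mu t) = 0) /\
      (forall t, N (t - t2) < s' -> Q n.+1 t (mu t) = 0).
    elim: n => [|n [IH1 IH2]]; first by split => t /in1; [exact: Q0|exact: Q1].
    split => // t ts; have := Qcurve ts (in1 _ ts) IH1.
    rewrite Qpde IH2// mulr0 mul0r add0r addr0 => /eqP.
    by rewrite !mulf_eq0 pnatr_eq0 (negbTE (mun _ ts)) /= => /eqP.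
  by apply: (fin t2) => n; apply: (claim n).1; rewrite subrr N0.
have {}mu0 t : N (t - t1) < r -> mu t = 0.
  by move=> tr; apply/eqP; apply/negP => /negP m0; case: mu0; exists t.
have claim n : forall t, N (t - t1) < r -> Q n t (mu t) = 0.
  elim: n => [|n IH] t tr; first exact: Q0.
  have := Qcurve tr tr IH; rewrite Qpde.
  have -> : derive1 mu t = 0.
    apply: hasd_derive1; apply: hasd_ext (hasd_cst 0 t).
    exists (r - N (t - t1)); first by rewrite subr_gt0.
    move=> u; rewrite ltrBrDr => us; rewrite mu0//.
    by apply: le_lt_trans us; apply: le_trans (ND _ _); rewrite addrA subrK.
  rewrite mulr0 addr0 (mu0 _ tr) mulr0 mul0r addr0 => /eqP.
  rewrite mulf_eq0 -[4]/(4%:R) -mulrnA -natrD pnatr_eq0 addn_eq0 andbF /=.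
  by move/eqP.
by apply: (fin t1) => n; apply: claim; rewrite subrr N0.
Qed.

End Multiple.
End Branch.

(** * Growth of solutions *)

Section Growth.
Variable R : realType.
Local Notation C := R[i].
Local Notation N := (@ComplexField.Normc.normc R).

Lemma fact_double m : ((m.*2)`! <= m`! * (m.*2) ^ m)%N.
Proof.
suff H k : ((m + k)`! <= m`! * (m + k) ^ k)%N by rewrite -addnn.
elim: k => [|k IH]; first by rewrite addn0 expn0 muln1.
rewrite addnS factS expnS mulnCA leq_mul2l /=.
apply: leq_trans IH _; rewrite leq_mul2l; apply/orP; right.
by case: k => // k; rewrite leq_exp2r.
Qed.

(** A limit superior below 2 gives ln (ln M(r)) <= rho ln r for large r with some rho < 2; take
    r = 2 ^ k and q = 2 ^ rho. *)
Lemma z_order_bound (F : C -> C -> C) : ent2 F -> (z_order F < 2%:E)%E ->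
  exists q : R, exists k0, [/\ 1 <= q, q < 4 & forall k z, (k0 <= k)%N -> N z = 2 ^+ k ->
    N (F 0 z) <= expR (q ^+ k)].
Proof.
move=> [_ _ FE]; rewrite /z_order /growth_order /limf_esup.
move=> /ereal_inf_lt[_ [V [M [Mreal MV]] <-]] sup2.
set g := fun r : R => _ in sup2.
have [rho [rho1 rho2 rhoV]] : exists rho : R, [/\ 0 <= rho, rho < 2 &
    forall r, V r -> ln (ln (max_modulus (F 0) r)) / ln r <= rho].
  have ub r : V r -> (g r <= ereal_sup (g @` V))%E.
    by move=> Vr; apply: ereal_sup_ubound; exists r.
  case: (ereal_sup (g @` V)) sup2 ub => [s||] //= s2 ub.
    exists (Num.max 0 s); split; first by rewrite le_max lexx.
      by rewrite gt_max; rewrite lte_fin in s2; rewrite s2 andbT.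
    by move=> r /ub; rewrite /g lee_fin => h; rewrite le_max h orbT.
  by exists 0; split => // r /ub.
have ln2 : 0 < ln (2 : R) by rewrite ln_gt0// ltr1n.
exists (expR (rho * ln 2)).
have [k0 Hk0] : exists k0, forall k, (k0 <= k)%N -> M < 2 ^+ k.
  exists (Num.truncn `|M|).+1 => k kM; apply: le_lt_trans (ler_norm M) _.
  apply: lt_le_trans (truncnS_gt _) _.
  apply: (@le_trans _ _ k%:R); first by rewrite ler_nat.
  by rewrite -natrX ler_nat ltnW// ltn_expl.
exists (maxn k0 1); split.
- by rewrite -[leLHS]expR0 ler_expR mulr_ge0// ltW.
- have -> : 4 = expR (2 * ln 2) :> R.
    by rewrite mulr_natl mulr2n expRD lnK ?posrE//; ring.
  by rewrite ltr_expR ltr_pM2r.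
move=> k z; rewrite geq_max => /andP[/Hk0 kM k1] zk.
have le_mm : N (F 0 z) <= max_modulus (F 0) (2 ^+ k).
  apply: ub_le_sup; last by exists z.
  have [|B B0 HB] := @bounded_disc _ (F 0) 0 (2 ^+ k).
    move=> w _; have [|l gl] := FE 0 w 1 w; first by rewrite subrr N0.
    exact: hasd_continuous gl.
  by exists B => _ [w ww <-]; apply: HB; rewrite subr0 ww.
apply: le_trans le_mm _; have := rhoV _ (MV _ kM).
set mm := max_modulus _ _.
have lk : 0 < ln ((2 : R) ^+ k) by rewrite ln_gt0// exprn_egt1// ?ltr1n// -lt0n.
rewrite ler_pdivrMr// => H.
have qk : 0 <= expR (rho * ln 2) ^+ k :> R by rewrite exprn_ge0// expR_ge0.
have [m1|m1] := leP mm 1.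
  by apply: le_trans m1 _; rewrite -[leLHS]expR0 ler_expR.
have m0 : 0 < mm by apply: lt_trans m1.
have lm : 0 < ln mm by rewrite ln_gt0.
rewrite -[mm]lnK ?posrE// ler_expR -[ln mm]lnK ?posrE//.
rewrite -expRM_natl ler_expR; apply: le_trans H _.
rewrite lnXn// mulrnAr mulr_natl lexx.
by [].
Qed.

Variables (F : C -> C -> C) (q : R) (k0 : nat).
Hypotheses (FE : ent2 F) (FH : heat F) (q1 : 1 <= q) (q4 : q < 4).
Hypothesis Fq : forall k z, (k0 <= k)%N -> N z = 2 ^+ k -> N (F 0 z) <= expR (q ^+ k).

Let q0 : 0 <= q. Proof. exact: le_trans ler01 q1. Qed.

Let disc_bound k z : (k0 <= k)%N -> N z <= 2 ^+ k -> N (F 0 z) <= 4 * expR (q ^+ k.+1).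
Proof.
move=> kk zk; have [_ _ F2] := FE.
have p0 : 0 < (2 : R) ^+ k by rewrite exprn_gt0.
have zk1 : N z < 2 ^+ k.+1 by rewrite exprS; lra.
have := @disc_bound_of_circle _ (F 0) 0 (2 ^+ k.+1 + 1) (2 ^+ k.+1) (expR (q ^+ k.+1)) z _ _ (F2 _ _ _) _ zk1.
rewrite add0r => /(_ _ _ _)/le_trans; apply.
- by rewrite exprn_gt0.
- by rewrite ltrDl.
- by move=> w; rewrite subr0 => wk; apply: Fq => //; exact: leqW.
have -> : 4 * expR (q ^+ k.+1) = 2 * expR (q ^+ k.+1) * 2 by ring.
apply: ler_wpM2l; first by rewrite mulr_ge0// expR_ge0.
rewrite ler_pdivrMr ?subr_gt0// exprS; rewrite exprS in zk1; lra.
Qed.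

Let qk_mono i j : (i <= j)%N -> q ^+ i <= q ^+ j.
Proof. by move=> ij; rewrite ler_weXn2l. Qed.

(** Cauchy estimate on the circle of radius 2 ^ j about [z]; the radius will be adapted to [m]. *)
Let deriv_bound k z j m : (k0 <= k)%N -> N z <= 2 ^+ k ->
  N (tcoef (F 0) z m) * (2 ^+ j) ^+ m <= 8 * (expR (q ^+ k.+2) * expR (q ^+ j.+2)).
Proof.
move=> kk zk; have [_ _ F2] := FE.
have p0 : 0 < (2 : R) ^+ j by rewrite exprn_gt0.
have [H _] := @taylor _ (F 0) z (2 ^+ j + 1) (2 ^+ j) p0 ltac:(by rewrite ltrDl) (F2 _ _ _).
have -> : 8 * (expR (q ^+ k.+2) * expR (q ^+ j.+2)) = 2 * (4 * expR (q ^+ k.+2 + q ^+ j.+2)).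
  by rewrite expRD; ring.
apply: H => w wz.
have wN : N w <= 2 ^+ (maxn k j).+1.
  have -> : w = (w - z) + z by rewrite subrK.
  apply: le_trans (ND _ _) _; rewrite wz exprS.
  have : (2 : R) ^+ j <= 2 ^+ maxn k j by rewrite ler_weXn2l ?ler1n// leq_maxr.
  have : (2 : R) ^+ k <= 2 ^+ maxn k j by rewrite ler_weXn2l ?ler1n// leq_maxl.
  lra.
apply: le_trans (disc_bound _ wN) _; first by apply: leqW; rewrite leq_max kk.
rewrite ler_pM2l// ler_expR.
have a0 : 0 <= q ^+ k.+2 by rewrite exprn_ge0.
have b0 : 0 <= q ^+ j.+2 by rewrite exprn_ge0.
by case: leqP => _; lra.
Qed.

Let dyadic (T : R) m : 1 <= T -> exists j, 8 * T * m%:R <= 4 ^+ j /\ (4 ^+ j <= 32 * T * m%:R \/ j = 0%N).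
Proof.
move=> T1.
have ex : exists j, 8 * T * m%:R <= (4 : R) ^+ j.
  exists (Num.truncn (8 * T * m%:R)).+1; apply: le_trans (ltW (truncnS_gt _)) _.
  by rewrite -natrX ler_nat ltnW// ltn_expl.
case: (ex_minnP ex) => -[|j] Hj jmin; first by exists 0%N; split => //; right.
exists j.+1; split => //; left.
have : ~~ (8 * T * m%:R <= 4 ^+ j) by apply/negP => /jmin; rewrite ltnn.
by rewrite -ltNge exprS => h; lra.
Qed.

(** For the coefficient of order [m] in time the radius 2 ^ j is chosen with 4 ^ j comparable to
    T m.  Since q < 4, the growth q ^ j is then eventually below any multiple of m, and in
    particular absorbed by 2 ^ m. *)
Let tail_bound (T : R) : 1 <= T -> exists2 K : R, 0 <= K & forall m, exists j,
  8 * T * m%:R <= 4 ^+ j /\ q ^+ j.+2 <= K + m%:R * ln 2.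
Proof.
move=> T1; have ln2 : 0 < ln (2 : R) by rewrite ln_gt0// ltr1n.
have [||J HJ] := @cvg0_geom R (q ^+ 2 * (32 * T)) (q / 4) (ln 2) _ _ ln2.
- by rewrite divr_ge0.
- by rewrite ltr_pdivrMr// mul1r.
exists (q ^+ J.+2) => [|m]; first by rewrite exprn_ge0.
have [j [j1 j2]] := dyadic m T1; exists j; split => //.
have m0 : 0 <= m%:R * ln 2 :> R by rewrite mulr_ge0// ltW.
have [jJ|jJ] := leqP j J.
  by apply: (le_trans (qk_mono _)); [exact: (_ : (j.+2 <= J.+2)%N)|rewrite lerDl].
case: j2 => [j2|j0]; last by rewrite j0 in jJ.
have qJ : 0 <= q ^+ J.+2 by rewrite exprn_ge0.
apply: (@le_trans _ _ (m%:R * ln 2)); last by rewrite lerDr.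
have qj0 : 0 <= q ^+ 2 * (q / 4) ^+ j by rewrite mulr_ge0 ?exprn_ge0 ?divr_ge0.
have -> : q ^+ j.+2 = q ^+ 2 * (q / 4) ^+ j * 4 ^+ j.
  by rewrite expr_div_n -mulrA divfK ?expf_neq0// -exprD add2n.
apply: le_trans (ler_wpM2l qj0 j2) _.
have := HJ j (ltnW jJ) => /ltW h.
have m1 : 0 <= m%:R :> R by [].
have := ler_wpM2l m1 h; apply: le_trans.
by rewrite le_eqVlt; apply/orP; left; apply/eqP; ring.
Qed.

(** The m-th Taylor coefficient in [t] is a z-derivative of order 2 m of F 0 divided by m!.  With
    the radius of [tail_bound] the Cauchy estimate, of which 4 ^ (j m) is a denominator, beats
    (2 m)! / m! times |t| ^ m by a geometric factor 2 ^- m. *)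
Lemma growth_in_time t : exists2 A : R, 0 < A & forall k z, (k0 <= k)%N -> N z <= 2 ^+ k ->
  N (F t z) <= A * expR (q ^+ k.+2).
Proof.
have [_ F1 _] := FE; pose T := N t + 1.
have Nt := N_ge0 t.
have T1 : 1 <= T by rewrite lerDr.
have [K K0 HK] := tail_bound T1.
exists (16 * expR K) => [|k z kk zk]; first by rewrite mulr_gt0// expR_gt0.
pose B := 8 * expR K * expR (q ^+ k.+2).
have B0 : 0 <= B by rewrite !mulr_ge0// expR_ge0.
have term m : N (tcoef (F ^~ z) 0 m * t ^+ m) <= B * (1 / 2) ^+ m.
  have [j [j1 j2]] := HK m.
  have := deriv_bound j m.*2 kk zk.
  have f0 : 0 < m`!%:R :> R by rewrite ltr0n fact_gt0.
  have E : N (tcoef (F ^~ z) 0 m) * m`!%:R = N (tcoef (F 0) z m.*2) * (m.*2)`!%:R.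
    rewrite /tcoef heat_derive1n// !NM !NV !N_nat.
    by rewrite !divfK// gt_eqF// ltr0n fact_gt0.
  set d := N (tcoef (F 0) z m.*2) in E *; have d0 : 0 <= d by exact: N_ge0.
  have -> : ((2 : R) ^+ j) ^+ m.*2 = (4 ^+ j) ^+ m.
    by rewrite -mul2n exprM -[(2 ^+ j) ^+ 2]exprM mulnC exprM -natrX.
  have Ej : expR (q ^+ j.+2) <= expR K * 2 ^+ m.
    apply: (@le_trans _ _ (expR (K + m%:R * ln 2))); first by rewrite ler_expR.
    by rewrite expRD expRM_natl lnK ?posrE.
  move=> H; set a := N (tcoef _ 0 m) in E.
  have E2 : a <= d * (m.*2)%:R ^+ m.
    rewrite -(ler_pM2r f0) E -mulrA; apply: ler_wpM2l => //.
    by rewrite -natrX -natrM ler_nat mulnC; exact: fact_double.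
  have E3 : (m.*2)%:R * N t <= 4 ^+ j / 4 :> R.
    have m0 : 0 <= m%:R :> R by [].
    have : m%:R * N t <= m%:R * T by rewrite ler_wpM2l// lerDl.
    by rewrite -mul2n natrM; lra.
  rewrite NM NX -/a; apply: (@le_trans _ _ (d * (m.*2)%:R ^+ m * N t ^+ m)).
    by rewrite ler_wpM2r// exprn_ge0.
  rewrite -mulrA -exprMn; apply: (@le_trans _ _ (d * (4 ^+ j / 4) ^+ m)).
    by rewrite ler_wpM2l//; apply: lerXn2r; rewrite ?nnegrE ?divr_ge0 ?mulr_ge0 ?exprn_ge0.
  rewrite !expr_div_n expr1n mulrA ler_pdivrMr ?exprn_gt0//; apply: (le_trans H).
  have -> : B * (1 / 2 ^+ m) * 4 ^+ m = 8 * (expR (q ^+ k.+2) * (expR K * 2 ^+ m)).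
    rewrite (_ : (4 : R) ^+ m = 2 ^+ m * 2 ^+ m); last by rewrite -exprMn -natrM.
    by rewrite /B; field; rewrite expf_neq0.
  by rewrite !ler_wpM2l// expR_ge0.
have geo n : \sum_(i < n) (1 / 2 : R) ^+ i <= 2.
  have := subrX1 (1 / 2 : R) n; move: (\sum_(i < n) _) => S E.
  by have := @exprn_ge0 R n (1 / 2) ltac:(lra); lra.
have Bsum n : N (\sum_(i < n) tcoef (F ^~ z) 0 i * t ^+ i) <= 2 * B.
  apply: le_trans (N_sum _ _ _) _.
  apply: (@le_trans _ _ (\sum_(i < n) B * (1 / 2) ^+ i)).
    by apply: ler_sum => i _; exact: term.
  by rewrite -mulr_sumr mulrC ler_wpM2r.
apply/ler_addgt0Pr => e e0.
have tT : N t < T by rewrite /T ltrDl.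
have [n0 /(_ n0 (leqnn _))] := taylor_cvg (F1 z 0 T) tT e0.
rewrite add0r => /ltW; move: (Bsum n0); move: (\sum_(i < n0) _) => S BS FS.
have -> : F t z = (F t z - S) + S by rewrite subrK.
apply: le_trans (ND _ _) _; rewrite addrC; apply: lerD => //.
by apply: le_trans BS _; rewrite /B le_eqVlt; apply/orP; left; apply/eqP; ring.
Qed.

End Growth.

Section PhiGrowth.
Variable R : realType.
Local Notation C := R[i].
Local Notation N := (@ComplexField.Normc.normc R).

(** Order less than one, measured on discs of radius 4 ^ k: if |u z| <= exp (B |z - a| ^ rho)
    with 0 <= rho < 1, this holds with q = 4 ^ rho. *)
Definition growth (u : C -> C) (a : C) := exists B q : R, exists k0,
  [/\ 0 <= B, 1 <= q, q < 4 & forall k z, (k0 <= k)%N -> N (z - a) <= 4 ^+ k ->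
    N (u z) <= expR (B * q ^+ k)].

Lemma growth_center u a b : growth u a -> growth u b.
Proof.
move=> [B [q [k0 [B0 q1 q4 H]]]].
have [k1 Hk1] : exists k1, N (b - a) <= 4 ^+ k1.
  exists (Num.truncn (N (b - a))).+1; apply: le_trans (ltW (truncnS_gt _)) _.
  by rewrite -natrX ler_nat ltnW// ltn_expl.
exists (B * q), q, (maxn k0 k1); split => //; first by rewrite mulr_ge0//; lra.
move=> k z; rewrite geq_max => /andP[kk0 kk1] zk.
rewrite -mulrA -exprS; apply: H; first exact: leqW.
have -> : z - a = (z - b) + (b - a) by ring.
apply: le_trans (ND _ _) _.
have : (4 : R) ^+ k1 <= 4 ^+ k by rewrite ler_weXn2l ?ler1n.
have : 0 <= (4 : R) ^+ k by rewrite exprn_ge0.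
rewrite exprS; lra.
Qed.

Lemma Phi_growth (F : C -> C -> C) t : ent2 F -> heat F -> (z_order F < 2%:E)%E ->
  growth (Phi_of F t) 0.
Proof.
move=> FE FH Ford; have [q [k0 [q1 q4 Fq]]] := z_order_bound FE Ford.
have [A A0 HA] := growth_in_time FE FH q1 q4 Fq t.
exists (q ^+ 2 + `|ln A|), q, k0; split => //.
  by rewrite addr_ge0 ?exprn_ge0//; lra.
move=> k z kk; rewrite subr0 => zk.
have sk : N (sqrtc z) <= 2 ^+ k.
  rewrite -(@ler_pXn2r _ 2) ?nnegrE ?N_ge0 ?exprn_ge0//.
  by rewrite -NX sqr_sqrtc -exprM mulnC exprM -natrX.
apply: le_trans (HA _ _ kk sk) _.
have qk : 1 <= q ^+ k by rewrite exprn_ege1.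
rewrite mulrDl -exprD add2n addrC expRD ler_pM2r ?expR_gt0//.
rewrite -[A]lnK ?posrE// ler_expR expRK; apply: le_trans (ler_norm _) _.
by rewrite ler_peMr.
Qed.

End PhiGrowth.

(** * Logarithms and the Borel-Caratheodory inequality *)

Section BC.
Variable R : realType.
Local Notation C := R[i].
Local Notation N := (@ComplexField.Normc.normc R).
Local Notation Re := (@complex.Re R).

Lemma geometric_cauchy (u : nat -> C) (K x : R) : 0 <= K -> 0 <= x -> x < 1 ->
  (forall n, N (u n.+1 - u n) <= K * x ^+ n) ->
  exists l, forall n, N (u n - l) <= K / (1 - x) * x ^+ n.
Proof.
move=> K0 x0 x1 H.
have x10 : 0 < 1 - x by rewrite subr_gt0.
have D n k : N (u (n + k)%N - u n) <= K / (1 - x) * x ^+ n.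
  apply: (@le_trans _ _ (K / (1 - x) * x ^+ n * (1 - x ^+ k))); last first.
    rewrite ler_piMr//; first by rewrite mulr_ge0 ?divr_ge0 ?exprn_ge0// ltW.
    by rewrite lerBlDr lerDl exprn_ge0.
  elim: k => [|k IH]; first by rewrite addn0 subrr N0 expr0 subrr mulr0.
  rewrite addnS.
  have -> : u (n + k).+1 - u n = (u (n + k).+1 - u (n + k)%N) + (u (n + k)%N - u n) by ring.
  apply: le_trans (ND _ _) _; apply: le_trans (lerD (H _) IH) _.
  by rewrite le_eqVlt; apply/orP; left; apply/eqP; rewrite exprD exprS; field; rewrite gt_eqF.
have [e e0|l Hl] := @cauchy_seqC R u.
  have [n0 Hn0] := cvg0_geom (K / (1 - x)) x0 x1 (divr_gt0 e0 (ltr0n _ 2)).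
  exists n0 => m n m0 n1; have := Hn0 _ (leqnn _).
  have := D n0 (m - n0)%N; have := D n0 (n - n0)%N; rewrite !subnKC// => A B h.
  have -> : u m - u n = (u m - u n0) - (u n - u n0) by ring.
  by apply: le_lt_trans (NB _ _) _; lra.
exists l => n; apply/ler_addgt0Pr => e /Hl[n0 H0].
have := H0 (n + n0)%N (leq_addl _ _) => A; have B := D n n0.
have -> : u n - l = (u (n + n0)%N - l) - (u (n + n0)%N - u n) by ring.
by apply: le_trans (NB _ _) _; lra.
Qed.

(** Integrate the Taylor polynomials; the resulting series converges uniformly on smaller discs,
    and so do the derivatives. *)
Lemma primitive (g : C -> C) (a : C) (r : R) : hol g a r ->
  exists k, forall w, N (w - a) < r -> hasd k w (g w).
Proof.
move=> gh; pose c i := tcoef g a i.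
pose b i : C := if i is j.+1 then c j / j.+1%:R else 0.
pose P n w := \sum_(i < n.+1) b i * (w - a) ^+ i.
have Pd n w : hasd (P n) w (\sum_(i < n) c i * (w - a) ^+ i).
  have := hasd_poly b n.+1 a w; rewrite /=.
  suff -> : \sum_(i < n) i.+1%:R * b i.+1 * (w - a) ^+ i = \sum_(i < n) c i * (w - a) ^+ i by [].
  apply: eq_bigr => i _; congr (_ * _).
  by rewrite /b mulrC divfK// pnatr_eq0.
have conv (s : R) : 0 < s -> s < r -> exists K x : R, [/\ 0 <= x, x < 1 &
    forall w, N (w - a) <= s -> forall n, N (P n.+1 w - P n w) <= K * x ^+ n].
  move=> s0 sr.
  have [t st tr] : exists2 t : R, s < t & t < r by exists ((s + r) / 2); lra.
  have t0 : 0 < t by exact: lt_trans st.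
  have [H _] := taylor t0 tr gh; have [M M0 HM] := hol_bounded tr gh.
  have {}H n : N (c n) * t ^+ n <= 2 * M.
    by apply: H => w wt; apply: HM; rewrite wt.
  exists (2 * M * s), (s / t); split; first by rewrite divr_ge0// ltW.
    by rewrite ltr_pdivrMr// mul1r.
  move=> w ws n; have -> : P n.+1 w - P n w = b n.+1 * (w - a) ^+ n.+1.
    have -> : P n.+1 w = P n w + b n.+1 * (w - a) ^+ n.+1 by exact: big_ord_recr.
    by rewrite addrC addKr.
  rewrite /b NM NX NM NV N_nat.
  have tn : 0 < t ^+ n by rewrite exprn_gt0.
  have cn : N (c n) / n.+1%:R <= 2 * M / t ^+ n.
    apply: (@le_trans _ _ (N (c n))); last by rewrite ler_pdivlMr.
    by rewrite ler_piMr ?N_ge0// invf_le1// ler1n.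
  have wn : N (w - a) ^+ n.+1 <= s ^+ n.+1.
    by apply: lerXn2r; rewrite ?nnegrE ?N_ge0 ?(ltW s0).
  apply: le_trans (ler_pM _ _ cn wn) _.
  - by rewrite divr_ge0 ?N_ge0.
  - by rewrite exprn_ge0 ?N_ge0.
  by rewrite expr_div_n exprS le_eqVlt; apply/orP; left; apply/eqP; field; rewrite gt_eqF.
have lim w : exists l, N (w - a) < r -> forall e : R, 0 < e -> exists n0, forall n, (n0 <= n)%N ->
    N (P n w - l) < e.
  have [wr|wr] := ltP (N (w - a)) r; last by exists 0.
  have Nw := N_ge0 (w - a).
  have [s ws sr] : exists2 s : R, N (w - a) < s & s < r by exists ((N (w - a) + r) / 2); lra.
  have [K [x [x0 x1 H]]] := conv s (le_lt_trans Nw ws) sr.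
  have {}H := H _ (ltW ws).
  have K0 : 0 <= K by have := H 0%N; rewrite expr0 mulr1; exact/le_trans/N_ge0.
  have [l Hl] := geometric_cauchy K0 x0 x1 H.
  exists l => _ e e0; have [n0 Hn0] := cvg0_geom (K / (1 - x)) x0 x1 e0.
  by exists n0 => n /Hn0; apply: le_lt_trans.
pose k w := projT1 (cid (lim w)).
have klim w : N (w - a) < r -> forall e : R, 0 < e -> exists n0, forall n, (n0 <= n)%N ->
    N (P n w - k w) < e.
  by rewrite /k; case: cid.
have unif (s : R) : 0 < s -> s < r -> forall e : R, 0 < e -> exists n0, forall n, (n0 <= n)%N ->
    forall w, N (w - a) <= s -> N (P n w - k w) <= e.
  move=> s0 sr e e0; have [K [x [x0 x1 H]]] := conv s s0 sr.
  have K0 : 0 <= K.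
    have := H a; rewrite subrr N0 => /(_ (ltW s0) 0%N).
    by rewrite expr0 mulr1; exact/le_trans/N_ge0.
  have [n0 Hn0] := cvg0_geom (K / (1 - x)) x0 x1 (divr_gt0 e0 (ltr0n _ 2)).
  exists n0 => n /Hn0 Hn w ws; have [l Hl] := geometric_cauchy K0 x0 x1 (H w ws).
  have [n1 Hn1] := klim w (le_lt_trans ws sr) (e / 4) (divr_gt0 e0 (ltr0n _ 4)).
  have [n2 Hn2] := cvg0_geom (K / (1 - x)) x0 x1 (divr_gt0 e0 (ltr0n _ 4)).
  have A := Hn1 _ (leq_maxl n1 n2); have B := Hn2 _ (leq_maxr n1 n2).
  have D := Hl (maxn n1 n2); have E := Hl n.
  have -> : P n w - k w = (P n w - l) - (P (maxn n1 n2) w - l) + (P (maxn n1 n2) w - k w) by ring.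
  apply: le_trans (ND _ _) _; have := NB (P n w - l) (P (maxn n1 n2) w - l).
  lra.
exists k => w wr.
have Nw := N_ge0 (w - a).
have [s ws sr] : exists2 s : R, N (w - a) < s & s < r by exists ((N (w - a) + r) / 2); lra.
have s0 : 0 < s by exact: le_lt_trans ws.
have kh : hol k a s.
  apply: weierstrass_ball => e e0; have [n0 /(_ n0 (leqnn _)) H] := unif s s0 sr e e0.
  exists (P n0); first by apply: entire_hol => z; eexists; exact: Pd.
  by move=> z /ltW; exact: H.
have kw := hol_derive1 kh ws.
suff <- : derive1 k w = g w by [].
apply/eqP; rewrite -subr_eq0; apply/eqP.
pose d := s - N (w - a); have d0 : 0 < d by rewrite subr_gt0.
apply: (@N_eps0 _ _ (4 / d + 1)) => e e0.
have [n1 H1] := unif s s0 sr e e0; have [n2 H2] := taylor_cvg gh wr e0.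
pose n := maxn n1 n2.
have A := H1 n (leq_maxl _ _); have := H2 n (leq_maxr _ _).
rewrite [a + _]addrC subrK => /ltW B.
have inw z : N (z - w) < d -> N (z - a) < s.
  rewrite /d ltrBrDr; apply: le_lt_trans.
  by apply: le_trans (ND _ _); rewrite addrA subrK.
have := @cauchy_derivative _ (fun z => P n z - k z) w d e _ d0 _ _ (hasdB (Pd n w) kw).
move=> /(_ _ _) D.
have {}D : N (\sum_(i < n) c i * (w - a) ^+ i - derive1 k w) <= 4 * e / d.
  apply: D; last by move=> z /inw/ltW; exact: A.
  move=> z /inw zs; eexists; exact: hasdB (Pd n z) (hol_derive1 kh zs).
move: B D; rewrite -/c; move: (\sum_(i < n) _) => S B D.
have -> : derive1 k w - g w = - ((S - derive1 k w) + (g w - S)) by ring.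
rewrite NN; apply: le_trans (ND _ _) _; rewrite mulrDl mul1r; apply: lerD => //.
by rewrite mulrAC.
Qed.

(** [v] has a logarithm [k] with real part at most [A] and k a = 0.  Then k / (2 A - k) maps the
    disc into the unit disc, and the Cauchy estimate for its derivative l / (2 A) at [a] applies. *)
Lemma borel_caratheodory (v : C -> C) (a l : C) (r A : R) : 0 < r -> 0 < A -> hol v a r ->
  (forall w, N (w - a) < r -> v w != 0) -> v a = 1 ->
  (forall w, N (w - a) < r -> N (v w) <= expR A) -> hasd v a l -> N l <= 8 * A / r.
Proof.
move=> r0 A0 vh v0 va vA vl.
have gh : hol (fun w => derive1 v w / v w) a r.
  move=> w wr; have [d dd] := hol_derive vh wr; eexists.
  exact: hasdM dd (hasdV (v0 _ wr) (hol_derive1 vh wr)).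
have [k0 Hk0] := primitive gh.
pose k w := k0 w - k0 a.
have Hk w : N (w - a) < r -> hasd k w (derive1 v w / v w).
  by move=> wr; have := hasdB (Hk0 _ wr) (hasd_cst (k0 a) w); rewrite subr0.
have aa : N (a - a) < r by rewrite subrr N0.
have vk w : N (w - a) < r -> v w = cexp (k w).
  move=> wr.
  have D z : N (z - a) < r -> hasd (fun z => v z * cexp (- k z)) z 0.
    move=> zr.
    have := hasdM (hol_derive1 vh zr) (hasd_comp (hasdN (Hk _ zr)) (hasd_cexp (- k z))).
    suff -> : derive1 v z * cexp (- k z) + v z * (cexp (- k z) * - (derive1 v z / v z)) = 0 by [].
    by field; exact: v0.
  have := hasd0_cst D wr; rewrite va mul1r /k subrr oppr0 cexp0 -/(k w) => E.
  by rewrite -[RHS]mul1r -E -mulrA -cexpD addNr cexp0 mulr1.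
have kA w : N (w - a) < r -> Re (k w) <= A.
  by move=> wr; have := vA w wr; rewrite vk// N_cexp ler_expR.
pose T : C := (2 * A)%:C.
have kT w : N (w - a) < r -> T - k w != 0.
  move=> wr; apply/eqP => /(congr1 Re); rewrite Re_D Re_N /=.
  have := kA w wr; lra.
pose f w := k w / (T - k w).
have fd w : N (w - a) < r -> hasd f w (derive1 v w / v w * (T - k w)^-1 +
    k w * (- (0 - derive1 v w / v w) / (T - k w) ^+ 2)).
  move=> wr; exact: hasdM (Hk _ wr) (@hasdV _ (fun z => T - k z) _ _ (kT _ wr) (hasdB (hasd_cst T w) (Hk _ wr))).
have := @cauchy_derivative _ f a r 1 _ r0 _ _ (fd a aa).
have -> : k a = 0 by rewrite /k subrr.
rewrite (hasd_derive1 vl) va divr1 mul0r addr0 subr0 NM NV N_real ger0_norm; last by lra.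
move=> H; have : N l / (2 * A) <= 4 * 1 / r.
  apply: H; first by move=> w wr; eexists; exact: fd.
  move=> w wr; rewrite NM NV ler_pdivrMr ?N_gt0 ?kT// mul1r.
  (* |k| <= |2 A - k| because the real part of k is at most A. *)
  rewrite -(@ler_pXn2r _ 2) ?nnegrE ?N_ge0// !N_sq Re_D Im_D Re_N Im_N /= sub0r sqrrN lerD2r.
  have := kA w wr; nra.
rewrite ler_pdivrMr ?mulr_gt0// => /le_trans; apply.
by rewrite le_eqVlt; apply/orP; left; apply/eqP; field; rewrite gt_eqF.
Qed.

End BC.

(** * Dividing out zeros *)

Section Division.
Variable R : realType.
Local Notation C := R[i].
Local Notation N := (@ComplexField.Normc.normc R).

Lemma entire_derive (u : C -> C) w : entire u -> hasd u w (derive1 u w).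
Proof.
by move=> ue; apply: (hol_derive1 (entire_hol ue (c := w) (r := 1))); rewrite subrr N0.
Qed.

Lemma derive1_entire (u : C -> C) : entire u -> entire (derive1 u).
Proof.
move=> ue w; have := hol_derive (entire_hol ue (c := w) (r := 1)); apply.
by rewrite subrr N0.
Qed.

Lemma derive1n_entire (u : C -> C) n : entire u -> entire (derive1n n u).
Proof. by move=> ue; elim: n => //= n IH; exact: derive1_entire. Qed.

(** The quotient is holomorphic at [w0] as the uniform limit of the quotients of the Taylor
    polynomials by [z - w0]. *)
Lemma divide_zero (u : C -> C) (w0 : C) : entire u -> u w0 = 0 ->
  exists2 v, entire v & forall z, u z = (z - w0) * v z.
Proof.
move=> ue u0; pose l := derive1 u w0; exists (diff_quotient u w0 l); last first.
  move=> z; rewrite /diff_quotient; case: eqVneq => [->|zw]; first by rewrite subrr mul0r.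
  by rewrite u0 subr0 mulrC divfK// subr_eq0.
move=> w; have [->|ww] := eqVneq w w0; last first.
  by have [a ua] := ue w; exact: diff_quotient_hasd ww ua.
apply: (@weierstrass _ _ w0 (1 / 2)) => [|e e0]; first by rewrite divr_gt0.
have uh : hol u w0 2 by exact: entire_hol.
have [_ H] := taylor (ltr01 : 0 < 1 :> R) (ltr1n _ _ : (1 < 2 :> R)) uh.
have [M M0 /H fM] := hol_bounded (ltr1n _ _ : (1 < 2 :> R)) uh.
have [n Hn] : exists n, 8 * M * (1 / 2 : R) ^+ n < e.
  have [||n0 /(_ n0 (leqnn _))] := cvg0_geom (8 * M) _ _ e0 (x := 1 / 2); try lra.
  by exists n0.
have t0 : tcoef u w0 0 = 0 by rewrite /tcoef /= u0 mul0r.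
have t1 : tcoef u w0 1 = l by rewrite /tcoef /= divr1.
exists (fun z => \sum_(i < n.+1) tcoef u w0 i.+1 * (z - w0) ^+ i).
  by apply: entire_hol => z; eexists; exact: (hasd_poly (fun i => tcoef u w0 i.+1)).
move=> z zw; rewrite NBC /diff_quotient; case: eqVneq => [->|zw0].
  rewrite big_ord_recl /= expr0 mulr1 big1 ?addr0 ?t1 ?subrr ?N0 ?ltW//.
  by move=> i _; rewrite expr0n /= mulr0.
have h0 : z - w0 != 0 by rewrite subr_eq0.
have := fM (z - w0) n.+2; rewrite [w0 + _]addrC subrK big_ord_recl t0 mul0r add0r.
pose S := \sum_(i < n.+1) tcoef u w0 i.+1 * (z - w0) ^+ i.
rewrite -/S; have -> : \sum_(i < n.+1) tcoef u w0 (lift ord0 i) * (z - w0) ^+ lift ord0 i =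
    (z - w0) * S.
  rewrite /S mulr_sumr; apply: eq_bigr => i _.
  by rewrite lift0 exprS mulrCA.
move: S => S; set h := z - w0 in h0 zw *.
have Nh : 0 < N h by rewrite N_gt0.
rewrite u0 subr0; have -> : u z / h - S = (u z - h * S) / h by field.
rewrite NM NV ler_pdivrMr// => /(_ ltac:(lra))/le_trans; apply.
rewrite divr1 exprS; apply: (@le_trans _ _ (8 * M * (1 / 2) ^+ n.+1 * N h)); last first.
  rewrite ler_wpM2r ?(ltW Nh)//; apply: le_trans (ltW Hn).
  rewrite exprS; have : 0 <= 8 * M * (1 / 2 : R) ^+ n.
    by apply: mulr_ge0; [lra|rewrite exprn_ge0//; lra].
  lra.
have hn : N h ^+ n.+1 <= (1 / 2) ^+ n.+1.
  by apply: lerXn2r; rewrite ?nnegrE ?(ltW Nh)//; lra.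
have i2 : 1 / (1 - N h) <= 2 by rewrite ler_pdivrMr; lra.
have hn0 : 0 <= N h ^+ n.+1 by rewrite exprn_ge0// ltW.
have -> : 4 * M * (N h * N h ^+ n.+1) * (1 / (1 - N h)) =
  4 * M * N h * (N h ^+ n.+1 * (1 / (1 - N h))) by ring.
have -> : 8 * M * (1 / 2) ^+ n.+1 * N h = 4 * M * N h * ((1 / 2) ^+ n.+1 * 2) by ring.
apply: ler_wpM2l; first by rewrite !mulr_ge0// ltW.
by apply: ler_pM => //; rewrite divr_ge0//; lra.
Qed.

Lemma hasd_eq (f : C -> C) (t a b : C) : hasd f t a -> a = b -> hasd f t b.
Proof. by move=> H <-. Qed.

(** Leibniz rule; at [w0] it relates the derivatives of [u] and of the quotient with a shift
    of order, and hence the multiplicities. *)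
Lemma derive1n_linear_factor (v : C -> C) (w0 : C) n w : entire v ->
  derive1n n.+1 (fun z => (z - w0) * v z) w =
  (w - w0) * derive1n n.+1 v w + n.+1%:R * derive1n n v w.
Proof.
elim: n w => [|n IH] w ve.
  rewrite /= mul1r; apply: hasd_derive1.
  have := hasdM (hasdB (hasd_id w) (hasd_cst w0 w)) (entire_derive w ve).
  by rewrite subr0 mul1r addrC.
rewrite [LHS]/=.
have -> : derive1 (derive1n n (fun z => (z - w0) * v z)) =
    (fun w => (w - w0) * derive1n n.+1 v w + n.+1%:R * derive1n n v w).
  by apply/funext => z; exact: IH.
apply: hasd_derive1.
have E (x y : C) : (1 - 0) * y + (w - w0) * x + n.+1%:R * y = (w - w0) * x + n.+2%:R * y.
  by rewrite -[n.+2%:R]natr1; ring.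
exact: hasd_eq (hasdD (hasdM (hasdB (hasd_id w) (hasd_cst w0 w))
  (entire_derive w (derive1n_entire n.+1 ve)))
  (hasdZ n.+1%:R (entire_derive w (derive1n_entire n ve)))) (E _ _).
Qed.

Lemma zero_mult_same (u v : C -> C) (w0 : C) n : entire v ->
  (forall z, u z = (z - w0) * v z) ->
  zero_multiplicity u w0 n.+1 -> zero_multiplicity v w0 n.
Proof.
move=> ve uv [H1 H2]; have {uv}uE : u = (fun z => (z - w0) * v z) by apply/funext.
have E i : derive1n i.+1 u w0 = i.+1%:R * derive1n i v w0.
  by rewrite uE derive1n_linear_factor// subrr mul0r add0r.
split=> [i ilt|]; last by move: H2; rewrite E mulf_eq0 negb_or => /andP[].
have := H1 i.+1 ilt; rewrite E => /eqP; rewrite mulf_eq0 pnatr_eq0 /= => /eqP.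
by [].
Qed.

Lemma zero_mult_other (u v : C -> C) (w0 w : C) n : entire v -> w != w0 ->
  (forall z, u z = (z - w0) * v z) ->
  zero_multiplicity u w n -> zero_multiplicity v w n.
Proof.
move=> ve ww uv [H1 H2]; have uE : u = (fun z => (z - w0) * v z) by apply/funext.
have w00 : w - w0 != 0 by rewrite subr_eq0.
have Z i : (i < n)%N -> derive1n i v w = 0.
  elim: i => [|i IH] ilt; have := H1 _ ilt.
    by rewrite /= uv => /eqP; rewrite mulf_eq0 (negbTE w00) => /eqP.
  rewrite uE derive1n_linear_factor// (IH (ltnW ilt)) mulr0 addr0 => /eqP.
  by rewrite mulf_eq0 (negbTE w00) => /eqP.
split => //; case: n H1 H2 Z => [|n] H1 H2 Z.
  by move: H2; rewrite /= uv mulf_eq0 negb_or => /andP[].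
move: H2; rewrite uE derive1n_linear_factor// (Z n (ltnSn _)) mulr0 addr0.
by rewrite mulf_eq0 negb_or => /andP[].
Qed.

Lemma zero_mult_pos (u : C -> C) (w : C) n : zero_multiplicity u w n ->
  (u w == 0) = (0 < n)%N.
Proof.
case: n => [|n] [H1 H2]; first by apply/negbTE.
by have := H1 0%N isT; rewrite /= => ->; rewrite eqxx.
Qed.

Lemma lists_zeros_root (u : C -> C) J nu j : lists_zeros u J nu -> J j -> u (nu j) = 0.
Proof.
move=> H Jj; have [n [zn cn]] := H (nu j); apply/eqP; rewrite (zero_mult_pos zn) lt0n.
apply/eqP => n0; move: cn; rewrite n0 II0 card_eq0 => /eqP E.
by have : [set i | J i /\ nu i = nu j] j by []; rewrite E.
Qed.

Lemma root_listed (u : C -> C) J nu w : lists_zeros u J nu -> u w = 0 ->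
  exists2 j, J j & nu j = w.
Proof.
move=> H uw; have [n [zn cn]] := H w.
have : (0 < n)%N by rewrite -(zero_mult_pos zn) uw eqxx.
case: (pselect (exists j, J j /\ nu j = w)) => [[j [Jj nj]]|no]; first by exists j.
move: cn; have -> : [set j | J j /\ nu j = w] = set0.
  by apply/seteqP; split => // j Hj; case: no; exists j.
by rewrite card_eq_sym card_eq0 => /eqP/IIn_eq0 ->.
Qed.

Lemma card_remove (A : set nat) k n : A k -> (A #= `I_n.+1)%card -> (A `\ k #= `I_n)%card.
Proof.
move=> Ak An; have fA : finite_set A by apply/finite_setP; exists n.+1.
have := card_fset_set An; rewrite (cardfsD1 k) in_fset_set// (mem_set Ak) /= add1n => -[cA].
have -> : A `\ k = [set` (fset_set A `\ k)%fset].
  apply/seteqP; split => x /=.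
    by move=> [Ax xk]; rewrite in_fsetD1 in_fset_set// (mem_set Ax) andbT; apply/eqP.
  by rewrite in_fsetD1 in_fset_set// => /andP[/eqP xk /set_mem].
exact/card_eq_fsetP.
Qed.

(** Dividing by [z - nu k] lowers the multiplicity at [nu k] by one and keeps the others. *)
Lemma lists_zeros_divide (u : C -> C) J nu k : entire u -> lists_zeros u J nu -> J k ->
  exists v, [/\ entire v, (forall z, u z = (z - nu k) * v z) & lists_zeros v (J `\ k) nu].
Proof.
move=> ue H Jk; have [v ve uv] := divide_zero ue (lists_zeros_root H Jk).
exists v; split => // w; have [n [zn cn]] := H w.
have [wk|wk] := eqVneq w (nu k); last first.
  exists n; split; first exact: zero_mult_other ve wk uv zn.
  suff -> : [set j | (J `\ k) j /\ nu j = w] = [set j | J j /\ nu j = w] by [].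
  apply/seteqP; split => j /=; first by move=> [[]].
  by move=> [Jj jw]; do !split => //; move=> jk; move: wk; rewrite -jw jk eqxx.
have kin : [set j | J j /\ nu j = w] k by [].
have n0 : (0 < n)%N by rewrite -(zero_mult_pos zn) wk (lists_zeros_root H Jk).
case: n n0 zn cn => // n _ zn cn; exists n; split.
  by rewrite wk in zn *; exact: zero_mult_same ve uv zn.
suff -> : [set j | (J `\ k) j /\ nu j = w] = [set j | J j /\ nu j = w] `\ k.
  exact: card_remove.
by apply/seteqP; split => j /=; tauto.
Qed.

Lemma lists_zeros_prod (u : C -> C) J nu (s : seq nat) : entire u -> lists_zeros u J nu ->
  uniq s -> (forall j, j \in s -> J j) ->
  exists v, [/\ entire v, (forall z, u z = \prod_(j <- s) (z - nu j) * v z) &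
    lists_zeros v (J `\` [set` s]) nu].
Proof.
elim: s u J => [|k s IH] u J ue H.
  move=> _ _; exists u; split => //; first by move=> z; rewrite big_nil mul1r.
  suff -> : J `\` [set` [::]] = J by [].
  by apply/seteqP; split => j /=; [case|].
rewrite cons_uniq => /andP[ks us] sJ.
have [|v [ve uv vH]] := lists_zeros_divide ue H (k := k); first by apply: sJ; rewrite mem_head.
have [|w [we vw wH]] := IH v _ ve vH us.
  move=> j js; split; first by apply: sJ; rewrite in_cons js orbT.
  by move=> jk; move: ks; rewrite -jk js.
exists w; split => //; first by move=> z; rewrite uv vw big_cons mulrA.
suff -> : J `\` [set` k :: s] = (J `\ k) `\` [set` s] by [].
apply/seteqP; split => j /=; rewrite in_cons.
  by move=> [Jj /negP]; rewrite negb_or => /andP[/eqP jk /negP js].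
by move=> [[Jj /eqP/negbTE jk] js]; split => //; rewrite jk.
Qed.

End Division.

(** * The logarithmic derivative as a sum over the zeros *)

Section Key.
Variable R : realType.
Local Notation C := R[i].
Local Notation N := (@ComplexField.Normc.normc R).

Lemma prod_ge (s : seq nat) (f : nat -> R) (c : R) : 0 <= c ->
  (forall j, j \in s -> c <= f j) -> c ^+ size s <= \prod_(j <- s) f j.
Proof.
move=> c0; elim: s => [|k s IH] H; first by rewrite big_nil expr0.
rewrite big_cons /= exprS; apply: ler_pM => //; first exact: exprn_ge0.
  by apply: H; rewrite mem_head.
by apply: IH => j js; apply: H; rewrite in_cons js orbT.
Qed.

Lemma prod_le (s : seq nat) (f : nat -> R) (c : R) : 0 <= c ->
  (forall j, j \in s -> 0 <= f j <= c) -> \prod_(j <- s) f j <= c ^+ size s.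
Proof.
move=> c0; elim: s => [|k s IH] H; first by rewrite big_nil expr0.
have /andP[f0 fc] := H k (mem_head _ _).
have Hs j : j \in s -> 0 <= f j <= c by move=> js; apply: H; rewrite in_cons js orbT.
rewrite big_cons /= exprS; apply: ler_pM => //; last exact: IH.
by rewrite big_seq prodr_ge0// => j /Hs/andP[].
Qed.

Lemma hasd_prod (s : seq nat) (nu : nat -> C) (a : C) :
  (forall j, j \in s -> nu j != a) ->
  hasd (fun z => \prod_(j <- s) (z - nu j)) a
    ((\prod_(j <- s) (a - nu j)) * \sum_(j <- s) (a - nu j)^-1).
Proof.
elim: s => [|k s IH] H.
  rewrite !big_nil mulr0; apply: hasd_ext (hasd_cst 1 a).
  by exists 1 => // y _; rewrite big_nil.
have ka : a - nu k != 0 by rewrite subr_eq0 eq_sym; apply: H; rewrite mem_head.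
have {}IH : hasd (fun z => \prod_(j <- s) (z - nu j)) a
    ((\prod_(j <- s) (a - nu j)) * \sum_(j <- s) (a - nu j)^-1).
  by apply: IH => j js; apply: H; rewrite in_cons js orbT.
have D := hasdM (hasdB (hasd_id a) (hasd_cst (nu k) a)) IH.
apply: (@hasd_ext _ (fun z => (z - nu k) * \prod_(j <- s) (z - nu j))).
  by exists 1 => // y _; rewrite big_cons.
apply: hasd_eq D _; rewrite !big_cons /=.
by field.
Qed.

Variables (u : C -> C) (a : C) (J : set nat) (nu : nat -> C) (B q : R) (k0 : nat).
Hypotheses (ue : entire u) (ua : u a != 0) (H : lists_zeros u J nu).
Hypotheses (B0 : 0 <= B) (q1 : 1 <= q) (q4 : q < 4).
Hypothesis G : forall k z, (k0 <= k)%N -> N (z - a) <= 4 ^+ k -> N (u z) <= expR (B * q ^+ k).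

Let q0 : 0 <= q. Proof. exact: le_trans ler01 q1. Qed.
Let Nua : 0 < N (u a). Proof. by rewrite N_gt0. Qed.
Let p4 k : 0 < (4 : R) ^+ k. Proof. by rewrite exprn_gt0. Qed.
Let qk1 k : 1 <= q ^+ k. Proof. exact: exprn_ege1. Qed.

Let nu_neq j : J j -> nu j != a.
Proof. by move=> Jj; apply: contra_neq ua => <-; exact: lists_zeros_root H Jj. Qed.

(** Duplicate-free lists of zeros in the disc of radius 4 ^ k about [a]. *)
Let inside k (s : seq nat) := uniq s /\ forall j, j \in s -> J j /\ N (nu j - a) <= 4 ^+ k.

(** On the circle of radius 4 ^ k.+1 every divided factor has modulus at least 3 * 4 ^ k, while at
    [a] it has modulus at most 4 ^ k. *)
Let quotient k s : (k0 <= k)%N -> inside k s -> exists v, [/\ entire v,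
  (forall z, u z = \prod_(j <- s) (z - nu j) * v z), lists_zeros v (J `\` [set` s]) nu,
  (forall w, N (w - a) = 4 ^+ k.+1 -> N (v w) <= expR (B * q ^+ k.+1) / (3 * 4 ^+ k) ^+ size s) &
  N (u a) <= (4 ^+ k) ^+ size s * N (v a)].
Proof.
move=> kk [us sJ].
have [v [ve uv vH]] := lists_zeros_prod ue H us (fun j js => (sJ j js).1).
exists v; split => //.
  move=> w wk; have c0 : 0 < 3 * (4 : R) ^+ k by rewrite mulr_gt0.
  rewrite ler_pdivlMr ?exprn_gt0// mulrC; apply: (@le_trans _ _ (N (u w))); last first.
    by apply: G; [exact: leqW|rewrite wk].
  rewrite uv NM N_prod ler_wpM2r ?N_ge0//; apply: prod_ge; first exact: ltW.
  move=> j /sJ[_ jk]; have -> : w - nu j = (w - a) - (nu j - a) by ring.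
  apply: le_trans (NB_ge _ _); rewrite wk exprS; lra.
rewrite uv NM N_prod ler_wpM2r ?N_ge0//; apply: prod_le; first exact: ltW.
by move=> j /sJ[_ jk]; rewrite N_ge0 NBC.
Qed.

Let ln3 : 0 < ln (3 : R). Proof. by rewrite ln_gt0// ltr1n. Qed.

(** By [quotient], |u a| is at most a constant times 3 ^- n times the bound of [u] on the larger
    circle, where [n] is the number of zeros; take logarithms. *)
Let count : exists2 K : R, 0 <= K & forall k s, (k0 <= k)%N -> inside k s -> (size s)%:R <= K * q ^+ k.
Proof.
exists ((`|ln (2 / N (u a))| + B * q) / ln 3).
  by rewrite divr_ge0 ?addr_ge0 ?mulr_ge0// ltW.
move=> k s kk ks; have [v [ve _ _ vb va]] := quotient kk ks.
have := @center_bound_of_circle _ v a (4 ^+ k.+1 + 1) (4 ^+ k.+1) _ (p4 k.+1) _ (@entire_hol _ v ve a _) vb.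
rewrite ltrDl ltr01 => /(_ isT); set E := expR _; set n := size s.
rewrite exprMn => h.
have p : 0 < ((4 : R) ^+ k) ^+ n by rewrite exprn_gt0.
have p3 : 0 < (3 : R) ^+ n by rewrite exprn_gt0.
have E0 : 0 < E by exact: expR_gt0.
have {}h : N (u a) * 3 ^+ n <= 2 * E.
  rewrite -ler_pdivlMr//; apply: le_trans va _.
  apply: (@le_trans _ _ (((4 : R) ^+ k) ^+ n * (2 * (E / (3 ^+ n * (4 ^+ k) ^+ n))))).
    by rewrite ler_pM2l.
  by rewrite le_eqVlt; apply/orP; left; apply/eqP; field; rewrite !gt_eqF.
have {}h : 3 ^+ n <= 2 / N (u a) * E by rewrite mulrAC ler_pdivlMr// mulrC.
have c0 : 0 < 2 / N (u a) by rewrite divr_gt0.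
have : ln ((3 : R) ^+ n) <= ln (2 / N (u a) * E) by rewrite ler_ln ?posrE// mulr_gt0.
rewrite lnXn// lnM ?posrE// /E expRK -[ln 3 *+ n]mulr_natl [q ^+ k.+1]exprS => {}h.
rewrite mulrAC ler_pdivlMr//; apply: le_trans h _.
rewrite [B * (q * _)]mulrA [leRHS]mulrDl lerD2r; apply: le_trans (ler_norm _) _.
by rewrite ler_peMr.
Qed.

(** The counting bound makes a maximal list exist. *)
Let exhaust k : (k0 <= k)%N -> exists s, inside k s /\
  forall j, J j -> N (nu j - a) <= 4 ^+ k -> j \in s.
Proof.
move=> kk; have [K K0 HK] := count.
pose P n := `[< exists2 s, inside k s & size s = n >].
have P0 : exists n, P n by exists 0%N; apply/asboolP; exists [::].
have Pb n : P n -> (n <= Num.truncn (K * q ^+ k))%N.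
  move=> /asboolP[s ks <-]; have := HK _ _ kk ks.
  by rewrite -(truncn_ge_nat _ (mulr_ge0 K0 (exprn_ge0 _ q0))).
have [n /asboolP[s ks sn] nmax] := ex_maxnP P0 Pb.
exists s; split => // j Jj jk; apply/negPn/negP => js.
have : P n.+1.
  apply/asboolP; exists (j :: s); last by rewrite /= sn.
  case: ks => us sJ; split; first by rewrite /= js.
  by move=> i; rewrite in_cons => /predU1P[->|/sJ].
by move/nmax; rewrite ltnn.
Qed.

(** The quotient has no zero in the disc, and its logarithmic derivative at [a] is up to sign the
    difference to be estimated; [borel_caratheodory] bounds it. *)
Let log_derivative : exists2 K : R, 0 <= K & forall k s, (k0 <= k)%N -> inside k s ->
  (forall j, J j -> N (nu j - a) <= 4 ^+ k -> j \in s) ->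
  N (\sum_(j <- s) (a - nu j)^-1 - derive1 u a / u a) <= K * (q / 4) ^+ k.
Proof.
pose A0 := B * q + `|ln (3 / N (u a))| + 1.
have A00 : 0 <= A0 by rewrite !addr_ge0// mulr_ge0.
exists (8 * A0) => [|k s kk ks full]; first by rewrite mulr_ge0.
have [v [ve uv vH vb va]] := quotient kk ks.
have va0 : v a != 0 by apply: contraNneq ua => va0; rewrite uv va0 mulr0.
have Nva : 0 < N (v a) by rewrite N_gt0.
have sneq j : j \in s -> nu j != a by move=> /ks.2[/nu_neq].
have vd := entire_derive a ve.
have uD := hasdM (hasd_prod sneq) vd.
have E : derive1 u a = (\prod_(j <- s) (a - nu j) * \sum_(j <- s) (a - nu j)^-1) * v a +
    \prod_(j <- s) (a - nu j) * derive1 v a.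
  by apply: hasd_derive1; apply: hasd_ext uD; exists 1 => // y _; rewrite uv.
have Pn0 : \prod_(j <- s) (a - nu j) != 0.
  by move: ua; rewrite uv mulf_eq0 negb_or => /andP[].
have -> : \sum_(j <- s) (a - nu j)^-1 - derive1 u a / u a = - ((v a)^-1 * derive1 v a).
  rewrite E uv; move: (\prod_(j <- s) _) (\sum_(j <- s) _) (derive1 v a) Pn0 => X Y Z X0.
  by field; rewrite va0 X0.
rewrite NN.
pose w z := (v a)^-1 * v z.
have wd : hasd w a ((v a)^-1 * derive1 v a) by exact: hasdZ.
(* expR A bounds v / v(a) on the disc: the factors 4 ^ k of v(a) and of the bound of v on the
   larger circle cancel. *)
pose n := size s; pose A := B * q ^+ k.+1 + `|ln (3 / N (u a))| + 1.
have A1 : 0 < A by rewrite ltr_wpDl// addr_ge0// mulr_ge0// exprn_ge0.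
have p : 0 < ((4 : R) ^+ k) ^+ n by rewrite exprn_gt0.
have wh : hol w a (4 ^+ k) by move=> z _; have [l vl] := ve z; eexists; exact: hasdZ vl.
have := @borel_caratheodory _ w a _ (4 ^+ k) A (p4 k) A1 wh _ _ _ wd.
move=> /(_ _ _ _)/le_trans; apply.
- move=> z zk; rewrite mulf_neq0 ?invr_neq0//; apply/eqP => vz.
  have [j [Jj js] jz] := root_listed vH vz.
  by apply: js; apply: full => //; rewrite jz ltW.
- by rewrite /w mulVf.
- move=> z zk.
  have zk1 : N (z - a) < 4 ^+ k.+1 by apply: lt_trans zk _; rewrite exprS; have := p4 k; lra.
  have := @disc_bound_of_circle _ v a (4 ^+ k.+1 + 1) (4 ^+ k.+1) _ (z - a) (p4 k.+1) _ (@entire_hol _ v ve a _) vb zk1.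
  rewrite ltrDl ltr01 => /(_ isT); rewrite [a + _]addrC subrK => h.
  rewrite /w NM NV mulrC ler_pdivrMr//; apply: le_trans h _.
  set EE := expR (B * q ^+ k.+1); rewrite exprMn -/n.
  have EE0 : 0 < EE by exact: expR_gt0.
  have r43 : 4 ^+ k.+1 / (4 ^+ k.+1 - N (z - a)) <= 4 / 3.
    rewrite ler_pdivrMr ?subr_gt0// exprS; have := p4 k; lra.
  have p3 : 1 <= (3 : R) ^+ n by rewrite exprn_ege1// ler1n.
  have p30 : 0 < (3 : R) ^+ n by exact: lt_le_trans p3.
  apply: (@le_trans _ _ (2 * (EE / (4 ^+ k) ^+ n) * (4 / 3))).
    apply: ler_pM; rewrite ?mulr_ge0 ?divr_ge0 ?invr_ge0 ?exprn_ge0 ?(ltW EE0)//.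
    - by rewrite subr_ge0 ltW.
    - rewrite ler_pM2l// ler_pM2l// lef_pV2 ?posrE ?mulr_gt0//.
      by rewrite ler_peMl// ltW.
  have va' : N (u a) / (4 ^+ k) ^+ n <= N (v a) by rewrite ler_pdivrMr// mulrC.
  have eA : 3 / N (u a) * EE <= expR A.
    rewrite -[3 / N (u a)]lnK ?posrE ?divr_gt0// -expRD ler_expR.
    have := ler_norm (ln (3 / N (u a))); rewrite /A; lra.
  apply: (@le_trans _ _ (3 / N (u a) * EE * (N (u a) / (4 ^+ k) ^+ n))); last first.
    apply: ler_pM => //; first by rewrite mulr_ge0 ?divr_ge0 ?(ltW EE0)// ltW.
    by rewrite divr_ge0// ltW.
  have -> : 3 / N (u a) * EE * (N (u a) / (4 ^+ k) ^+ n) = 3 * (EE / (4 ^+ k) ^+ n).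
    by field; rewrite !gt_eqF.
  have : 0 <= EE / (4 ^+ k) ^+ n by rewrite divr_ge0// ltW.
  lra.
rewrite expr_div_n mulrA ler_pM2r ?invr_gt0// -mulrA ler_pM2l//.
rewrite /A /A0 exprS !mulrDl mulrA mul1r -!addrA lerD2l.
apply: lerD => //; by rewrite ler_peMr.
Qed.

(** Split the zeros according to the annuli between the radii 4 ^ (k + m) and 4 ^ (k + m + 1): by
    [count] each contributes a multiple of (q / 4) ^ (k + m). *)
Let tail : exists2 K : R, 0 <= K & forall k s, (k0 <= k)%N -> uniq s ->
  (forall j, j \in s -> J j /\ 4 ^+ k < N (nu j - a)) ->
  N (\sum_(j <- s) (a - nu j)^-1) <= K * (q / 4) ^+ k.
Proof.
have [K K0 HK] := count.
pose x := q / 4; have x0 : 0 <= x by rewrite divr_ge0.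
have x1 : x < 1 by rewrite ltr_pdivrMr// mul1r.
have x10 : 0 < 1 - x by rewrite subr_gt0.
pose L := K * q / (1 - x).
have L0 : 0 <= L by rewrite divr_ge0 ?mulr_ge0// ltW.
exists L => // k s kk us sJ.
have claim m s' : uniq s' ->
    (forall j, j \in s' -> J j /\ 4 ^+ k < N (nu j - a) <= 4 ^+ (k + m)) ->
    N (\sum_(j <- s') (a - nu j)^-1) <= L * (x ^+ k - x ^+ (k + m)).
  elim: m s' => [|m IH] s' us' s'J.
    case: s' us' s'J => [|j s'] _ H'; first by rewrite big_nil N0 addn0 subrr mulr0.
    have [_ /andP[h1 h2]] := H' j (mem_head _ _).
    by move: h1; rewrite addn0 in h2; rewrite ltNge h2.
  rewrite (bigID (fun j => N (nu j - a) <= 4 ^+ (k + m))) /=.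
  apply: le_trans (ND _ _) _.
  rewrite -[X in N X + _]big_filter -[X in _ + N X]big_filter; set s1 := [seq j <- s' | _]; set s2 := [seq j <- s' | ~~ _].
  have B1 : N (\sum_(j <- s1) (a - nu j)^-1) <= L * (x ^+ k - x ^+ (k + m)).
    apply: IH; first exact: filter_uniq.
    move=> j; rewrite mem_filter => /andP[jm /s'J[Jj /andP[jk _]]].
    by rewrite jm jk.
  have B2 : N (\sum_(j <- s2) (a - nu j)^-1) <= K * q * x ^+ (k + m).
    apply: le_trans (N_sum _ _ _) _.
    apply: (@le_trans _ _ (\sum_(j <- s2) (4 ^+ (k + m))^-1)).
      rewrite !big_seq; apply: ler_sum => j; rewrite mem_filter -ltNge => /andP[jm _].
      rewrite NV lef_pV2 ?posrE//; first by rewrite NBC ltW.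
      by rewrite NBC; exact: lt_trans jm.
    rewrite big_const_seq count_predT iter_addr addr0 -[_ *+ _]mulr_natl.
    have s2i : inside (k + m).+1 s2.
      split; first exact: filter_uniq.
      move=> j; rewrite mem_filter => /andP[_ /s'J[Jj /andP[_ jm]]].
      by rewrite -addnS.
    have := HK (k + m).+1 s2 (leqW (leq_trans kk (leq_addr _ _))) s2i => h.
    rewrite ler_pdivrMr//; apply: le_trans h _.
    rewrite exprS /x expr_div_n mulrA le_eqVlt; apply/orP; left; apply/eqP.
    by field; rewrite gt_eqF.
  apply: le_trans (lerD B1 B2) _; rewrite addnS [x ^+ (k + m).+1]exprS.
  rewrite le_eqVlt; apply/orP; left; apply/eqP; rewrite /L.
  by field; rewrite gt_eqF.
have [m Hm] : exists m, forall j, j \in s -> N (nu j - a) <= 4 ^+ (k + m).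
  elim: s us sJ => [|j s IH]; first by exists 0%N.
  rewrite /= => /andP[_ us] sJ.
  have [|m Hm] := IH us; first by move=> i js; apply: sJ; rewrite in_cons js orbT.
  pose m' := (Num.truncn (N (nu j - a))).+1.
  have Hj : N (nu j - a) <= 4 ^+ m'.
    by apply: le_trans (ltW (truncnS_gt _)) _; rewrite -natrX ler_nat ltnW// ltn_expl.
  exists (maxn m m') => i; rewrite in_cons => /predU1P[->|/Hm him].
    apply: le_trans Hj _; rewrite ler_weXn2l ?ler1n//.
    by rewrite (leq_trans (leq_maxr m m'))// leq_addl.
  by apply: le_trans him _; rewrite ler_weXn2l ?ler1n// leq_add2l leq_maxl.
apply: le_trans (claim m s us _) _.
  by move=> j js; have [Jj jk] := sJ _ js; rewrite jk Hm.
by rewrite ler_wpM2l// lerBlDr lerDl exprn_ge0.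
Qed.

(** A partial sum that contains all zeros in the disc of radius 4 ^ k consists of the part
    controlled by [log_derivative] and of a sum over zeros outside, controlled by [tail]. *)
Lemma log_derivative_series :
  series (fun j => if j \in J then (a - nu j)^-1 else 0) @ \oo --> derive1 u a / u a.
Proof.
have [K1 K10 H1] := log_derivative; have [K2 K20 H2] := tail.
have x0 : 0 <= q / 4 by rewrite divr_ge0.
have x1 : q / 4 < 1 by rewrite ltr_pdivrMr// mul1r.
apply/cvgCP => e e0.
have [n1 Hn1] := cvg0_geom (K1 + K2) x0 x1 e0.
pose k := maxn k0 n1; have kk : (k0 <= k)%N by exact: leq_maxl.
have Ke := Hn1 k (leq_maxr _ _).
have [s [ks full]] := exhaust kk.
exists (\max_(j <- s) j).+1 => // n /= nm.
have sn j : j \in s -> (j < n)%N by move=> js; apply: leq_trans nm; rewrite ltnS leq_bigmax_seq.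
rewrite /series /= -big_mkcond /= -big_filter.
set r := [seq j <- _ | _].
have ur : uniq r by rewrite filter_uniq// iota_uniq.
have rJ j : j \in r = (j \in J) && (j < n)%N by rewrite mem_filter mem_index_iota leq0n.
rewrite (bigID (mem s)) /= -[X in X + _ - _]big_filter -[X in _ + X - _]big_filter.
have -> : \sum_(j <- [seq j <- r | j \in s]) (a - nu j)^-1 = \sum_(j <- s) (a - nu j)^-1.
  apply: perm_big; apply: uniq_perm; [exact: filter_uniq|by case: ks|].
  move=> j; rewrite mem_filter rJ andbC; case js: (j \in s); rewrite ?andbF// andbT.
  by rewrite (sn _ js) andbT; apply/mem_set; have [] := ks.2 _ js.
set s2 := [seq j <- r | ~~ _].
have B2 : N (\sum_(j <- s2) (a - nu j)^-1) <= K2 * (q / 4) ^+ k.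
  apply: H2 => //; first exact: filter_uniq.
  move=> j; rewrite mem_filter rJ => /andP[js /andP[/set_mem Jj _]]; split => //.
  by rewrite ltNge; apply: contra js; exact: full.
have B1 := H1 k s kk ks full.
move: (\sum_(j <- s) _) (\sum_(j <- s2) _) (derive1 u a / u a) B1 B2 => S1 S2 T B1 B2.
have -> : S1 + S2 - T = (S1 - T) + S2 by ring.
by apply: le_lt_trans (ND _ _) _; rewrite mulrDl in Ke; lra.
Qed.

End Key.

(** * The velocity of the zeros *)

Section Assembly.
Variable R : realType.
Local Notation C := R[i].
Local Notation N := (@ComplexField.Normc.normc R).

(** On the circles |z - a| = 4 ^ k.+1 the divisor has modulus at least 1; inside, the bound
    follows from the circle. *)
Lemma growth_divide (u v : C -> C) (a : C) : entire v -> (forall z, u z = (z - a) * v z) ->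
  growth u a -> growth v a.
Proof.
move=> ve uv [B [q [k0 [B0 q1 q4 G]]]].
have q0 : 0 <= q by exact: le_trans ler01 q1.
exists (B * q + 3), q, k0; split => //; first by rewrite addr_ge0 ?mulr_ge0.
move=> k z kk zk; have p : 0 < (4 : R) ^+ k by rewrite exprn_gt0.
have p' : 0 < (4 : R) ^+ k.+1 by rewrite exprn_gt0.
have zk' : N (z - a) < 4 ^+ k.+1 by apply: le_lt_trans zk _; rewrite exprS; lra.
have vb w : N (w - a) = 4 ^+ k.+1 -> N (v w) <= expR (B * q ^+ k.+1).
  move=> wk; have := G k.+1 w (leqW kk); rewrite wk lexx uv NM wk => /(_ isT).
  by apply: le_trans; rewrite ler_peMl ?N_ge0// exprn_ege1// ler1n.
have := @disc_bound_of_circle _ v a (4 ^+ k.+1 + 1) (4 ^+ k.+1) _ (z - a) p' _ (@entire_hol _ v ve a _) vb zk'.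
rewrite ltrDl ltr01 => /(_ isT); rewrite [a + _]addrC subrK => /le_trans; apply.
set E := expR _; have E0 : 0 < E by exact: expR_gt0.
have r43 : 4 ^+ k.+1 / (4 ^+ k.+1 - N (z - a)) <= 2.
  rewrite ler_pdivrMr ?subr_gt0//; move: zk; rewrite exprS; lra.
apply: (@le_trans _ _ (2 * E * 2)).
  by rewrite ler_pM2l// mulr_gt0.
apply: (@le_trans _ _ (E * expR 3)).
  have := expR_ge1Dx (3 : R); rewrite mulrAC [E * _]mulrC ler_pM2r//; lra.
rewrite /E -expRD ler_expR exprS mulrDl mulrA lerD2l.
by rewrite ler_peMr// exprn_ege1.
Qed.

Section Velocity.
Variables (P : C -> C -> C) (mu : C -> C) (t l : C).
Hypotheses (PE : ent2 P) (mut : hasd mu t l).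
Hypothesis Ppde : forall t m, D1 P t m = 2 * D2 P t m + 4 * m * D2 (D2 P) t m.
Hypothesis Pmu : exists2 d : R, 0 < d & forall s, N (s - t) < d -> P s (mu s) = 0.
Hypothesis simple : D2 P t (mu t) != 0.

(** Differentiate P s (mu s) = 0 at [t] and substitute the equation of [P]. *)
Lemma branch_velocity : l = - 2 - 4 * mu t * (D2 (D2 P) t (mu t) / D2 P t (mu t)).
Proof.
have H := hasd_curve PE (hasd_id t) mut.
have Z : hasd (fun s => P s (mu s)) t 0.
  have [d d0 dP] := Pmu; apply: (hasd_ext _ (hasd_cst 0 t)).
  by exists d => // s sd; rewrite dP.
have := hasd_unique H Z; rewrite mulr1 Ppde => {H Z}.
move: (mu t) (D2 (D2 P) t (mu t)) (D2 P t (mu t)) simple => m y x x0 e.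
apply: (mulfI x0); have -> : x * l = - (2 * x + 4 * m * y) by rewrite -[RHS]add0r -e; ring.
by field.
Qed.

End Velocity.

Lemma second_derivative_factor (P : C -> C -> C) (t a : C) (v : C -> C) : entire v ->
  (forall z, P t z = (z - a) * v z) ->
  D2 P t a = v a /\ D2 (D2 P) t a = 2 * derive1 v a.
Proof.
move=> ve Pv; have PtE : P t = (fun z => (z - a) * v z) by apply/funext.
have E : D2 P t = derive1 (P t) by apply/funext => z; rewrite D2E.
have H n := derive1n_linear_factor a n a ve.
split; rewrite D2E; first by have := H 0%N; rewrite -PtE subrr mul0r add0r mul1r.
by rewrite E; have := H 1%N; rewrite -PtE subrr mul0r add0r.
Qed.

(** With the zero [nu k] divided out, the function still has order less than one, and its
    logarithmic derivative at [nu k] is half the quotient of the second by the first derivative. *)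
Lemma other_zeros_sum (P : C -> C -> C) (t : C) (J : set nat) (nu : nat -> C) (k : nat) :
  ent2 P -> growth (P t) 0 -> lists_zeros (P t) J nu -> J k -> D2 P t (nu k) != 0 ->
  (forall j, J j -> j <> k -> nu j <> nu k) /\
  other_zeros_series J nu k @ \oo --> D2 (D2 P) t (nu k) / (2 * D2 P t (nu k)).
Proof.
move=> PE Pg H Jk P2.
have Pe : entire (P t) by move=> w; exists (D2 P t w); exact: hasd_D2.
have [v [ve Pv vH]] := lists_zeros_divide Pe H Jk.
have [E1 E2] := second_derivative_factor ve Pv.
rewrite {}E1 in P2 *; rewrite {}E2; split.
  move=> j Jj jk jE; move: P2; rewrite -jE => /eqP; apply.
  exact: lists_zeros_root vH _.
have [B [q [k0 [B0 q1 q4 G]]]] := growth_divide ve Pv (growth_center (nu k) Pg).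
have := log_derivative_series ve P2 vH B0 q1 q4 G.
move: (derive1 v (nu k)) (v (nu k)) P2 => x y y0.
by have -> : 2 * x / (2 * y) = x / y by field.
Qed.

End Assembly.

Theorem mainTheorem8 (R : realType) (F : R[i] -> R[i] -> R[i])
    (F_entire : entire2 F)
    (F_neq0 : exists t z : R[i], F t z != 0)
    (F_heat : heat_equation F)
    (F0_even : forall z : R[i], F 0 (- z) = F 0 z)
    (F_order : (z_order F < 2%:E)%E) :
  (forall t z : R[i], F t (- z) = F t z) /\
  exists Phi : R[i] -> R[i] -> R[i],
    [/\ entire2 Phi,
        (forall t z : R[i], F t z = Phi t (z ^+ 2)) &
        forall (D : set R[i]) (mu : R[i] -> R[i]),
          domain D ->
          holomorphic_on D mu ->
          (forall t : R[i], D t -> Phi t (mu t) = 0) ->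
          exists E : set R[i],
            discrete_subset E D /\
            forall t : R[i], D t -> ~ E t ->
            forall (J : set nat) (nu : nat -> R[i]) (k : nat),
              lists_zeros (Phi t) J nu ->
              J k -> nu k = mu t ->
              [/\ (forall j : nat, J j -> j <> k -> nu j <> mu t),
                  cvgn (other_zeros_series J nu k) &
                  derive1 mu t =
                    - 2 - 8 * mu t * limn (other_zeros_series J nu k)]].
Proof.
have FE := entire2_ent2 F_entire; have FH := heat_equationP F_heat.
have Fev := heat_even FE FH F0_even; split => //.
pose Phi := Phi_of F; have PE : ent2 Phi by exact: ent2_Phi.
have Ppde := Phi_pde FE Fev FH.
exists Phi; split; [exact: ent2_entire2|by move=> t z; rewrite /Phi PhiE|].
move=> D mu [oD cD [t0 Dt0]] muh Pmu.
have mud t : D t -> hasd mu t (derive1 mu t) by move=> /muh/derivable_hasd.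
pose g t := D2 Phi t (mu t).
have gd t : D t -> exists l, hasd g t l.
  by move=> Dt; eexists; exact: hasd_curve (ent2_D2 PE) (hasd_id t) (mud _ Dt).
(* If all zeros of the branch were multiple, F would vanish identically. *)
have [g0|g0] := identity_domain oD cD gd.
  have [r r0 rD] := open_ball oD Dt0; have [t [z /eqP[]]] := F_neq0.
  have muhr : hol mu t0 r by move=> w /rD/mud; exists (derive1 mu w).
  have [t2 Pt2] := @multiple_branch R Phi PE Ppde mu t0 r r0 muhr
    (fun t tr => Pmu t (rD t tr)) (fun t tr => g0 t (rD t tr)).
  by apply: (heat_zero FE FH) => w; rewrite -(PhiE Fev).
exists [set t | D t /\ g t = 0]; split.
  split => [t []//|t Dt lim]; have [d d0 gn] := g0 t Dt.
  have nb : nbhs t [set y | ComplexField.Normc.normc (y - t) < d] by apply/cnbhsP; exists d.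
  by have [y [yt [_ gy] /= yd]] := lim _ nb; have := gn y yt yd; rewrite gy eqxx.
move=> t Dt nEt J nu k H Jk nk.
have gt0 : D2 Phi t (nu k) != 0 by rewrite nk; apply/eqP => gt; apply: nEt.
have [simple cv] := other_zeros_sum PE (Phi_growth t FE FH F_order) H Jk gt0.
rewrite nk in simple cv gt0.
split; [exact: simple|exact: cvgP cv|].
rewrite (cvg_lim (@norm_hausdorff _ _) cv).
have [r r0 rD] := open_ball oD Dt.
have Pr : exists2 d : R, 0 < d & forall s, ComplexField.Normc.normc (s - t) < d -> Phi s (mu s) = 0.
  by exists r => // s /rD/Pmu.
rewrite (branch_velocity PE (mud _ Dt) Ppde Pr gt0).
move: (mu t) (D2 (D2 Phi) t (mu t)) (D2 Phi t (mu t)) gt0 => m y x x0.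
by field.
Qed.
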